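(* Let $d=3$, $\beta>0$, $\rho=\rho_{\mathrm c}=(4\pi\beta)^{-3/2}\zeta(3/2)$, and assume $\lambda_1>0$. Then, under $\mathbb P_{L,\beta,\rho_{\mathrm c}L^3}$, $$\frac{\mathcal N_L-\mathbb E[\mathcal N_L]}{\beta^{-1}L^2}\xrightarrow[L\to\infty]{(d)}\chi_\zeta ,$$ where $\chi_\zeta$ is a random variable whose characteristic function is given by the second regularized Fredholm determinant $$\psi(t)=\det\nolimits_2\big(\mathrm{Id}-it(-\Delta)^{-1}\big)^{-1},\qquad t\in\mathbb R .$$ Furthermore, $\chi_\zeta$ can be represented as an infinite sum of independent recentered Gamma random variables: $$\chi_\zeta=\sum_{k\ge1}\Big(\mathrm{Gamma}(1,\lambda_k)-\frac1{\lambda_k}\Big).$$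
   Context: Setting ($d=3$). $\Lambda$ is either the torus $\mathbb T^3$ or a compact region in $\mathbb R^3$, with unit volume $|\Lambda|=1$. $\Delta$ is the Laplacian on $\Lambda$ (with Dirichlet, Neumann, Robin or mixed Dirichlet--Robin boundary conditions if $\Lambda$ has a boundary). The operator $-\Delta\ge 0$ has eigenvalues $0\le\lambda_1<\lambda_2\le\lambda_3\le\dots$ (with multiplicity). Let $Z(t)=\sum_{k\ge1}e^{-\lambda_kt}$, which satisfies $Z(t)=a_0t^{-3/2}+a_1t^{-1}+a_2t^{-1/2}+O(1)$ as $t\to0$, $a_0=(4\pi)^{-3/2}$. Loop soup. $\Lambda_L=L\Lambda$, and $\mathbb P_{L,\beta,N}$ is the Poisson point process of loops with intensity measure $\sum_{j=1}^{N}\frac1j\int_{\Lambda_L}dx\,\mathbb P^{(L)}_{x,x,\beta j}$, where $\mathbb P^{(L)}_{x,x,t}$ is the unnormalized Brownian bridge (loop) measure of duration $t$ at $x$ in $\Lambda_L$ (generator $\Delta$). A loop coming from the $j$-th term has length $j$. Hence under $\mathbb P_{L,\beta,N}$ the numbers $C_j$ of loops of length $j$, $1\le j\le N$, are independent Poisson variables with means $t_j/j$, $t_j=Z(\beta jL^{-2})$, and the total particle number is $\mathcal N_L=\sum_{j=1}^{N}jC_j$. Limits are along $L$ with $\rho_{\mathrm c}L^3\in\mathbb N$. Conventions. $\mathrm{Gamma}(1,\lambda)$ has shape $1$ and rate $\lambda$ (mean $1/\lambda$). For a Hilbert--Schmidt operator $A$ with eigenvalues $(\kappa_k)$, $\det_2(\mathrm{Id}+A)=\prod_k(1+\kappa_k)e^{-\kappa_k}$.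 *)

(* Defs.v *)
From HB Require Import structures.
From mathcomp Require Import all_boot all_order all_algebra.
From mathcomp Require Import complex.
From mathcomp Require Import all_classical all_reals all_analysis.
Set Implicit Arguments.
Unset Strict Implicit.
Unset Printing Implicit Defensive.
Import Order.TTheory GRing.Theory Num.Theory.
Import numFieldNormedType.Exports.
Local Open Scope classical_set_scope.
Local Open Scope ring_scope.

Notation E3 R := (R * R * R)%type.

(* Lebesgue measure for the default Borel structure of R (the library states
   it for the alias measurableTypeR R, which has another display). *)
Definition leb (R : realType) : set R -> \bar R := @lebesgue_measure R.
HB.instance Definition _ (R : realType) := isMeasure.Build _ R R (@leb R)
  (measure0 (@lebesgue_measure R)) (measure_ge0 (@lebesgue_measure R))
  (@measure_semi_sigma_additive _ _ _ (@lebesgue_measure R)).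
HB.instance Definition _ (R : realType) :=
  @Measure_isSigmaFinite.Build _ R R (@leb R)
    (sigma_finiteT (@lebesgue_measure R)).

Definition vol (R : realType) : {measure set (E3 R) -> \bar R} :=
  ((@leb R \x @leb R) \x @leb R)%E.

Definition dot3 (R : realType) (x y : E3 R) : R :=
  x.1.1 * y.1.1 + x.1.2 * y.1.2 + x.2 * y.2.

Definition grad (R : realType) (f : E3 R -> R) (x : E3 R) : E3 R :=
  (('D_((1, 0, 0) : E3 R) f x, 'D_((0, 1, 0) : E3 R) f x),
   'D_((0, 0, 1) : E3 R) f x).

Definition C1 (R : realType) (f : E3 R -> R) : Prop :=
  (forall x, differentiable f x) /\
  (forall v : E3 R, continuous (fun x => 'D_v f x)).

Definition dilate (R : realType) (L : R) (V : set (E3 R)) : set (E3 R) :=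
  [set L *: x | x in V].

(* [Region Lam GamD alpha sigma] carries Dirichlet conditions on the part
   [GamD] of the boundary of [Lam] and Robin conditions
   d_nu u + alpha u = 0 on the rest of it; [sigma] is the surface measure.
   Dirichlet: GamD = boundary.  Robin: GamD = set0.  Neumann: GamD = set0 and
   alpha = 0.  Functions on the torus are encoded by their restriction to a
   fundamental cell. *)
Inductive domain (R : realType) :=
| Torus
| Region (Lam GamD : set (E3 R)) (alpha : E3 R -> R)
    (sigma : {measure set (E3 R) -> \bar R}).
Arguments Torus {R}.

Definition carrier (R : realType) (D : domain R) : set (E3 R) :=
  match D with
  | Torus => [set x | [/\ 0 <= x.1.1 < 1, 0 <= x.1.2 < 1 & 0 <= x.2 < 1]]
  | Region Lam _ _ _ => Lam
  end.

Definition periodic3 (R : realType) (L : R) (f : E3 R -> R) : Prop :=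
  forall x, [/\ f (x + ((L, 0, 0) : E3 R)) = f x,
                f (x + ((0, L, 0) : E3 R)) = f x &
                f (x + ((0, 0, L) : E3 R)) = f x].

Definition descends (R : realType) (D : domain R) (L : R) (f : E3 R -> R)
  : Prop :=
  match D with Torus => periodic3 L f | Region _ _ _ _ => True end.

(* The surface measure and the outer unit normal [nu] are characterized by the
   Gauss--Green formula (here, finite perimeter in the sense of De Giorgi). *)
Definition surface_measure (R : realType) (Lam : set (E3 R))
    (sigma : {measure set (E3 R) -> \bar R}) : Prop :=
  [/\ (sigma setT < +oo)%E,
      sigma (~` (Lam `\` Lam°)) = 0%E &
      exists nu : E3 R -> E3 R,
        [/\ measurable_fun setT nu,
            {ae sigma, forall x, dot3 (nu x) (nu x) = 1} &
            forall (f : E3 R -> R) (v : E3 R), C1 f ->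
              (\int[vol R]_(x in Lam) ('D_v f x))%R =
              (\int[sigma]_x (f x * dot3 (nu x) v))%R]].

Definition admissible (R : realType) (D : domain R) : Prop :=
  match D with
  | Torus => True
  | Region Lam GamD alpha sigma =>
    [/\ [/\ compact Lam, closure (Lam°) = Lam & connected (Lam°)],
        vol R Lam = 1%E,
        surface_measure Lam sigma,
        closed GamD /\ GamD `<=` Lam `\` Lam° &
        measurable_fun setT alpha /\ exists M, forall x, `|alpha x| <= M]
  end.

Definition L2fun (R : realType) (V : set (E3 R)) (u : E3 R -> R) : Prop :=
  measurable_fun V u /\ (\int[vol R]_(x in V) ((u x ^+ 2)%:E) < +oo)%E.

Definition L2dot (R : realType) (V : set (E3 R)) (u v : E3 R -> R) : R :=
  (\int[vol R]_(x in V) (u x * v x))%R.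

Definition test_fun (R : realType) (D : domain R) (f : E3 R -> R) : Prop :=
  [/\ C1 f, descends D 1 f &
      match D with
      | Torus => True
      | Region _ GamD _ _ =>
        exists U : set (E3 R),
          [/\ open U, GamD `<=` U & forall x, U x -> f x = 0]
      end].

Definition dform (R : realType) (D : domain R) (u v : E3 R -> R) : R :=
  (\int[vol R]_(x in carrier D) dot3 (grad u x) (grad v x))%R +
  match D with
  | Torus => 0
  | Region _ GamD alpha sigma =>
    (\int[sigma]_(x in ~` GamD) (alpha x * u x * v x))%R
  end.

(* [dform] with [alpha] replaced by its absolute value, so that together with
   the L2 norm it controls the form norm whatever the sign of [alpha]. *)
Definition energy (R : realType) (D : domain R) (u : E3 R -> R) : R :=
  (\int[vol R]_(x in carrier D) dot3 (grad u x) (grad u x))%R +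
  match D with
  | Torus => 0
  | Region _ GamD alpha sigma =>
    (\int[sigma]_(x in ~` GamD) (`|alpha x| * u x ^+ 2))%R
  end.

(* Graph of -Delta: u belongs to the domain of the closure of [dform] on test
   functions and dform u v = <f, v> for all test functions v. *)
Definition neg_laplacian (R : realType) (D : domain R) (u f : E3 R -> R)
  : Prop :=
  [/\ L2fun (carrier D) u, L2fun (carrier D) f &
   exists w : nat -> E3 R -> R,
   [/\ forall n, test_fun D (w n),
       (fun n => L2dot (carrier D) (w n \- u) (w n \- u)) @ \oo --> (0 : R),
       forall eps : R, 0 < eps -> exists M : nat, forall m n : nat,
         (M <= m)%N -> (M <= n)%N -> energy D (w m \- w n) < eps &
       forall v, test_fun D v ->
         (fun n => dform D (w n) v) @ \oo --> L2dot (carrier D) f v]].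

Definition orthonormal_basis (R : realType) (V : set (E3 R))
    (e : nat -> E3 R -> R) : Prop :=
  [/\ forall k, L2fun V (e k),
      forall j k, L2dot V (e j) (e k) = (j == k)%:R &
      forall u, L2fun V u -> (forall k, L2dot V u (e k) = 0) ->
        {ae vol R, forall x, V x -> u x = 0}].

(* [lam k] is the eigenvalue written lambda_(k+1) in the literature. *)
Definition laplace_spectrum (R : realType) (D : domain R) (lam : nat -> R)
    (e : nat -> E3 R -> R) : Prop :=
  [/\ orthonormal_basis (carrier D) e,
      forall k, neg_laplacian D (e k) (fun x => lam k * e k x),
      0 <= lam 0%N, lam 0%N < lam 1%N &
      forall k, lam k <= lam k.+1].

Definition heat_trace (R : realType) (lam : nat -> R) (t : R) : \bar R :=
  (\sum_(0 <= k <oo) (expR (- lam k * t))%:E)%E.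

Definition heat_trace_expansion (R : realType) (lam : nat -> R) : Prop :=
  exists a1 a2 M : R, \forall t \near 0^'+,
    (`| heat_trace lam t
        - ((4 * pi) `^ (- (3 / 2)) * t `^ (- (3 / 2))
           + a1 * t^-1 + a2 * t `^ (- (1 / 2)))%:E | <= M%:E)%E.

Definition heat_kernel (R : realType) (lam : nat -> R) (e : nat -> E3 R -> R)
    (t : R) (x y : E3 R) : R :=
  limn (series (fun k => expR (- lam k * t) * e k x * e k y)).

(* Kernel of exp(t Delta) on the dilated domain, boundary conditions being
   transported by x |-> x / L: the eigenpairs there are lam_k / L^2 and
   L^(-3/2) e_k(x / L). *)
Definition dilated_heat_kernel (R : realType) (lam : nat -> R)
    (e : nat -> E3 R -> R) (L t : R) (x y : E3 R) : R :=
  L ^- 3 * heat_kernel lam e (t / L ^+ 2) (L^-1 *: x) (L^-1 *: y).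

Definition path_continuous (R : realType) (D : domain R) (L : R)
    (g : R -> E3 R) : Prop :=
  forall f : E3 R -> R, continuous f -> descends D L f -> continuous (f \o g).

Lemma path_continuous0 (R : realType) (D : domain R) (L : R) :
  path_continuous D L (fun=> (0 : E3 R)).
Proof. by move=> f _ _ s; exact: cst_continuous. Qed.

(* Continuous paths in the dilated domain; on the torus, continuity is modulo
   the lattice L Z^3.  A path of duration t is encoded by its extension to the
   whole line that is constant on ]-oo, 0] and on [t, +oo[. *)
Definition cpath (R : realType) (D : domain R) (L : R) : Type :=
  {g : R -> E3 R | path_continuous D L g}.

Section cpath_instances.
Context (R : realType) (D : domain R) (L : R).
HB.instance Definition _ := gen_eqMixin (cpath D L).
HB.instance Definition _ := gen_choiceMixin (cpath D L).
HB.instance Definition _ :=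
  isPointed.Build (cpath D L) (exist _ _ (@path_continuous0 R D L)).
End cpath_instances.

Definition cylinders (R : realType) (D : domain R) (L : R)
  : set (set (cpath D L)) :=
  [set B | exists (s : R) (A : set (E3 R)),
     measurable A /\ B = [set g : cpath D L | A (sval g s)]].

Definition loop_path (R : realType) (D : domain R) (L : R) :=
  g_sigma_algebraType (@cylinders R D L).

HB.instance Definition _ (R : realType) (D : domain R) (L : R) :=
  Measurable.on (@loop_path R D L).

Definition loop (R : realType) (D : domain R) (L : R) :=
  (nat * loop_path D L)%type.

HB.instance Definition _ (R : realType) (D : domain R) (L : R) :=
  Measurable.on (@loop R D L).

(* Unnormalized mass of the bridge from (s, z) to (t, y) with prescribed
   positions at the times listed in [cs]. *)
Fixpoint bridge_fdd (R : realType) (V : set (E3 R))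
    (p : R -> E3 R -> E3 R -> R) (t : R) (y : E3 R)
    (cs : seq (R * set (E3 R))) (s : R) (z : E3 R) : \bar R :=
  match cs with
  | [::] => (p (t - s) z y)%:E
  | (s1, A) :: cs' =>
    (\int[vol R]_(z1 in V `&` A)
       ((p (s1 - s)%R z z1)%:E * bridge_fdd V p t y cs' s1 z1))%E
  end.

Definition bridge_measure (R : realType) (D : domain R) (L : R)
    (p : R -> E3 R -> E3 R -> R) (t : R) (x : E3 R)
    (Q : {measure set (loop_path D L) -> \bar R}) : Prop :=
  (forall s, s <= 0 \/ t <= s ->
     Q [set g : loop_path D L | sval g s <> x] = 0%E) /\
  (forall cs : seq (R * set (E3 R)),
     sorted <%R (rcons (0 :: unzip1 cs) t) ->
     (forall c, c \in cs -> measurable c.2) ->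
     Q [set g : loop_path D L | forall c, c \in cs -> c.2 (sval g c.1)] =
     bridge_fdd (dilate L (carrier D)) p t x cs 0 x).

Definition brownian_loop_measure (R : realType) (D : domain R)
    (lam : nat -> R) (e : nat -> E3 R -> R) (L t : R)
    (Q : R.-ker (E3 R) ~> loop_path D L) : Prop :=
  {ae vol R, forall x, dilate L (carrier D) x ->
     bridge_measure (dilated_heat_kernel lam e L) t x (Q x)}.

Definition loop_intensity (R : realType) (D : domain R) (L : R) (N : nat)
    (Q : nat -> R.-ker (E3 R) ~> loop_path D L) (A : set (loop D L))
  : \bar R :=
  (\sum_(1 <= j < N.+1) (j%:R^-1)%:E *
     \int[vol R]_(x in dilate L (carrier D)) Q j x (xsection A j))%E.

(* Point configurations are finite, since only finite intensities occur. *)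
Definition poisson_process (R : realType) d (Omega : measurableType d)
    (P : probability Omega R) d' (T : measurableType d') (mu : set T -> \bar R)
    (eta : Omega -> seq T) : Prop :=
  let n A w := count (mem (A : set T)) (eta w) in
  [/\ forall A k, measurable A -> measurable [set w | n A w = k],
      forall A k, measurable A ->
        P [set w | n A w = k] =
        (expR (- fine (mu A)) * fine (mu A) ^+ k / k`!%:R)%:E &
      forall m (A : 'I_m -> set T) (k : 'I_m -> nat),
        (forall i, measurable (A i)) -> trivIset setT A ->
        P [set w | forall i, n (A i) w = k i] =
        (\prod_(i < m) P [set w | n (A i) w = k i])%E].

Definition loop_count (R : realType) (D : domain R) (L : R)
    (s : seq (loop D L)) (j : nat) : nat := count (fun l => l.1 == j) s.

Definition particle_number (R : realType) (D : domain R) (L : R) (N : nat)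
    (s : seq (loop D L)) : nat := (\sum_(1 <= j < N.+1) j * loop_count s j)%N.

Definition zeta (R : realType) (s : R) : R :=
  limn (series (fun n => (n.+1%:R : R) `^ (- s))).

Definition critical_density (R : realType) (beta : R) : R :=
  (4 * pi * beta) `^ (- (3 / 2)) * zeta (3 / 2).

Definition cvg_in_distribution (R : realType) (d : nat -> measure_display)
    (Omega : forall n, measurableType (d n))
    (P : forall n, probability (Omega n) R) (X : forall n, Omega n -> R)
    d' (Omega' : measurableType d') (P' : probability Omega' R)
    (chi : Omega' -> R) : Prop :=
  forall f : R -> R, continuous f -> (exists M, forall x, `|f x| <= M) ->
    (fun n => 'E_(P n)[f \o X n])%E @ \oo --> ('E_P'[f \o chi])%E.

Definition Gamma_fun (R : realType) (a : R) : R :=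
  (\int[@leb R]_(x in `[0%R, +oo[) (x `^ (a - 1) * expR (- x)))%R.

Definition gamma_pdf (R : realType) (a rate x : R) : R :=
  if 0 <= x then
    rate `^ a * x `^ (a - 1) * expR (- (rate * x)) / Gamma_fun a
  else 0.

Definition gamma_distributed (R : realType) d (Omega : measurableType d)
    (P : probability Omega R) (X : Omega -> R) (a rate : R) : Prop :=
  forall A : set R, measurable A ->
    P (X @^-1` A) = (\int[@leb R]_(x in A)
                       (gamma_pdf a rate x)%:E)%E.

Definition mutually_independent (R : realType) d (Omega : measurableType d)
    (P : probability Omega R) (X : nat -> Omega -> R) : Prop :=
  forall (s : seq nat) (A : nat -> set R), uniq s ->
    (forall k, measurable (A k)) ->
    P [set w | forall k, k \in s -> A k (X k w)] =
    (\prod_(k <- s) P (X k @^-1` A k))%E.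

Definition char_fun (R : realType) d (Omega : measurableType d)
    (P : probability Omega R) (X : Omega -> R) (t : R) : R[i] :=
  (fine 'E_P[fun w => cos (t * X w)] +i* fine 'E_P[fun w => sin (t * X w)])%C.

Definition cexp (R : realType) (z : R[i]) : R[i] :=
  ((expR (complex.Re z) * cos (complex.Im z)) +i*
   (expR (complex.Re z) * sin (complex.Im z)))%C.

Definition reF (R : realType) (u : E3 R -> R[i]) : E3 R -> R :=
  fun x => complex.Re (u x).
Definition imF (R : realType) (u : E3 R -> R[i]) : E3 R -> R :=
  fun x => complex.Im (u x).

Definition cL2fun (R : realType) (V : set (E3 R)) (u : E3 R -> R[i]) : Prop :=
  L2fun V (reF u) /\ L2fun V (imF u).

(* The integral of u times the conjugate of v. *)
Definition cL2dot (R : realType) (V : set (E3 R)) (u v : E3 R -> R[i])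
  : R[i] :=
  ((L2dot V (reF u) (reF v) + L2dot V (imF u) (imF v)) +i*
   (L2dot V (imF u) (reF v) - L2dot V (reF u) (imF v)))%C.

Definition corthonormal_basis (R : realType) (V : set (E3 R))
    (e : nat -> E3 R -> R[i]) : Prop :=
  [/\ forall k, cL2fun V (e k),
      forall j k, cL2dot V (e j) (e k) = (j == k)%:R &
      forall u, cL2fun V u -> (forall k, cL2dot V u (e k) = 0) ->
        {ae vol R, forall x, V x -> u x = 0}].

(* Operators are given by their graphs. *)
Definition operator (R : realType) :=
  (E3 R -> R[i]) -> (E3 R -> R[i]) -> Prop.

Definition cneg_laplacian (R : realType) (D : domain R) : operator R :=
  fun u f => neg_laplacian D (reF u) (reF f) /\ neg_laplacian D (imF u) (imF f).

Definition op_inv (R : realType) (A : operator R) : operator R :=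
  fun u v => A v u.

Definition op_scale (R : realType) (c : R[i]) (A : operator R) : operator R :=
  fun u v => exists2 w, A u w & v = (fun x => c * w x).

(* [is_det2 V A z]: A is a diagonalizable Hilbert--Schmidt operator on the
   complex L2 space of V and z = det_2 (Id + A). *)
Definition is_det2 (R : realType) (V : set (E3 R)) (A : operator R) (z : R[i])
  : Prop :=
  exists (kappa : nat -> R[i]) (e : nat -> E3 R -> R[i]),
    [/\ corthonormal_basis V e,
        forall k, A (e k) (fun x => kappa k * e k x),
        cvgn (series (fun k => complex.Re (kappa k) ^+ 2
                               + complex.Im (kappa k) ^+ 2)) &
        (fun n => \prod_(k < n) ((1 + kappa k) * cexp (- kappa k)) : R[i]^o)
          @ \oo --> (z : R[i]^o)].

(* Main.v *)
Require Import Defs.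
From HB Require Import structures.
From mathcomp Require Import all_boot all_order all_algebra.
From mathcomp Require Import complex.
From mathcomp Require Import all_classical all_reals all_analysis.
From mathcomp Require Import measurable_realfun.
From mathcomp Require Import ring lra.
Import Order.TTheory GRing.Theory Num.Theory.
Import numFieldNormedType.Exports.
Local Open Scope classical_set_scope.
Local Open Scope ring_scope.
Set Implicit Arguments.
Unset Strict Implicit.
Unset Printing Implicit Defensive.

(* Put h = beta / L^2, q_k = exp(- lambda_k h) and a_j = Z(h j) = sum_k q_k^j.
   The law p of the particle number solves the Panjer recursion
   m p_m = sum_(1 <= j <= N) a_j p_(m-j), and the law of a sum of K independent
   geometric variables of parameters q_k solves the same recursion with a_j
   replaced by sum_(k < K) q_k^j and no cut-off at N.  Hence the two laws
   differ by at most sum_(j <= N) (a_j - sum_(k < K) q_k^j) +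
   sum_(k < K) q_k^(N+1), which tends to 0 for K large enough, because
   h N = beta rho_c L tends to infinity.  A geometric variable is the integer
   part of G_k / h, G_k exponential of rate lambda_k; so h times the centred
   geometric sum converges in L^2 to sum_k (G_k - 1 / lambda_k), a series
   which converges almost surely because sum_k lambda_k^-2 is finite, by the
   heat trace expansion.  The characteristic functions of its partial sums are
   the inverses of the partial products of the determinant, and their moduli are
   bounded below, so that the inversion passes to the limit. *)

(** * Convolution and Panjer recursion *)

(** The cut-off N is of order L^3, far beyond the diffusive time L^2, and the first eigenvalue is
    positive; hence the loops cut off cost only Z(h (N+1)), which decays exponentially in h N.
    Closeness of two laws says nothing about their means, so the centring is a separate obstacle:
    E[N_L] is the sum of Z(h j) over j <= N, the geometric sum has mean sum_(k < K) q_k / (1 - q_k),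
    and [bias] measures the gap between them, controlled by the same two errors. [K] is chosen for
    each n after h and N, which keeps every convolution finite. The limit lives on the unit interval
    with Lebesgue measure: alternate binary digits of one uniform point form two independent uniform
    points, and iteration gives a sequence. The digits left over are again a uniform point, so a
    statement on m summands is proved by integrating out the first one. [chi] is fixed there once
    and for all while the geometric variables vary with n; this turns convergence in law into an L^2
    estimate. The constant 32 is a crude second moment bound for an exponential variable of rate
    1. *)

Definition conv {R : realType} (f g : nat -> R) (m : nat) : R :=
  \sum_(i < m.+1) f i * g (m - i)%N.

(** Cauchy products are coefficients of products of truncated polynomials; commutativity and
    associativity are then inherited from the polynomial ring. *)
Lemma conv_coef {R : realType} (f g : nat -> R) (n m : nat) : (m < n)%N ->
  conv f g m = ((\poly_(i < n) f i) * (\poly_(i < n) g i))`_m.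
Proof.
move=> mn; rewrite coefM; apply: eq_bigr => i _; rewrite !coef_poly.
by rewrite (leq_ltn_trans _ mn) ?leq_ord// (leq_ltn_trans (leq_subr _ _) mn).
Qed.

Lemma convC {R : realType} (f g : nat -> R) : conv f g = conv g f.
Proof. by apply/funext => m; rewrite !(conv_coef _ _ (ltnSn m)) mulrC. Qed.

Lemma convA {R : realType} (f g k : nat -> R) :
  conv f (conv g k) = conv (conv f g) k.
Proof.
apply/funext => m.
have E (F G H : nat -> R) : conv F (conv G H) m =
    ((\poly_(i < m.+1) F i) *
      ((\poly_(i < m.+1) G i) * (\poly_(i < m.+1) H i)))`_m.
  rewrite coefM; apply: eq_bigr => i _; rewrite coef_poly ltn_ord.
  by rewrite (conv_coef _ _ (leq_subr _ _ : (m - i < m.+1)%N)).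
(* Commutativity puts the right-hand side in the nested form that [E] handles, with [k] in front. *)
rewrite E [RHS](congr1 (fun h => h m) (convC _ _)) E.
by congr (_`_m); rewrite mulrA mulrC.
Qed.

Lemma convDl {R : realType} (f g k : nat -> R) :
  conv (fun i => f i + g i) k = (fun i => conv f k i + conv g k i).
Proof.
by apply/funext => m; rewrite -big_split; apply: eq_bigr => i _; rewrite mulrDl.
Qed.

Lemma conv_ge0 {R : realType} (f g : nat -> R) :
  (forall i, 0 <= f i) -> (forall i, 0 <= g i) -> forall i, 0 <= conv f g i.
Proof. by move=> f0 g0 i; apply: sumr_ge0 => j _; rewrite mulr_ge0. Qed.

Lemma conv0 {R : realType} (f g : nat -> R) : conv f g 0 = f 0%N * g 0%N.
Proof. by rewrite /conv big_ord1. Qed.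

(** Partial sums are the values at 1 of the truncated polynomials, whose product has at most [n + n]
    coefficients. *)
Lemma series_conv_poly {R : realType} (f g : nat -> R) (n : nat) :
  series f n * series g n =
  \sum_(m < n + n) ((\poly_(i < n) f i) * (\poly_(i < n) g i))`_m.
Proof.
have E (h : nat -> R) : series h n = (\poly_(i < n) h i).[1].
  by rewrite horner_poly /series/= big_mkord; apply: eq_bigr => i _; rewrite expr1n mulr1.
rewrite !E -hornerM; apply: etrans (horner_coef_wide _ _) _; last first.
  by apply: eq_bigr => i _; rewrite expr1n mulr1.
apply: leq_trans (size_polyMleq _ _) _.
apply: leq_trans (leq_pred _) _.
by apply: leq_add; exact: size_poly.
Qed.

(** For nonnegative terms the square i, j < n lies between the triangles i + j < n and i + j < 2n.
    This inclusion and its counterpart [series_conv_le] squeeze the Cauchy product. *)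
Lemma series_conv_ge {R : realType} (f g : nat -> R) (n : nat) :
  (forall i, 0 <= f i) -> (forall i, 0 <= g i) ->
  series f n * series g n <= series (conv f g) (n + n).
Proof.
move=> f0 g0; rewrite series_conv_poly /series/= big_mkord.
apply: ler_sum => i _; rewrite coefM; apply: ler_sum => j _; rewrite !coef_poly.
by do 2 case: ifP => _; rewrite ?mulr0 ?mul0r// mulr_ge0.
Qed.

Lemma series_conv_le {R : realType} (f g : nat -> R) (n : nat) :
  (forall i, 0 <= f i) -> (forall i, 0 <= g i) ->
  series (conv f g) n <= series f n * series g n.
Proof.
move=> f0 g0; rewrite series_conv_poly -(big_mkord xpredT (fun m => _`_m)).
rewrite (@big_cat_nat _ _ _ n)//= ?leq_addr// -[leLHS]addr0 lerD//.
  rewrite /series/= le_eqVlt; apply/orP; left; apply/eqP.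
  by apply: eq_big_nat => i /andP[_ ?]; exact: conv_coef.
apply: sumr_ge0 => i _; rewrite coefM; apply: sumr_ge0 => j _; rewrite !coef_poly.
by do 2 case: ifP => _; rewrite ?mulr0 ?mul0r// mulr_ge0.
Qed.

Lemma cvg_series_conv {R : realType} (f g : nat -> R) (a b : R) :
  (forall i, 0 <= f i) -> (forall i, 0 <= g i) ->
  series f @ \oo --> a -> series g @ \oo --> b ->
  series (conv f g) @ \oo --> a * b.
Proof.
move=> f0 g0 fa gb.
have ub n : series (conv f g) n <= a * b.
  apply: le_trans (series_conv_le _ f0 g0) _.
  have s0 (h : nat -> R) : (forall i, 0 <= h i) -> 0 <= series h n.
    by move=> h0; apply: sumr_ge0.
  have sle (h : nat -> R) (c : R) : (forall i, 0 <= h i) -> series h @ \oo --> c -> series h n <= c.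
    move=> h0 hc; rewrite -(cvg_lim _ hc)//.
    apply: nondecreasing_cvgn_le; last by apply/cvg_ex; exists c.
    by apply/nondecreasing_seqP => k; rewrite /series/= big_nat_recr//= lerDl.
  by apply: ler_pM; [exact: s0|exact: s0|exact: sle|exact: sle].
have nd : nondecreasing_seq (series (conv f g)).
  by apply/nondecreasing_seqP => k; rewrite /series/= big_nat_recr//= lerDl conv_ge0.
have cv : cvgn (series (conv f g)).
  by apply: nondecreasing_is_cvgn => //; exists (a * b) => _ [n _ <-]; exact: ub.
have L1 : limn (series (conv f g)) <= a * b.
  by apply: limr_le => //; near=> n; exact: ub.
have L2 : a * b <= limn (series (conv f g)).
  have <- : limn (series f \* series g) = a * b by apply/cvg_lim => //; exact: cvgM.
  apply: limr_le; first by apply/cvg_ex; exists (a * b); exact: cvgM.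
  near=> n; apply: le_trans (series_conv_ge n f0 g0) _.
  exact: nondecreasing_cvgn_le.
have <- : limn (series (conv f g)) = a * b by apply/eqP; rewrite eq_le L1 L2.
by [].
Unshelve. all: by end_near. Qed.

(** In generating functions this is z F'(z) = A(z) F(z): [a] holds the coefficients of the
    logarithmic derivative z F'/F, so that F is proportional to exp(sum_j a_j z^j / j) when a_0 =
    0. *)
Definition panjer {R : realType} (a f : nat -> R) :=
  forall m : nat, m%:R * f m = conv a f m.

(** Logarithmic derivatives add up under products; the Leibniz rule is the splitting of [m] as
    [i + (m - i)] inside the convolution. *)
Lemma panjer_conv {R : realType} (a b f g : nat -> R) :
  panjer a f -> panjer b g -> panjer (fun i => a i + b i) (conv f g).
Proof.
move=> fa gb m; rewrite convDl.
rewrite convA (convC f g) convA (convC (conv b g) f).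
have -> : conv a f = fun m => m%:R * f m by apply/funext => i; rewrite fa.
have -> : conv b g = fun m => m%:R * g m by apply/funext => i; rewrite gb.
rewrite (convC g f) /conv -big_split/= mulr_sumr; apply: eq_bigr => i _.
have -> : m%:R = i%:R + (m - i)%:R :> R by rewrite -natrD subnKC// leq_ord.
ring.
Qed.

(** As [b 0] vanishes, [g m] is determined by its values below [m], and the recursion is monotone
    both in the weights and in those values; strong induction concludes. *)
Lemma panjer_le {R : realType} (a b f g : nat -> R) :
  b 0%N = 0 -> (forall i, 0 <= b i <= a i) -> (forall i, 0 <= f i) ->
  panjer a f -> panjer b g -> g 0%N <= f 0%N -> forall m, g m <= f m.
Proof.
move=> b0 ab f0 fa gb gf0 m; elim/ltn_ind: m => -[//|m] IH.
rewrite -(ler_pM2l (ltr0Sn R m)) fa gb; apply: ler_sum => -[[|i] ltim] _ /=.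
  have /andP[_ a0] := ab 0%N; rewrite b0 mul0r mulr_ge0//.
  by rewrite -b0.
have /andP[bi ai] := ab i.+1.
apply: (@le_trans _ _ (b i.+1 * f (m.+1 - i.+1)%N)).
  by rewrite ler_wpM2l// IH// subSS ltnS leq_subr.
by rewrite ler_wpM2r.
Qed.

Lemma panjerZ {R : realType} (a f : nat -> R) (c : R) :
  panjer a f -> panjer a (fun m => c * f m).
Proof.
move=> fa m; rewrite mulrCA fa /conv mulr_sumr; apply: eq_bigr => i _.
by rewrite mulrCA.
Qed.

Lemma nondecreasing_series_ge0 {R : realType} (f : nat -> R) :
  (forall i, 0 <= f i) -> nondecreasing_seq (series f).
Proof.
by move=> f0; apply/nondecreasing_seqP => k; rewrite /series/= big_nat_recr//= lerDl.
Qed.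

Lemma series_le_lim {R : realType} (f : nat -> R) (a : R) n :
  (forall i, 0 <= f i) -> series f @ \oo --> a -> series f n <= a.
Proof.
move=> f0 fa; rewrite -(cvg_lim _ fa)//.
apply: nondecreasing_cvgn_le; last by apply/cvg_ex; exists a.
exact: nondecreasing_series_ge0.
Qed.

(** * Compound Poisson weights *)

Definition unit_mass {R : realType} (m : nat) : R := (m == 0%N)%:R.

Lemma panjer_unit_mass {R : realType} :
  panjer (fun=> 0) (@unit_mass R).
Proof.
move=> m; rewrite /conv big1 => [|i _]; last by rewrite mul0r.
by case: m => [|m]; rewrite /unit_mass ?mul0r// mulr0.
Qed.

Lemma series_unit_mass {R : realType} : series (@unit_mass R) @ \oo --> (1 : R).
Proof.
rewrite -cvg_shiftS; apply: cvg_near_cst; near=> n.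
by rewrite /series/= big_nat_recl//= big1_seq ?addr0//.
Unshelve. all: by end_near. Qed.

(** Up to the factor [expR (- x)], the law of [j] times a Poisson variable of mean [x]; its
    generating function is exp(x z^j). *)
Definition pw {R : realType} (j : nat) (x : R) (m : nat) : R :=
  if (j %| m)%N then x ^+ (m %/ j) / (m %/ j)`!%:R else 0.

Lemma pw_ge0 {R : realType} j (x : R) m : 0 <= x -> 0 <= pw j x m.
Proof. by move=> x0; rewrite /pw; case: ifP => // _; rewrite divr_ge0// exprn_ge0. Qed.

Lemma pw0 {R : realType} j (x : R) : pw j x 0 = 1.
Proof. by rewrite /pw dvdn0 div0n expr0 fact0 divr1. Qed.

Lemma panjer_pw {R : realType} j (x : R) : (0 < j)%N ->
  panjer (fun i => if i == j then j%:R * x else 0) (pw j x).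
Proof.
move=> j0 m; rewrite /conv -(big_mkord xpredT
  (fun i => (if i == j then j%:R * x else 0) * pw j x (m - i)%N)).
have [mj|jm] := ltnP m j.
  rewrite big1_seq => [|i]; last first.
    rewrite mem_index_iota => /andP[_ /= im]; rewrite ifF ?mul0r//.
    by apply/negbTE; rewrite neq_ltn (leq_ltn_trans _ mj).
  rewrite /pw; case: m mj => [|m] mj; first by rewrite mul0r.
  by rewrite gtnNdvd// mulr0.
rewrite (bigD1_seq j) ?iota_uniq ?mem_index_iota//= eqxx big1 => [|i /negbTE ->]; last by rewrite mul0r.
rewrite addr0 /pw dvdn_subl//; have [/dvdnP[c mE]|_] := boolP (j %| m)%N; last by rewrite !mulr0.
case: c mE => [|c] mE; first by move: jm; rewrite mE leqn0 => /eqP jE; rewrite jE in j0.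
have -> : (m - j = c * j)%N by rewrite mE mulSn addnC addnK.
rewrite mE !mulnK// natrM factS natrM exprS.
rewrite invfM; have c0 : c.+1%:R != 0 :> R by rewrite pnatr_eq0.
have f0 : c`!%:R != 0 :> R by rewrite pnatr_eq0 -lt0n fact_gt0.
by move: (c.+1%:R) (c`!%:R) c0 f0 => a b a0 b0; field; rewrite a0 b0.
Qed.

Lemma series_pw {R : realType} j (x : R) : (0 < j)%N -> 0 <= x ->
  series (pw j x) @ \oo --> expR x.
Proof.
move=> j0 x0.
(* Each block of [j] consecutive indices carries at most one nonzero term, its first one, so the
   partial sums along multiples of [j] are those of the exponential series. *)
have sE n : series (pw j x) (n * j)%N = series (exp_coeff x) n.
  elim: n => [|n IH]; first by rewrite mul0n /series/= !big_geq.
  rewrite seriesSr -IH /series/= mulSn addnC.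
  rewrite (@big_cat_nat _ _ _ (n * j)%N)//= ?leq_addr//; congr (_ + _).
  rewrite -{1}(add0n (n * j)%N) big_addn addKn.
  case: j j0 {IH} => // j _.
  rewrite big_nat_recl// add0n {1}/pw dvdn_mull// mulnK//.
  rewrite big1_seq ?addr0// => i; rewrite mem_index_iota => /andP[_ /= ij].
  by rewrite /pw dvdn_addl ?dvdn_mull// gtnNdvd.
have ge0 i : 0 <= pw j x i by exact: pw_ge0.
have nd := nondecreasing_series_ge0 ge0.
have ec : series (exp_coeff x) @ \oo --> expR x.
  exact: is_cvg_series_exp_coeff.
have eg0 : forall i, 0 <= exp_coeff x i by move=> i; rewrite divr_ge0// exprn_ge0.
have ub n : series (pw j x) n <= expR x.
  apply: le_trans (_ : series (pw j x) (n * j)%N <= _).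
    by apply: nd; rewrite leq_pmulr.
  by rewrite sE; exact: series_le_lim.
have cv : cvgn (series (pw j x)).
  by apply: nondecreasing_is_cvgn => //; exists (expR x) => _ [n _ <-]; exact: ub.
have <- : limn (series (pw j x)) = expR x.
  apply/eqP; rewrite eq_le; apply/andP; split.
    by apply: limr_le => //; near=> n; exact: ub.
  rewrite -(cvg_lim _ ec)//; apply: limr_le; first by apply/cvg_ex; exists (expR x).
  by near=> n; rewrite -sE; exact: nondecreasing_cvgn_le.
by [].
Unshelve. all: by end_near. Qed.

(** Left unnormalized, with generating function exp(sum_(j <= N) x_j z^j) and value 1 at 0, so that
    [panjer_le] compares two such sequences without constants. *)
Fixpoint cpois {R : realType} (x : nat -> R) (N : nat) : nat -> R :=
  if N is N'.+1 then conv (cpois x N') (pw N (x N)) else unit_mass.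

Lemma cpois_ge0 {R : realType} (x : nat -> R) N :
  (forall j, 0 <= x j) -> forall m, 0 <= cpois x N m.
Proof.
move=> x0; elim: N => [|N IH] /=; first by move=> m; rewrite /unit_mass.
by apply: conv_ge0 => // i; exact: pw_ge0.
Qed.

Lemma cpois0 {R : realType} (x : nat -> R) N : cpois x N 0 = 1.
Proof. by elim: N => [//|N IH] /=; rewrite conv0 IH pw0 mulr1. Qed.

Lemma panjer_cpois {R : realType} (x : nat -> R) N :
  panjer (fun i => if (0 < i <= N)%N then i%:R * x i else 0) (cpois x N).
Proof.
elim: N => [|N IH] /=.
  rewrite (_ : (fun i => _) = fun=> 0); first exact: panjer_unit_mass.
  by apply/funext => i; rewrite ifF// ltnNge; case: leqP.
move: (panjer_conv IH (panjer_pw (x N.+1) (ltn0Sn N))).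
congr (panjer _ _); apply/funext => i; case: i => [|i] /=; first by rewrite addr0.
by rewrite eqSS ltnS; case: ltngtP => [_|_|->] /=; rewrite ?addr0 ?add0r.
Qed.

Lemma series_cpois {R : realType} (x : nat -> R) N : (forall j, 0 <= x j) ->
  series (cpois x N) @ \oo --> expR (\sum_(1 <= j < N.+1) x j).
Proof.
move=> x0; elim: N => [|N IH] /=.
  by rewrite big_geq// expR0; exact: series_unit_mass.
rewrite big_nat_recr//= expRD; apply: cvg_series_conv => //.
- exact: cpois_ge0.
- by move=> i; exact: pw_ge0.
- exact: series_pw.
Qed.

(** * Geometric laws and their sums *)

Definition geo {R : realType} (q : R) (m : nat) : R := (1 - q) * q ^+ m.

(** The generating function (1 - q) / (1 - q z) has logarithmic derivative sum_(i > 0) q^i z^i: each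
    of the [m] terms of positive index in the convolution equals [geo q m]. *)
Lemma panjer_geo {R : realType} (q : R) :
  panjer (fun i => if i == 0%N then 0 else q ^+ i) (geo q).
Proof.
move=> m; rewrite /conv big_ord_recl/= mul0r add0r.
rewrite (eq_bigr (fun=> (1 - q) * q ^+ m)) => [|i _].
  by rewrite sumr_const card_ord /geo mulr_natl.
by rewrite /geo mulrCA -exprD subnKC.
Qed.

Lemma geo_ge0 {R : realType} (q : R) m : 0 <= q <= 1 -> 0 <= geo q m.
Proof. by move=> /andP[q0 q1]; rewrite mulr_ge0 ?subr_ge0// exprn_ge0. Qed.

Lemma series_geo {R : realType} (q : R) : 0 <= q < 1 ->
  series (geo q) @ \oo --> (1 : R).
Proof.
move=> /andP[q0 q1]; have q1' : 1 - q != 0 by rewrite subr_eq0 eq_sym lt_eqF.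
rewrite (_ : geo q = geometric (1 - q) q)//.
rewrite -[X in _ --> X](divff q1').
by apply: cvg_geometric_series; rewrite ger0_norm.
Qed.

(** The first parameter is peeled off, to match the way in which the first of the independent
    uniform variables is split from the others in [geometric_sum_law]. *)
Fixpoint gconv {R : realType} (q : nat -> R) (K : nat) : nat -> R :=
  if K is K'.+1 then conv (geo (q 0)) (gconv (fun k => q k.+1) K')
  else unit_mass.

Lemma gconv_ge0 {R : realType} (q : nat -> R) K :
  (forall k, 0 <= q k <= 1) -> forall m, 0 <= gconv q K m.
Proof.
elim: K q => [|K IH] q q01 /=; first by move=> m; rewrite /unit_mass.
by apply: conv_ge0 => i; [exact: geo_ge0|exact: IH].
Qed.

Lemma gconv0 {R : realType} (q : nat -> R) K :
  gconv q K 0 = \prod_(k < K) (1 - q k).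
Proof.
elim: K q => [|K IH] q /=; first by rewrite big_ord0.
by rewrite conv0 IH big_ord_recl /geo expr0 mulr1.
Qed.

Lemma panjer_gconv {R : realType} (q : nat -> R) K :
  panjer (fun i => if i == 0%N then 0 else \sum_(k < K) q k ^+ i) (gconv q K).
Proof.
elim: K q => [|K IH] q /=.
  rewrite (_ : (fun i => _) = fun=> 0); first exact: panjer_unit_mass.
  by apply/funext => i; rewrite big_ord0 if_same.
move: (panjer_conv (panjer_geo (q 0%N)) (IH (fun k => q k.+1))).
congr (panjer _ _); apply/funext => i; rewrite big_ord_recl.
by case: ifP => //; rewrite addr0.
Qed.

Lemma series_gconv {R : realType} (q : nat -> R) K :
  (forall k, 0 <= q k < 1) -> series (gconv q K) @ \oo --> (1 : R).
Proof.
elim: K q => [|K IH] q q01 /=; first exact: series_unit_mass.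
have q01' k : 0 <= q k <= 1 by have /andP[-> /ltW] := q01 k.
rewrite -[X in _ --> X]mulr1; apply: cvg_series_conv.
- by move=> i; exact: geo_ge0.
- exact: gconv_ge0.
- exact: series_geo.
- exact: IH.
Qed.

(** The coefficients of exp(sum_(j <= N) (q z)^j / j) are nonnegative and, up to degree [N], those
    of 1 / (1 - q z). Its value at 1 is therefore at least 1 + q + ... + q^N = (1 - q^(N+1)) / (1 -
    q). *)
Lemma expR_log_partial {R : realType} (q : R) (N : nat) : 0 <= q < 1 ->
  1 - q ^+ N.+1 <= (1 - q) * expR (\sum_(1 <= j < N.+1) q ^+ j / j%:R).
Proof.
move=> /andP[q0 q1]; pose x (j : nat) := q ^+ j / j%:R.
have x0 j : 0 <= x j by rewrite divr_ge0// exprn_ge0.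
have xq m : (m <= N)%N -> cpois x N m = q ^+ m.
  elim/ltn_ind: m => -[|m] IH mN; first by rewrite cpois0.
  apply: (mulfI (x := m.+1%:R)); first by rewrite pnatr_eq0.
  rewrite panjer_cpois /conv big_ord_recl/= mul0r add0r.
  rewrite (eq_bigr (fun=> q ^+ m.+1)) => [|i _].
    by rewrite sumr_const card_ord mulr_natl.
  rewrite /= /bump leq0n add1n subSS.
  rewrite (leq_trans (ltn_ord i : (i.+1 <= m.+1)%N))//.
  rewrite IH ?ltnS ?leq_subr//; last by rewrite (leq_trans _ mN)// (leq_trans (leq_subr _ _)).
  rewrite /x mulrCA mulfV ?mulr1 ?pnatr_eq0// -exprD addSn subnKC//.
  by rewrite -ltnS.
have := series_le_lim N.+1 (cpois_ge0 N x0) (series_cpois x0).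
rewrite -(ler_pM2l (_ : 0 < 1 - q)) ?subr_gt0//; apply: le_trans.
rewrite /series/= big_mkord (eq_bigr (fun i : 'I_N.+1 => q ^+ i)); last first.
  by move=> i _; rewrite xq// -ltnS.
by rewrite -opprB -(opprB q 1) subrX1 -mulNr opprB.
Qed.

(** * Comparison of laws *)

Lemma cvg_seriesZ {R : realType} (c a : R) (f : nat -> R) :
  series f @ \oo --> a -> series (fun m => c * f m) @ \oo --> c * a.
Proof.
move=> fa; rewrite (_ : series _ = (fun n => c * series f n)).
  by apply: cvgM fa; exact: cvg_cst.
by apply/funext => n; rewrite /series/= mulr_sumr.
Qed.

Lemma cvg_series_le {R : realType} (f g : nat -> R) (a b : R) :
  (forall m, f m <= g m) ->
  series f @ \oo --> a -> series g @ \oo --> b -> a <= b.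
Proof.
by move=> fg fa gb; apply: (ler_cvg_to fa gb); near=> n; exact: ler_sum.
Unshelve. all: by end_near. Qed.

(** The remainder [p - c * r] is nonnegative of mass [1 - c], hence [u - c * v] lies between 0 and
    [B * (1 - c)]. So does [(1 - c) * v], and [u - v] is the difference of the two. *)
Lemma mixture_le {R : realType} (p r F : nat -> R) (c B u v : R) :
  (forall m, 0 <= r m) -> (forall m, c * r m <= p m) ->
  series p @ \oo --> (1 : R) -> series r @ \oo --> (1 : R) ->
  (forall m, 0 <= F m <= B) ->
  series (fun m => F m * p m) @ \oo --> u ->
  series (fun m => F m * r m) @ \oo --> v ->
  `|u - v| <= B * (1 - c).
Proof.
move=> r0 cr p1 r1 FB Fu Fv.
have c1 : c <= 1.
  by have := cvg_series_le cr (cvg_seriesZ (c := c) r1) p1; rewrite mulr1.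
have v0 : 0 <= v.
  apply: (cvg_series_le (f := fun=> 0) _ _ Fv).
    by move=> m; have /andP[? ?] := FB m; rewrite mulr_ge0.
  rewrite (_ : series _ = fun=> 0); first exact: cvg_cst.
  by apply/funext => n; rewrite /series/= big1.
have vB : v <= B.
  rewrite -[leRHS]mulr1; apply: (cvg_series_le _ Fv (cvg_seriesZ (c := B) r1)) => m.
  by have /andP[? ?] := FB m; rewrite ler_wpM2r.
have cvu : c * v <= u.
  apply: (cvg_series_le _ (cvg_seriesZ (c := c) Fv) Fu) => m.
  by have /andP[? ?] := FB m; rewrite mulrCA ler_wpM2l.
have ucv : u - c * v <= B * (1 - c).
  have H (s t a b k : R) (f g : nat -> R) : series f @ \oo --> a ->
      series g @ \oo --> b -> series (fun m => f m - k * g m) @ \oo --> a - k * b.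
    move=> fa gb.
    rewrite (_ : series _ = (fun n => series f n - series (fun m => k * g m) n)).
      by apply: cvgB fa _; exact: cvg_seriesZ.
    by apply/funext => n; rewrite /series/= sumrB.
  have := cvg_series_le _ (H 0 0 _ _ c _ _ Fu Fv) (cvg_seriesZ (c := B) (H 0 0 _ _ c _ _ p1 r1)).
  rewrite mulr1; apply => m.
  have /andP[F0 F1] := FB m; rewrite mulrCA -mulrBr ler_wpM2r// subr_ge0//.
by rewrite ler_norml; apply/andP; split; nra.
Qed.

Lemma expRN_ge1B {R : realType} (x : R) : 1 - x <= expR (- x).
Proof. exact: expR_ge1Dx. Qed.

(** Induction on (1 - S) (1 - x) >= 1 - S - x. It turns bounds on the factors of a domination
    constant into one that adds up over the eigenvalues. *)
Lemma prod_ge_1Bsum {R : realType} (K : nat) (x y : nat -> R) :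
  (forall k, (k < K)%N -> 0 <= x k <= 1 /\ 1 - x k <= y k) ->
  1 - \sum_(k < K) x k <= \prod_(k < K) y k.
Proof.
elim: K => [|K IH] xy; first by rewrite !big_ord0 subr0.
rewrite !big_ord_recr/=.
have [/andP[x0 x1] xyK] := xy K (ltnSn K).
have IH' := IH (fun k kK => xy k (ltnW kK)).
have S0 : 0 <= \sum_(k < K) x k.
  by apply: sumr_ge0 => k _; have [/andP[]] := xy k (ltnW (ltn_ord k)).
have P0 : 0 <= \prod_(k < K) y k.
  apply: prodr_ge0 => k _; have [/andP[_ xk] yk] := xy k (ltnW (ltn_ord k)).
  by apply: le_trans yk; rewrite subr_ge0.
apply: (@le_trans _ _ ((\prod_(k < K) y k) * (1 - x K))); last first.
  by rewrite ler_wpM2l.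
by nra.
Qed.

(* Both laws dominate a multiple of the compound Poisson law [r] whose Panjer
   weights are those common to the two. *)
Lemma compound_poisson_vs_geometric {R : realType} (N K : nat) (q a : nat -> R)
    (F : nat -> R) (B u v : R) :
  (forall k, 0 <= q k < 1) ->
  (forall j, \sum_(k < K) q k ^+ j <= a j) ->
  (forall m, 0 <= F m <= B) ->
  let p m := expR (- \sum_(1 <= j < N.+1) a j / j%:R) *
             cpois (fun j => a j / j%:R) N m in
  series (fun m => F m * p m) @ \oo --> u ->
  series (fun m => F m * gconv q K m) @ \oo --> v ->
  `|u - v| <= B * (\sum_(1 <= j < N.+1) (a j - \sum_(k < K) q k ^+ j)
                   + \sum_(k < K) q k ^+ N.+1).
Proof.
move=> q01 qa FB p Fp Fg.
have B0 : 0 <= B by have /andP[] := FB 0%N; exact: le_trans.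
have q01' k : 0 <= q k <= 1 by have /andP[-> /ltW] := q01 k.
have q0 k : 0 <= q k by have /andP[] := q01 k.
pose aK j := \sum_(k < K) q k ^+ j.
have aK0 j : 0 <= aK j by apply: sumr_ge0 => k _; rewrite exprn_ge0.
have a0 j : 0 <= a j := le_trans (aK0 j) (qa j).
pose xa j := a j / j%:R; pose xK j := aK j / j%:R.
have xa0 j : 0 <= xa j by rewrite divr_ge0.
have xK0 j : 0 <= xK j by rewrite divr_ge0.
pose r m := expR (- \sum_(1 <= j < N.+1) xK j) * cpois xK N m.
have r0 m : 0 <= r m by rewrite mulr_ge0 ?expR_ge0// cpois_ge0.
have mass (x : nat -> R) : (forall j, 0 <= x j) ->
    series (fun m => expR (- \sum_(1 <= j < N.+1) x j) * cpois x N m) @ \oo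
      --> (1 : R).
  move=> x0; rewrite -[X in _ --> X](_ : expR (- \sum_(1 <= j < N.+1) x j) *
    expR (\sum_(1 <= j < N.+1) x j) = 1); first exact/cvg_seriesZ/series_cpois.
  by rewrite -expRD addNr expR0.
have Fr : cvgn (series (fun m => F m * r m)).
  apply: (@series_le_cvg _ _ (fun m => B * r m)).
  - by move=> m; have /andP[? ?] := FB m; rewrite mulr_ge0.
  - by move=> m; rewrite mulr_ge0.
  - by move=> m; have /andP[? ?] := FB m; rewrite ler_wpM2r.
  - by apply/cvg_ex; exists (B * 1); exact/cvg_seriesZ/mass.
have step (c w : R) (p' : nat -> R) : (forall m, c * r m <= p' m) ->
    series p' @ \oo --> (1 : R) -> series (fun m => F m * p' m) @ \oo --> w ->
    `|w - limn (series (fun m => F m * r m))| <= B * (1 - c).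
  by move=> cr p1 Fw; exact: (mixture_le r0 cr p1 (mass _ xK0) FB Fw Fr).
(* Before normalization the compound Poisson sequence with weights [a] dominates the one with
   weights [aK]; [c1] is the ratio of the normalizations. *)
pose c1 := expR (- \sum_(1 <= j < N.+1) (xa j - xK j)).
have le_xa j : xK j <= xa j by rewrite /xK /xa ler_wpM2r//; exact: qa.
have H1 : `|u - limn (series (fun m => F m * r m))| <= B * (1 - c1).
  apply: step Fp.
  - move=> m; rewrite /r /p mulrA -expRD sumrB -opprD subrK.
    rewrite ler_wpM2l ?expR_ge0//.
    apply: panjer_le (panjer_cpois xa N) (panjer_cpois xK N) _ m => //.
    + move=> i; case: ifP => _; last by rewrite lexx.
      by rewrite mulr_ge0//= ler_wpM2l.
    + exact: cpois_ge0.
    + by rewrite !cpois0.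
  - exact: mass.
(* Here the domination constant is the ratio of the values at 0, [gconv q K 0] over [r 0]. It
   factorizes over [k], and each factor is at least [1 - q k ^+ N.+1] by [expR_log_partial]. *)
pose y k := (1 - q k) * expR (\sum_(1 <= j < N.+1) q k ^+ j / j%:R).
pose c2 := \prod_(k < K) y k.
have c2E : c2 = gconv q K 0 * expR (\sum_(1 <= j < N.+1) xK j).
  rewrite /c2 /y big_split/= gconv0; congr (_ * _).
  rewrite -expR_sum.
  congr expR; rewrite exchange_big; apply: eq_big_nat => j _.
  by rewrite /xK /aK mulr_suml.
have H2 : `|v - limn (series (fun m => F m * r m))| <= B * (1 - c2).
  apply: step Fg.
  - move=> m; rewrite c2E /r -mulrA (mulrA (expR _)) -expRD subrr expR0 mul1r.
    apply: panjer_le (panjer_gconv q K) (panjerZ (gconv q K 0) (panjer_cpois xK N)) _ m => //.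
    + move=> i; case: i => [|i] /=; first by rewrite lexx.
       case: (ltnP i N) => _.
        by rewrite /xK mulrCA mulfV ?pnatr_eq0// mulr1 aK0 lexx.
      by rewrite aK0 lexx.
    + exact: gconv_ge0.
    + by rewrite cpois0 mulr1.
  - exact: series_gconv.
(* From 1 - exp(-x) <= x, the weights 1 / j being at most 1. *)
have c1le : 1 - c1 <= \sum_(1 <= j < N.+1) (a j - aK j).
  rewrite lerBlDl -lerBlDr; apply: le_trans (expRN_ge1B _).
  rewrite lerD2l lerN2; apply: ler_sum_nat => j /andP[j0 _].
  rewrite /xa /xK -mulrBl ler_pdivrMr ?ltr0n// ler_peMr ?subr_ge0 ?ler1n//.
  exact: qa.
have c2le : 1 - c2 <= \sum_(k < K) q k ^+ N.+1.
  rewrite lerBlDl -lerBlDr; apply: (prod_ge_1Bsum (x := fun k => q k ^+ N.+1) (y := y)) => k _; split.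
    by rewrite exprn_ge0//= exprn_ile1//; have /andP[] := q01' k.
  exact: expR_log_partial.
have := ler_distD (limn (series (fun m => F m * r m))) u v.
move=> /le_trans; apply; rewrite mulrDr lerD//.
  by apply: le_trans H1 _; rewrite ler_wpM2l.
by rewrite distrC; apply: le_trans H2 _; rewrite ler_wpM2l.
Qed.

(** * Mass of the loop intensity *)

Lemma open_ball_rat {R : realType} (x : R) (n : nat) :
  exists p : rat, `|ratr p - x| < n.+1%:R^-1.
Proof.
have e0 : 0 < n.+1%:R^-1 :> R by rewrite invr_gt0.
have h : x < x + n.+1%:R^-1 by rewrite ltrDl.
have [q] := rat_in_itvoo h; rewrite in_itv/= => /andP[h1 h2].
exists q; move: e0 h1 h2; move: (_^-1) => e e0 h1 h2.
by rewrite ltr_norml; apply/andP; split; lra.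
Qed.

(** Measurability in [E3 R] refers to the product sigma-algebra; an open set is the countable union
    of the boxes with rational centre and radius 1 / (n + 1) that it contains. *)
Lemma E3_open_measurable {R : realType} (U : set (E3 R)) : open U -> measurable U.
Proof.
move=> oU.
pose B (i : rat * rat * rat * nat) : set (E3 R) :=
  [set x | [/\ `|ratr i.1.1.1 - x.1.1| < i.2.+1%:R^-1,
               `|ratr i.1.1.2 - x.1.2| < i.2.+1%:R^-1 &
               `|ratr i.1.2 - x.2| < i.2.+1%:R^-1]].
have mB i : measurable (B i).
  have -> : B i = ((ball (ratr i.1.1.1 : R) i.2.+1%:R^-1) `*`
      (ball (ratr i.1.1.2 : R) i.2.+1%:R^-1)) `*` (ball (ratr i.1.2 : R) i.2.+1%:R^-1).
    by apply/seteqP; split => [[[a b] c]|[[a b] c]] /=; [case|case => -[]].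
  by apply: measurableX; [apply: measurableX|]; apply: open_measurable; exact: ball_open.
have -> : U = \bigcup_i (if `[< B i `<=` U >] then B i else set0).
  apply/seteqP; split => [x Ux|x [i _]]; last first.
    by case: asboolP => // BU; exact: BU.
  have : nbhs x U by move: oU; rewrite openE; exact.
  move=> /nbhs_ballP[e /= e0 eU].
  (* With radius below [e / 2], a box containing [x] stays within distance [e] of [x]. *)
  have [n ne] : exists n : nat, n.+1%:R^-1 < e / 2.
    exists (Num.truncn (e / 2)^-1).
    rewrite invf_plt ?posrE ?divr_gt0//.
    by rewrite truncnS_gt// invr_ge0 divr_ge0// ltW.
  have [p1 h1] := open_ball_rat x.1.1 n.
  have [p2 h2] := open_ball_rat x.1.2 n.
  have [p3 h3] := open_ball_rat x.2 n.
  exists (p1, p2, p3, n) => //.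
  case: asboolP => [_|]; first by split.
  move: ne h1 h2 h3; rewrite /B/=; move: (_^-1) => w ne h1 h2 h3.
  case => y [/= y1 y2 y3]; apply: eU.
  split; first split; rewrite /ball/=.
  - by apply: le_lt_trans (ler_distD (ratr p1) _ _) _; rewrite distrC; lra.
  - by apply: le_lt_trans (ler_distD (ratr p2) _ _) _; rewrite distrC; lra.
  - by apply: le_lt_trans (ler_distD (ratr p3) _ _) _; rewrite distrC; lra.
apply: countable_bigcupT_measurable => [|i]; first exact: countableP.
by case: ifP.
Qed.

Lemma E3_continuous_measurable {R : realType} (f : E3 R -> R) :
  continuous f -> measurable_fun setT f.
Proof.
move=> cf; apply: (measurability _ (RGenOpens.measurableE R)).
move=> _ [_ [a [b ->] <-]]; rewrite setTI; apply: E3_open_measurable.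
by move/continuousP: cf; apply; exact: interval_open.
Qed.

Lemma E3_closed_measurable {R : realType} (A : set (E3 R)) : closed A -> measurable A.
Proof. by move=> cA; rewrite -[A]setCK; apply: measurableC; apply: E3_open_measurable; exact: closed_openC. Qed.

Lemma measurable_carrier {R : realType} (D : domain R) : admissible D ->
  measurable (carrier D).
Proof.
case: D => [_|Lam GamD alpha sigma [[cL _ _] _ _ _ _]] /=.
  have -> : [set x : E3 R | [/\ 0 <= x.1.1 < 1, 0 <= x.1.2 < 1 & 0 <= x.2 < 1]] =
      (`[0, 1[ `*` `[0, 1[) `*` `[0, 1[.
    apply/seteqP; split => [[[a b] c]|[[a b] c]] /=; rewrite !in_itv/=.
      by case.
    by case => -[].
  by apply: measurableX; [apply: measurableX|].
apply: E3_closed_measurable; apply: compact_closed => //.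
Qed.

(** A change of variables stated for integrals of nonnegative functions rather than for measures of
    sets, so that Tonelli carries it to products. *)
Definition scales {R : realType} d (T : measurableType d)
    (mu : {measure set T -> \bar R}) (s : T -> T) (c : R) :=
  measurable_fun setT s /\
  forall g : T -> \bar R, measurable_fun setT g -> (forall x, 0 <= g x)%E ->
    (\int[mu]_x g (s x) = c%:E * \int[mu]_x g x)%E.

Lemma leb_scales {R : realType} (L : R) : 0 < L ->
  scales (@leb R) (fun x => L^-1 * x) L.
Proof.
move=> L0; have ms : measurable_fun setT (fun x : R => L^-1 * x).
  exact: mulrl_measurable.
split => // g mg g0.
have -> : (\int[@leb R]_x g (L^-1 * x)%R =
    \int[pushforward (@leb R) (fun x : R => L^-1 * x)%R]_x g x)%E.
  by rewrite ge0_integral_pushforward//= preimage_setT.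
have L0' : 0 <= L by exact: ltW.
have iL0 : 0 <= L^-1 by rewrite invr_ge0.
have mt : measurable_fun setT (fun x : measurableTypeR R => L^-1 * x : measurableTypeR R).
  by move=> mT Y mY; exact: (ms mT Y mY).
pose p_ : {measure set (measurableTypeR R) -> \bar R} :=
  pushforward (@lebesgue_measure R) (fun x : measurableTypeR R => L^-1 * x : measurableTypeR R).
pose p := p_ mt.
have pE A : measurable A ->
    pushforward (@leb R) (fun x : R => L^-1 * x) A = mscale (NngNum L0') (@leb R) A.
  move=> mA; pose m : {measure set (measurableTypeR R) -> \bar R} := mscale (NngNum iL0) p.
  (* The image measure divided by [L] gives half-open intervals their length, hence is Lebesgue
     measure. *)
  have mE : @leb R A = m A.
    apply: (@lebesgue_measure_unique R m _ A mA).
    move=> _ [[a b] _ <-];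
    change (lebesgue_measure `]a, b]%classic = (L^-1)%R%:E *
      lebesgue_measure ((fun x : R => (L^-1 * x)%R) @^-1` `]a, b]%classic))%E.
    have -> : (fun x : R => L^-1 * x) @^-1` `]a, b]%classic = `]L * a, L * b]%classic.
      apply/seteqP; split => x /=;
        by rewrite !in_itv/= (mulrC L^-1) (mulrC L a) (mulrC L b) ltr_pdivlMr// ler_pdivrMr.
    rewrite !lebesgue_measure_itv/= !lte_fin ltr_pM2l//.
    case: ifP => _; last by rewrite mule0.
    by rewrite -!EFinD -EFinM -mulrBr mulKf// gt_eqF.
  change (lebesgue_measure ((fun x : R => (L^-1 * x)%R) @^-1` A) = L%:E * @leb R A)%E.
  rewrite mE.
  change (lebesgue_measure ((fun x : R => (L^-1 * x)%R) @^-1` A) = L%:E * ((L^-1)%R%:E *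
     lebesgue_measure ((fun x : R => (L^-1 * x)%R) @^-1` A)))%E.
  by rewrite muleA -EFinM mulfV ?gt_eqF// mul1e.
transitivity (\int[mscale (NngNum L0') (@leb R)]_x g x)%E.
  by apply: eq_measure_integral => A mA _; exact: pE.
by rewrite ge0_integral_mscale.
Qed.

Lemma scales_prod {R : realType} d1 d2 (T1 : measurableType d1)
    (T2 : measurableType d2) (m1 : {sigma_finite_measure set T1 -> \bar R})
    (m2 : {sigma_finite_measure set T2 -> \bar R}) s1 s2 (c1 c2 : R) :
  0 <= c2 -> scales m1 s1 c1 -> scales m2 s2 c2 ->
  scales (m1 \x m2)%E (fun x => (s1 x.1, s2 x.2)) (c1 * c2).
Proof.
move=> c20 [ms1 H1] [ms2 H2]; split.
  by apply: measurable_fun_pair; apply: measurableT_comp.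
move=> g mg g0.
have mgs : measurable_fun setT (fun x : T1 * T2 => g (s1 x.1, s2 x.2)).
  apply: (measurableT_comp mg).
  by apply: measurable_fun_pair; apply: measurableT_comp.
rewrite fubini_tonelli1// fubini_tonelli1//.
transitivity (\int[m1]_x (c2%:E * fubini_F m2 g (s1 x)))%E.
  apply: eq_integral => x _; rewrite /fubini_F/=.
  rewrite (H2 (fun y => g (s1 x, y)))//.
  exact: measurable_fun_pair2.
have mF : measurable_fun setT (fubini_F m2 g) by exact: measurable_fun_fubini_tonelli_F.
have F0 x : (0 <= fubini_F m2 g x)%E by apply: integral_ge0.
rewrite (H1 (fun x => c2%:E * fubini_F m2 g x)%E).
- by rewrite ge0_integralZl_EFin// EFinM muleA.
- exact: measurable_funeM.
- by move=> x; apply: mule_ge0.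
Qed.

(* A named copy of [leb \x leb], to carry a sigma-finite instance. *)
Definition leb2 (R : realType) : set (R * R) -> \bar R := (@leb R \x @leb R)%E.

HB.instance Definition _ (R : realType) := Measure.copy (@leb2 R) (@leb R \x @leb R)%E.

Lemma leb2_sigma_finite (R : realType) : sigma_finite setT (@leb2 R).
Proof.
have /sigma_finiteP[F [TF ndF Foo]] := sigma_finiteT (@leb R).
exists (fun n => F n `*` F n).
  rewrite -setXTT {1 2}TF predeqE => -[x y]; split.
    move=> [/= [n _ Fnx] [k _ Gky]]; exists (maxn n k) => //; split.
    - by move: x Fnx; exact/subsetPset/ndF/leq_maxl.
    - by move: y Gky; exact/subsetPset/ndF/leq_maxr.
  by move=> [n _ []/= ? ?]; split; exists n.
move=> k; have [? ?] := Foo k.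
split; first exact: measurableX.
by rewrite /leb2 product_measure1E// lte_mul_pinfty// ge0_fin_numE.
Qed.

HB.instance Definition _ (R : realType) :=
  @Measure_isSigmaFinite.Build _ _ R (@leb2 R) (@leb2_sigma_finite R).

Lemma vol_scales {R : realType} (L : R) (g : E3 R -> \bar R) : 0 < L ->
  measurable_fun setT g -> (forall x, 0 <= g x)%E ->
  (\int[vol R]_x g (L^-1 *: x)%R = (L ^+ 3)%:E * \int[vol R]_x g x)%E.
Proof.
move=> L0 mg g0; have L0' := ltW L0.
have H1 := leb_scales L0.
have H2 : scales (@leb2 R) _ _ := scales_prod L0' H1 H1.
have [_ H3] := scales_prod L0' H2 H1.
have -> : L ^+ 3 = L * L * L by rewrite !exprS expr0 mulr1 mulrA.
rewrite -(H3 g mg g0).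
by apply: eq_integral => -[[a b] c] _.
Qed.

Lemma cvg_EFinT {R : realType} {I : Type} {F : set_system I} {FF : Filter F}
  (f : I -> R) (a : R) : f @ F --> a -> (EFin \o f) @ F --> a%:E.
Proof. by move=> fa; apply: cvg_EFin => //; exact: nearW. Qed.

Lemma E3_measurable_scale {R : realType} (c : R) :
  measurable_fun setT (fun x : E3 R => c *: x).
Proof.
have -> : (fun x : E3 R => c *: x) = (fun x => ((c * x.1.1, c * x.1.2), c * x.2)).
  by apply/funext => -[[a b] z].
apply: measurable_fun_pair; first apply: measurable_fun_pair.
- by apply: measurable_funM => //; apply: measurableT_comp.
- by apply: measurable_funM => //; apply: measurableT_comp.
- by apply: measurable_funM.
Qed.

Lemma cvg_nneseries {R : realType} (f : nat -> R) (a : R) :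
  series f @ \oo --> a -> (\sum_(0 <= k <oo) (f k)%:E = a%:E)%E.
Proof.
move=> fa; apply/cvg_lim => //.
rewrite (_ : (fun n => _) = EFin \o series f); first exact: cvg_EFinT.
by apply/funext => n; rewrite /= /series/= sumEFin.
Qed.

Lemma nneseries_cvg {R : realType} (f : nat -> R) : (forall k, 0 <= f k) ->
  (\sum_(0 <= k <oo) (f k)%:E < +oo)%E ->
  series f @ \oo --> fine (\sum_(0 <= k <oo) (f k)%:E)%E.
Proof.
move=> f0 fy.
have S0 : (0 <= \sum_(0 <= k <oo) (f k)%:E)%E by apply: nneseries_ge0 => k _; rewrite lee_fin.
have : (fun n => \sum_(0 <= k < n) (f k)%:E)%E @ \oo --> (fine (\sum_(0 <= k <oo) (f k)%:E))%:E.
  by rewrite fineK ?ge0_fin_numE//; apply: is_cvg_nneseries => k _ _; rewrite lee_fin.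
move/fine_cvg; apply: cvg_trans.
rewrite (_ : series f = fine \o (fun n => \sum_(0 <= k < n) (f k)%:E)%E)//.
by apply/funext => n; rewrite /= /series/= sumEFin.
Qed.

Lemma fine_eq1 {R : realType} (x : \bar R) : fine x = 1 -> x = 1%E.
Proof. by case: x => [r /= -> //||] /= /esym/eqP; rewrite oner_eq0. Qed.

(** With no intermediate time the bridge formula gives the total mass, a diagonal value of the heat
    kernel. On the diagonal the spectral series has nonnegative terms, so Tonelli integrates it term
    by term, each [e k] having norm 1; the factor [L ^- 3] cancels the Jacobian of the dilation. *)
Lemma loop_mass {R : realType} (D : domain R) (lam : nat -> R)
    (e : nat -> E3 R -> R) (L t : R) (Q : R.-ker (E3 R) ~> loop_path D L) :
  0 < L -> 0 < t -> measurable (carrier D) ->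
  (forall k, L2fun (carrier D) (e k)) ->
  (forall k, L2dot (carrier D) (e k) (e k) = 1) ->
  (heat_trace lam (t / L ^+ 2) < +oo)%E ->
  brownian_loop_measure lam e t Q ->
  (\int[vol R]_(x in dilate L (carrier D)) Q x setT = heat_trace lam (t / L ^+ 2))%E.
Proof.
move=> L0 t0; set V := carrier D => mV L2e dote Zy HQ.
set tau := t / L ^+ 2 in Zy *.
pose F k (x : E3 R) := (expR (- lam k * tau) * e k x ^+ 2).
pose S (x : E3 R) : \bar R := (\sum_(0 <= k <oo) (F k x)%:E)%E.
have F0 k x : 0 <= F k x by rewrite mulr_ge0 ?expR_ge0// sqr_ge0.
have S0 x : (0 <= S x)%E by apply: nneseries_ge0 => k _; rewrite lee_fin.
have me k : measurable_fun V (e k) by have [] := L2e k.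
have mF k : measurable_fun V (F k).
  by apply: measurable_funM => //; exact: measurable_funX.
have mS : measurable_fun V S.
  apply: (@ge0_emeasurable_sum _ _ _ _ (fun k x => (F k x)%:E) xpredT).
    by move=> k x _ _; rewrite lee_fin.
  by move=> k _; exact/measurable_EFinP.
have intS : (\int[vol R]_(x in V) S x = heat_trace lam tau)%E.
  rewrite integral_nneseries//; last 2 first.
  - by move=> k; exact/measurable_EFinP.
  - by move=> k x _; rewrite lee_fin.
  apply: eq_eseriesr => k _; rewrite /F.
  under eq_integral do rewrite EFinM.
  rewrite ge0_integralZl_EFin ?expR_ge0//; last 2 first.
  - by move=> x _; rewrite lee_fin sqr_ge0.
  - by apply/measurable_EFinP; exact: measurable_funX.
  have := dote k; rewrite /L2dot /Rintegral => /fine_eq1.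
  by under eq_integral do rewrite -expr2; move=> ->; rewrite mule1.
pose g : E3 R -> \bar R := S \_ V.
have mg : measurable_fun setT g by move/(measurable_restrictT S mV): mS.
have g0 x : (0 <= g x)%E by rewrite /g patchE; case: ifP.
have intg : (\int[vol R]_x g x = heat_trace lam tau)%E by rewrite -intS [RHS]integral_mkcond.
have intgs : (\int[vol R]_x g (L^-1 *: x)%R = (L ^+ 3)%:E * heat_trace lam tau)%E.
  by rewrite vol_scales// intg.
have mscale1 : measurable_fun setT (fun x : E3 R => L^-1 *: x).
  exact: E3_measurable_scale.
have mgs : measurable_fun setT (fun x : E3 R => g (L^-1 *: x)).
  exact: measurableT_comp mg mscale1.
have dilE x : dilate L V x <-> V (L^-1 *: x).
  split => [[y Vy <-]|Vx]; first by rewrite scalerA mulVf ?gt_eqF// scale1r.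
  by exists (L^-1 *: x) => //; rewrite scalerA mulfV ?gt_eqF// scale1r.
have dilP : dilate L V = (fun x : E3 R => L^-1 *: x) @^-1` V.
  by apply/seteqP; split => x /dilE.
have mW : measurable (dilate L V).
  by rewrite dilP -[X in measurable X]setTI; exact: mscale1.
have Zfin : heat_trace lam tau \is a fin_num.
  by rewrite ge0_fin_numE// -intg integral_ge0.
(* The kernel is a [limn] of real partial sums; it is identified with the extended sum only where
   the latter is finite, which a finite trace ensures almost everywhere. *)
have aefin : {ae vol R, forall x, setT x -> g (L^-1 *: x) \is a fin_num}.
  apply: integrable_ae => //; apply/integrableP; split => //.
  under eq_integral do rewrite gee0_abs//.
  by rewrite intgs -(fineK Zfin) -EFinM ltry.
transitivity (\int[vol R]_(x in dilate L V) ((L ^- 3)%:E * g (L^-1 *: x)%R))%E.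
  apply: ge0_ae_eq_integral => //.
  - by apply: measurable_funTS; exact: measurable_kernel.
  - by apply: measurable_funTS; exact: measurable_funeM.
  - by move=> x _; rewrite mule_ge0// lee_fin invr_ge0 exprn_ge0// ltW.
  move: HQ aefin; apply: filterS2 => x HQ gfin Wx.
  have [_ /(_ [::])] := HQ Wx.
  move=> HH; have {HH} : Q x setT = (dilated_heat_kernel lam e L t x x)%:E.
    have -> : (dilated_heat_kernel lam e L t x x)%:E = bridge_fdd
        (dilate L (carrier D)) (dilated_heat_kernel lam e L) t x [::] 0 x.
      by rewrite /= subr0.
    rewrite -HH//=; last by rewrite t0.
    by congr (Q x _); apply/seteqP; split.
  move=> ->; rewrite /dilated_heat_kernel EFinM; congr (_ * _)%E.
  have gE : g (L^-1 *: x) = S (L^-1 *: x).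
    by rewrite /g patchE ifT// inE; exact/dilE.
  have Sfin : S (L^-1 *: x) \is a fin_num by rewrite -gE; exact: gfin.
  rewrite gE -(fineK Sfin); congr (_%:E); rewrite /heat_kernel.
  apply/cvg_lim => //.
  rewrite (_ : series _ = series (F ^~ (L^-1 *: x))).
    by apply: nneseries_cvg => //; rewrite ltey_eq Sfin.
  by congr series; apply/funext => k; rewrite /F -/tau -mulrA -expr2.
rewrite integral_mkcond.
transitivity (\int[vol R]_x ((L ^- 3)%:E * g (L^-1 *: x)%R))%E.
  apply: eq_integral => x _; rewrite patchE; case: ifPn => //; rewrite notin_setE => Wx.
  by rewrite /g patchE ifF ?mule0//; apply/negbTE; rewrite notin_setE => /dilE.
rewrite ge0_integralZl_EFin//; last by rewrite invr_ge0 exprn_ge0// ltW.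
by rewrite intgs muleA -EFinM mulVf ?mul1e// expf_neq0// gt_eqF.
Qed.

(** The set of loops of length [j] has empty sections in all terms of the intensity but the [j]-th,
    where the section is the whole path space. *)
Lemma loop_intensity_length {R : realType} (D : domain R) (lam : nat -> R)
    (e : nat -> E3 R -> R) (L beta : R) (N : nat)
    (Q : nat -> R.-ker (E3 R) ~> loop_path D L) (j : nat) :
  0 < L -> 0 < beta -> admissible D -> laplace_spectrum D lam e ->
  (forall t, 0 < t -> (heat_trace lam t < +oo)%E) ->
  (forall i, (1 <= i <= N)%N ->
    brownian_loop_measure lam e (beta * i%:R) (Q i)) ->
  (1 <= j <= N)%N ->
  (loop_intensity N Q [set l : loop D L | l.1 = j] =
    (j%:R^-1)%:E * heat_trace lam (beta * j%:R / L ^+ 2))%E.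
Proof.
move=> L0 beta0 aD [[L2e dote _] _ _ _ _] Zy HQ jN.
have [j1 jN'] := andP jN.
rewrite /loop_intensity (bigD1_seq j) ?iota_uniq ?mem_index_iota ?ltnS//=.
rewrite big1 ?adde0 => [|i ij]; last first.
  rewrite integral0_eq ?mule0// => x _.
  rewrite (_ : xsection _ _ = set0) ?measure0//.
  apply/seteqP; split => // y; rewrite /xsection/= inE/= => ij'.
  by rewrite ij' eqxx in ij.
congr (_ * _)%E.
rewrite -(loop_mass L0 _ (measurable_carrier aD) L2e _ _ (HQ j jN)).
- apply: eq_integral => x _; congr (Q j x _).
  by apply/seteqP; split => // y _; rewrite /xsection/= inE.
- by rewrite mulr_gt0// ltr0n.
- by move=> k; rewrite dote eqxx.
- by apply: Zy; rewrite divr_gt0 ?exprn_gt0// mulr_gt0// ltr0n.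
Qed.

(** * Law of the particle number *)

Lemma measurable_nat_comp d (T : measurableType d) d' (T' : measurableType d')
    (X : T -> nat) (g : nat -> T') : (forall m, measurable [set w | X w = m]) ->
  measurable_fun setT (g \o X).
Proof.
move=> mX _ Y mY; rewrite setTI.
rewrite (_ : _ @^-1` _ = \bigcup_(m in [set m | Y (g m)]) [set w | X w = m]).
  exact: bigcup_measurable.
by apply/seteqP; split => [w /= Yw|w [m /= Ym ->]//]; exists (X w).
Qed.

Lemma integral_nat {R : realType} d (T : measurableType d)
    (P : {measure set T -> \bar R}) (X : T -> nat) (g : nat -> R) :
  (forall m, measurable [set w | X w = m]) -> (forall m, 0 <= g m) ->
  (\int[P]_w (g (X w))%:E = \sum_(0 <= m <oo) (g m)%:E * P [set w | X w = m])%E.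
Proof.
move=> mX g0.
have E : setT = \bigcup_m [set w | X w = m].
  by apply/seteqP; split => // w _; exists (X w).
have mg : measurable_fun setT (fun w => (g (X w))%:E).
  exact: (@measurable_nat_comp _ T _ (\bar R) X (fun m => (g m)%:E)).
rewrite [in LHS]E ge0_integral_bigcup//.
- apply: eq_eseriesr => m _; rewrite -integral_cst//; apply: eq_integral => w.
  by rewrite inE/= => ->.
- by rewrite -E.
- by move=> w _; rewrite lee_fin.
- by move=> i j _ _ [w [/= <- <-]].
Qed.

Lemma cvg_series_expectation {R : realType} d (T : measurableType d)
    (P : probability T R) (X : T -> nat) (F p : nat -> R) :
  (forall m, measurable [set w | X w = m]) -> (forall m, 0 <= F m) ->
  (forall m, P [set w | X w = m] = (p m)%:E) ->
  (\int[P]_w (F (X w))%:E < +oo)%E ->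
  series (fun m => F m * p m) @ \oo --> fine (\int[P]_w (F (X w))%:E)%E.
Proof.
move=> mX F0 Pp.
have -> : (\int[P]_w (F (X w))%:E = \sum_(0 <= m <oo) (F m * p m)%:E)%E.
  by rewrite integral_nat//; apply: eq_eseriesr => m _; rewrite EFinM -Pp.
apply: nneseries_cvg => m; apply: mulr_ge0 => //.
by rewrite -lee_fin -Pp.
Qed.

Definition pois {R : realType} (x : R) (k : nat) : R := expR (- x) * x ^+ k / k`!%:R.

Section compound_poisson_law.
Context {R : realType} d (T : measurableType d) (P : probability T R).
Variables (N : nat) (C : nat -> T -> nat) (x : nat -> R).
Hypothesis mC : forall j k, measurable [set w | C j w = k].
Hypothesis PC : forall k : nat -> nat,
  P [set w | forall j, (0 < j <= N)%N -> C j w = k j] =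
  (\prod_(1 <= j < N.+1) pois (x j) (k j))%:E.

Let S i w := (\sum_(1 <= j < i.+1) j * C j w)%N.

(** These events interpolate between the joint law of the counts, at [i = 0], and the law of the
    weighted sum, at [i = N]: each step trades the constraint on one count for one more summand. *)
Let E i m k := [set w | S i w = m /\ forall j, (i < j <= N)%N -> C j w = k j].

Let mS i m : measurable [set w | S i w = m].
Proof.
elim: i m => [|i IH] m.
  rewrite /S; under eq_set do rewrite big_geq//.
  case: m => [|m].
    by rewrite (_ : [set _ | _] = setT)//; apply/seteqP; split.
  by rewrite (_ : [set _ | _] = set0)//; apply/seteqP; split.
have -> : [set w | S i.+1 w = m] = \bigcup_a (\bigcup_b
    (if (a + i.+1 * b == m)%N then [set w | S i w = a] `&` [set w | C i.+1 w = b] else set0)).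
  apply/seteqP; split => w.
    move=> Sw; exists (S i w) => //; exists (C i.+1 w) => //.
    by rewrite ifT//; apply/eqP; rewrite -(Sw : S i.+1 w = m) {2}/S big_nat_recr.
  move=> [a _ [b _]]; case: eqP => // <- [/= <- <-].
  by rewrite /S big_nat_recr.
apply: bigcupT_measurable => a; apply: bigcupT_measurable => b.
by case: ifP => _ //; exact: measurableI.
Qed.

Let mE i m k : measurable (E i m k).
Proof.
rewrite (_ : E i m k = [set w | S i w = m] `&`
  \bigcap_j (if (i < j <= N)%N then [set w | C j w = k j] else setT)).
  apply: measurableI => //; apply: bigcapT_measurable => j.
  by case: ifP => _.
apply/seteqP; split => w [Sw Cw]; split => // j.
  by move=> _; case: ifP => // /Cw.
by move=> ij; have := Cw j I; rewrite ij.
Qed.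

Let PE i m k : (i <= N)%N -> P (E i m k) =
  (expR (- \sum_(1 <= j < i.+1) x j) * cpois x i m *
   \prod_(i.+1 <= j < N.+1) pois (x j) (k j))%:E.
Proof.
elim: i m k => [|i IH] m k iN.
  rewrite [X in expR (- X)]big_geq// oppr0 expR0 mul1r /=.
  case: m => [|m].
    rewrite /unit_mass mul1r -PC; congr (P _); apply/seteqP; split => w.
      by case.
    by move=> Cw; split => //; rewrite /S big_geq.
  rewrite /unit_mass mul0r (_ : E _ _ _ = set0) ?measure0//.
  by apply/seteqP; split => // w []; rewrite /S big_geq.
(* The event at rank [i.+1] is split by the value [a] of the sum up to rank [i]; the next count must
   then be [(m - a) / (i + 1)], which [k'] adds to the prescribed values. *)
pose k' c j := if j == i.+1 then c else k j.
pose F (a : nat) := if (i.+1 %| m - a)%N then E i a (k' ((m - a) %/ i.+1)%N) else set0.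
have -> : E i.+1 m k = \big[setU/set0]_(a < m.+1) F a.
  rewrite -(bigcup_mkord m.+1 F); apply/seteqP; split => w.
    move=> [Sw Cw]; have Sm : (S i w < m.+1)%N by rewrite ltnS -Sw /S [leqRHS]big_nat_recr//= leq_addr.
    have CE : (m - S i w = C i.+1 w * i.+1)%N.
      by rewrite -Sw /S [X in (X - _)%N]big_nat_recr//= addKn mulnC.
    exists (S i w) => //; rewrite /F/= CE dvdn_mull// mulnK//.
    split => // j /andP[ij jN]; rewrite /k'; case: eqVneq => [->//|ji].
    by apply: Cw; rewrite jN andbT ltn_neqAle eq_sym ji.
  move=> [a /= am]; rewrite /F; case: ifPn => // /dvdnP[c mc] [Sw Cw].
  have Ci : C i.+1 w = c.
    by rewrite Cw ?ltnSn// /k' eqxx mc mulnK.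
  split; first by rewrite /S big_nat_recr//= -/(S i w) Sw Ci mulnC -mc subnKC.
  move=> j /andP[ij jN]; rewrite Cw; last by rewrite jN ltnW.
  by rewrite /k' gtn_eqF.
rewrite (@measure_bigsetU_ord _ _ _ _ _ xpredT (fun a : 'I_m.+1 => F a)); last 2 first.
- by move=> a; rewrite /F; case: ifP => _.
- move=> a b _ _ [w []]; rewrite /F.
  do 2 (case: ifP => _ //); move=> [Sa _] [Sb _]; apply/val_inj => /=.
  by rewrite -Sa -Sb.
have -> : expR (- \sum_(1 <= j < i.+2) x j) = expR (- \sum_(1 <= j < i.+1) x j) * expR (- x i.+1).
  by rewrite big_nat_recr//= opprD expRD.
rewrite /= /conv mulr_sumr mulr_suml -sumEFin; apply: eq_bigr => a _.
rewrite /F /pw; case: ifPn => adv; last by rewrite measure0 mulr0 mulr0 mul0r.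
rewrite IH ?(ltnW iN)//; congr (_%:E).
rewrite (@big_ltn _ _ _ i.+1)//.
rewrite [X in _ * (_ * X)](eq_big_nat _ _ (F2 := fun j => pois (x j) (k j))); last first.
  by move=> j /andP[ij _]; rewrite /k' gtn_eqF.
by rewrite /k' eqxx /pois; ring.
Qed.

Lemma compound_poisson_law m :
  P [set w | (\sum_(1 <= j < N.+1) j * C j w)%N = m] =
  (expR (- \sum_(1 <= j < N.+1) x j) * cpois x N m)%:E.
Proof.
transitivity (P (E N m (fun=> 0%N))).
  congr (P _); apply/seteqP; split => w; last by case.
  by move=> Sw; split => // j /andP[Nj jN]; rewrite ltnNge jN in Nj.
by rewrite PE// [X in _ * X]big_geq// mulr1.
Qed.

Lemma measurable_compound_sum m :
  measurable [set w | (\sum_(1 <= j < N.+1) j * C j w)%N = m].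
Proof. exact: mS. Qed.

End compound_poisson_law.

Lemma poisson_mean {R : realType} d (T : measurableType d)
    (P : probability T R) (X : T -> nat) (x : R) : 0 <= x ->
  (forall m, measurable [set w | X w = m]) ->
  (forall m, P [set w | X w = m] = (pois x m)%:E) ->
  (\int[P]_w ((X w)%:R)%:E = x%:E)%E.
Proof.
move=> x0 mX PX; rewrite (integral_nat P (g := fun m => m%:R))//.
transitivity (\sum_(0 <= m <oo) (m%:R * pois x m)%:E)%E.
  by apply: eq_eseriesr => m _; rewrite EFinM -PX.
apply: cvg_nneseries; rewrite -cvg_shiftS.
have H : series (fun m => x * expR (- x) * exp_coeff x m) @ \oo --> x.
  rewrite -[X in _ --> X](_ : x * expR (- x) * expR x = x).
    by apply: cvg_seriesZ; exact: is_cvg_series_exp_coeff.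
  by rewrite -mulrA -expRD addNr expR0 mulr1.
rewrite (_ : [sequence _]_n = series (fun m => x * expR (- x) * exp_coeff x m))//.
apply/funext => n.
rewrite /series/= big_nat_recl//= mul0r add0r; apply: eq_bigr => i _.
rewrite /pois /exp_coeff/= exprS factS natrM invfM.
have : i.+1%:R != 0 :> R by rewrite pnatr_eq0.
have : i`!%:R != 0 :> R by rewrite pnatr_eq0 -lt0n fact_gt0.
by move: (i.+1%:R) (i`!%:R) => a b b0 a0; field; rewrite a0 b0.
Qed.

Section particle_number_law.
Context {R : realType} (D : domain R) (L : R) (N : nat).
Context d (Omega : measurableType d) (P : probability Omega R).
Variables (mu : set (loop D L) -> \bar R) (eta : Omega -> seq (loop D L)).
Variable x : nat -> R.
Hypothesis x0 : forall j, 0 <= x j.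
Hypothesis mux : forall j, (0 < j <= N)%N -> mu [set l | l.1 = j] = (x j)%:E.
Hypothesis etaP : poisson_process P mu eta.

Let C j w := loop_count (eta w) j.

Let mA j : measurable [set l : loop D L | l.1 = j].
Proof.
rewrite (_ : [set _ | _] = [set j] `*` setT); first exact: measurableX.
by apply/seteqP; split => -[a b] //= [].
Qed.

Let CE j w : C j w = count (mem ([set l | l.1 = j] : set (loop D L))) (eta w).
Proof.
apply: eq_count => l /=; apply/eqP/idP => [lj|]; first by rewrite inE.
by rewrite inE.
Qed.

Let mC j k : measurable [set w | C j w = k].
Proof.
have [H _ _] := etaP.
by under eq_set do rewrite CE; exact: H.
Qed.

Let PC j k : (0 < j <= N)%N -> P [set w | C j w = k] = (pois (x j) k)%:E.
Proof.
move=> jN; have [_ H _] := etaP.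
by under eq_set do rewrite CE; rewrite H// mux.
Qed.

(** Loops of different lengths form disjoint sets, so the independence clause of the Poisson process
    applies; an ordinal [i] below [N] stands for the length [i + 1]. *)
Let PCs (k : nat -> nat) :
  P [set w | forall j, (0 < j <= N)%N -> C j w = k j] =
  (\prod_(1 <= j < N.+1) pois (x j) (k j))%:E.
Proof.
have [_ _ H] := etaP.
rewrite (_ : [set w | _] = [set w | forall i : 'I_N,
    count (mem ([set l | l.1 = i.+1] : set (loop D L))) (eta w) = k i.+1]).
  rewrite (H N (fun i : 'I_N => [set l | l.1 = i.+1]) (fun i => k i.+1)); last 2 first.
  - by move=> i.
  - by move=> i j _ _ [l [/= -> [/ord_inj]]].
  rewrite big_add1/= big_mkord -prodEFin; apply: eq_bigr => i _.
  rewrite -PC ?ltn_ord//; congr (P _); apply/seteqP; split => w /=; by rewrite CE.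
apply/seteqP; split => w /= Cw.
  by move=> i; rewrite -CE; apply: Cw; rewrite /= ltn_ord.
by move=> [//|j] jN; rewrite CE; exact: (Cw (Ordinal (jN : (j < N)%N))).
Qed.

Lemma measurable_particle_number m :
  measurable [set w | particle_number N (eta w) = m].
Proof. exact: (measurable_compound_sum N mC). Qed.

Lemma particle_number_law m :
  P [set w | particle_number N (eta w) = m] =
  (expR (- \sum_(1 <= j < N.+1) x j) * cpois x N m)%:E.
Proof. exact: (compound_poisson_law mC PCs). Qed.

Lemma particle_number_mean :
  (\int[P]_w ((particle_number N (eta w))%:R)%:E =
   (\sum_(1 <= j < N.+1) j%:R * x j)%:E)%E.
Proof.
have mCR j : measurable_fun setT (fun w => ((C j w)%:R)%:E : \bar R).
  exact: (@measurable_nat_comp _ _ _ (\bar R) (C j) (fun m => (m%:R)%:E)).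
transitivity (\int[P]_w (\sum_(1 <= j < N.+1) (j%:R)%:E * ((C j w)%:R)%:E))%E.
  apply: eq_integral => w _; rewrite /particle_number natr_sum -sumEFin.
  by apply: eq_bigr => j _; rewrite natrM EFinM.
rewrite ge0_integral_sum//; last by move=> j; exact: measurable_funeM.
rewrite -sumEFin; apply: eq_big_nat => j /andP[j0 jN].
rewrite ge0_integralZl_EFin// ?(@poisson_mean R _ _ P (C j) (x j))//.
by move=> m; apply: PC; rewrite j0.
Qed.

End particle_number_law.

(** * Independent uniform variables from binary digits *)

(** Open left half-lines are stable under intersection, generate the Borel sets and exhaust the
    line, so they determine a finite measure. *)
Lemma finite_measure_rays {R : realType} (m1 m2 : {measure set R -> \bar R}) :
  (m1 setT < +oo)%E ->
  (forall a, m1 `]-oo, a[%classic = m2 `]-oo, a[%classic) ->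
  forall A, measurable A -> m1 A = m2 A.
Proof.
move=> m1y m12 A mA.
apply: (measure_unique (@RGenInftyO.G R) (fun n => `]-oo, n%:R[%classic)) => //.
- exact: RGenInftyO.measurableE.
- move=> _ _ [a ->] [b ->]; exists (Num.min a b).
  by apply/seteqP; split => x /=; rewrite !in_itv/= lt_min => /andP.
- by move=> n; exists n%:R.
- apply/seteqP; split => // x _; exists (Num.truncn x).+1 => //=.
  by rewrite in_itv/= truncnS_gt.
- by move=> _ [a ->].
- by move=> n; apply: le_lt_trans m1y; apply: le_measure; rewrite ?inE.
Qed.

Definition unif01 (R : realType) : set R -> \bar R :=
  mrestr (@leb R) (measurable_itv `[0%R, 1%R]).

HB.instance Definition _ (R : realType) := Measure.copy (@unif01 R)
  (mrestr (@leb R) (measurable_itv `[0%R, 1%R])).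

Lemma unif01_setT (R : realType) : @unif01 R setT = 1%E.
Proof.
rewrite /unif01 /mrestr setTI /leb.
by rewrite lebesgue_measure_itv/= lte_fin ltr01 oppr0 adde0.
Qed.

HB.instance Definition _ (R : realType) :=
  @Measure_isProbability.Build _ R R (@unif01 R) (@unif01_setT R).

(** The distribution function of the uniform law on [0, 1]. *)
Definition clamp {R : realType} (a : R) : R := Num.min 1 (Num.max 0 a).

Lemma clamp_le0 {R : realType} (a : R) : a <= 0 -> clamp a = 0.
Proof. by move=> a0; rewrite /clamp max_l// min_r. Qed.

Lemma clamp_ge1 {R : realType} (a : R) : 1 <= a -> clamp a = 1.
Proof. by move=> a1; rewrite /clamp max_r ?min_l// (le_trans ler01). Qed.

Lemma clamp_id {R : realType} (a : R) : 0 <= a <= 1 -> clamp a = a.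
Proof. by move=> /andP[a0 a1]; rewrite /clamp max_r// min_r. Qed.

Lemma clamp01 {R : realType} (a : R) : 0 <= clamp a <= 1.
Proof.
have [a0|/ltW a0] := leP a 0; first by rewrite clamp_le0// lexx ler01.
have [a1|/ltW a1] := leP a 1; last by rewrite clamp_ge1// lexx ler01.
by rewrite clamp_id ?a0.
Qed.

(** Self-similarity of the uniform law in terms of distribution functions: it is the average of its
    images under x / 2 and (x + 1) / 2. *)
Lemma clamp_split {R : realType} (a : R) :
  clamp a = (clamp (2 * a) + clamp (2 * a - 1)) / 2.
Proof.
have [a0|a0] := leP a 0.
  by rewrite !clamp_le0 ?addr0 ?mul0r//; lra.
have [ah|ah] := leP (2 * a) 1.
  by rewrite [X in _ + X]clamp_le0 ?(clamp_id (a := a)) ?(clamp_id (a := 2 * a)); lra.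
have [a1|a1] := leP a 1.
  by rewrite (clamp_ge1 (a := 2 * a)) ?(clamp_id (a := a)) ?clamp_id; lra.
by rewrite !clamp_ge1; lra.
Qed.

Lemma unif01_ray (R : realType) (a : R) : @unif01 R `]-oo, a[%classic = (clamp a)%:E.
Proof.
rewrite /unif01 /mrestr /leb.
have [a0|a0] := leP a 0.
  rewrite clamp_le0// (_ : _ `&` _ = set0) ?measure0//.
  by apply/seteqP; split => // x []/=; rewrite !in_itv/= => xa /andP[x0 _]; lra.
have [a1|a1] := leP a 1.
  rewrite clamp_id; last by rewrite ltW.
  rewrite (_ : _ `&` _ = `[0, a[%classic).
    by rewrite lebesgue_measure_itv/= lte_fin a0 oppr0 adde0.
  apply/seteqP; split => x /=; rewrite !in_itv/=.
    by move=> [-> /andP[->]].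
  by move=> /andP[-> xa]; rewrite xa (le_trans (ltW xa)).
rewrite clamp_ge1 ?ltW// setIidr ?lebesgue_measure_itv/= ?lte_fin ?ltr01 ?oppr0 ?adde0//.
by move=> x /=; rewrite !in_itv/= => /andP[_ /le_lt_trans]; apply.
Qed.

(** The doubling map, which drops the first binary digit; [bit] reads that digit. *)
Definition dbl {R : realType} (x : R) : R := if x < 2^-1 then 2 * x else 2 * x - 1.

Definition bit {R : realType} (x : R) : R := if x < 2^-1 then 0 else 1.

Lemma measurable_half {R : realType} : measurable_fun setT (fun x : R => x < 2^-1).
Proof. exact: measurable_fun_ltr. Qed.

Lemma measurable_dbl {R : realType} : measurable_fun setT (@dbl R).
Proof.
apply: measurable_fun_ifT; first exact: measurable_half.
  exact: mulrl_measurable.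
by apply: measurable_funB => //; exact: mulrl_measurable.
Qed.

Lemma measurable_bit {R : realType} : measurable_fun setT (@bit R).
Proof. by apply: measurable_fun_ifT => //; exact: measurable_half. Qed.

Lemma measurable_half_add {R : realType} (c : R) :
  measurable_fun setT (fun x : R => (x + c) / 2).
Proof. by apply: measurable_funM => //; apply: measurable_funD. Qed.

Lemma pushforward_measure {R : realType} d1 d2 (X : measurableType d1)
    (Y : measurableType d2) (mu : {measure set X -> \bar R}) (f : X -> Y) :
  measurable_fun setT f ->
  exists m : {measure set Y -> \bar R}, forall A, m A = mu (f @^-1` A).
Proof.
move=> mf; pose p : {measure set Y -> \bar R} := pushforward mu f.
by exists (p mf).
Qed.

Lemma integral_image_measure {R : realType} d1 d2 (X : measurableType d1)
    (Y : measurableType d2) (mu : {measure set X -> \bar R})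
    (m : {measure set Y -> \bar R}) (f : X -> Y) (g : Y -> \bar R) :
  measurable_fun setT f -> (forall A, m A = mu (f @^-1` A)) ->
  measurable_fun setT g -> (forall y, 0 <= g y)%E ->
  (\int[m]_y g y = \int[mu]_x g (f x))%E.
Proof.
move=> mf mE mg g0; transitivity (\int[pushforward mu f]_y g y)%E.
  by apply: eq_measure_integral => A _ _; exact: mE.
by rewrite ge0_integral_pushforward.
Qed.

Lemma unif01_split {R : realType} (A : set R) : measurable A ->
  @unif01 R A = (2^-1%:E * (@unif01 R ((fun x => (x + 0) / 2)%R @^-1` A) +
                       @unif01 R ((fun x => (x + 1) / 2)%R @^-1` A)))%E.
Proof.
move=> mA.
have [p0 p0E] := pushforward_measure (@unif01 R) (measurable_half_add 0).
have [p1 p1E] := pushforward_measure (@unif01 R) (measurable_half_add 1).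
have h0 : 0 <= 2^-1 :> R by rewrite invr_ge0.
pose m : {measure set R -> \bar R} := mscale (NngNum h0) (measure_add p0 p1).
have mE B : m B = (2^-1%:E * (@unif01 R ((fun x => (x + 0) / 2)%R @^-1` B) +
                       @unif01 R ((fun x => (x + 1) / 2)%R @^-1` B)))%E.
  by rewrite -p0E -p1E -measure_addE.
rewrite -mE; apply: finite_measure_rays => //.
  by have : (@unif01 R setT < +oo)%E by rewrite unif01_setT ltry.
move=> a; rewrite mE; apply: (etrans (unif01_ray a)).
have rE c : (fun x : R => (x + c) / 2) @^-1` `]-oo, a[%classic = `]-oo, (2 * a - c)[%classic.
  by apply/seteqP; split => x /=; rewrite !in_itv/=; lra.
by rewrite !rE !unif01_ray -EFinD -EFinM subr0 mulrC -clamp_split.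
Qed.

(* [digits x] keeps the binary digits of [x] of even rank. *)
Fixpoint digits_upto {R : realType} (n : nat) (x : R) : R :=
  if n is n'.+1 then (bit x + digits_upto n' (dbl (dbl x))) / 2 else 0.

Definition digits {R : realType} (x : R) : R := limn (digits_upto ^~ x).

Lemma bit01 {R : realType} (x : R) : 0 <= bit x <= 1.
Proof. by rewrite /bit; case: ifP => _; rewrite lexx ler01. Qed.

Lemma digits_upto01 {R : realType} n (x : R) : 0 <= digits_upto n x <= 1.
Proof.
elim: n x => [|n IH] x /=; first by rewrite lexx ler01.
by have := bit01 x; have := IH (dbl (dbl x)) => /andP[? ?] /andP[? ?]; apply/andP; split; lra.
Qed.

Lemma digits_upto_nd {R : realType} (x : R) : nondecreasing_seq (digits_upto ^~ x).
Proof.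
apply/nondecreasing_seqP => n; elim: n x => [|n IH] x.
  by have /andP[] := digits_upto01 1 x.
have E k : digits_upto k.+1 x = (bit x + digits_upto k (dbl (dbl x))) / 2 by [].
by rewrite !E ler_wpM2r// lerD2l; exact: IH.
Qed.

Lemma cvg_digits {R : realType} (x : R) : digits_upto ^~ x @ \oo --> digits x.
Proof.
apply: nondecreasing_is_cvgn; first exact: digits_upto_nd.
by exists 1 => _ [n _ <-]; have /andP[] := digits_upto01 n x.
Qed.

Lemma digits01 {R : realType} (x : R) : 0 <= digits x <= 1.
Proof.
apply/andP; split.
  apply: limr_ge; first by apply/cvg_ex; exists (digits x); exact: cvg_digits.
  by near=> n; have /andP[] := digits_upto01 n x.
apply: limr_le; first by apply/cvg_ex; exists (digits x); exact: cvg_digits.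
by near=> n; have /andP[] := digits_upto01 n x.
Unshelve. all: by end_near. Qed.

Lemma digitsE {R : realType} (x : R) : digits x = (bit x + digits (dbl (dbl x))) / 2.
Proof.
apply/cvg_lim => //; rewrite -cvg_shiftS.
apply: cvgM; last exact: cvg_cst.
by apply: cvgD; [exact: cvg_cst|exact: cvg_digits].
Qed.

Lemma measurable_digits {R : realType} : measurable_fun setT (@digits R).
Proof.
apply: (measurable_fun_cvg (h := @digits_upto R)) => [n|x _]; last exact: cvg_digits.
elim: n => [|n IH] /=; first exact: measurable_cst.
apply: measurable_funM => //; apply: measurable_funD; first exact: measurable_bit.
by apply: measurableT_comp IH _; apply: measurableT_comp; exact: measurable_dbl.
Qed.

Lemma measurable_digits_dbl {R : realType} :
  measurable_fun setT (fun x : R => digits (dbl x)).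
Proof. by apply: measurableT_comp; [exact: measurable_digits|exact: measurable_dbl]. Qed.

(** Putting a digit in front shifts all ranks by one, and so exchanges the digits of even rank with
    those of odd rank. At [x = 1] the rule fails, because 1 / 2 belongs to the upper half. *)
Lemma digits_half {R : realType} (x : R) : x < 1 ->
  digits ((x + 0) / 2) = digits (dbl x) / 2 /\ digits (dbl ((x + 0) / 2)) = digits x.
Proof.
move=> x1; have h : (x + 0) / 2 < 2^-1 by lra.
have -> : dbl ((x + 0) / 2) = x by rewrite /dbl h; lra.
split => //; rewrite digitsE /bit h add0r; congr (digits (dbl _) / 2).
by rewrite /dbl h; lra.
Qed.

Lemma digits_halfS {R : realType} (x : R) : 0 <= x ->
  digits ((x + 1) / 2) = (1 + digits (dbl x)) / 2 /\ digits (dbl ((x + 1) / 2)) = digits x.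
Proof.
move=> x0; have h : (x + 1) / 2 < 2^-1 = false by apply/negbTE; rewrite -leNgt; lra.
have -> : dbl ((x + 1) / 2) = x by rewrite /dbl h; lra.
split => //; rewrite digitsE /bit h; congr ((1 + digits (dbl _)) / 2).
by rewrite /dbl h; lra.
Qed.

(* Uniqueness for the functional equation [Frec] of the joint distribution
   function of [digits] and [digits \o dbl]. *)
Lemma halving_eq0 {R : realType} (I : Type) (h : I -> R) :
  (forall i, `|h i| <= 1) -> (forall i, h i = 0 \/ exists j, `|h i| <= `|h j| / 2) ->
  forall i, h i = 0.
Proof.
move=> h1 hh i; have H n : forall i, `|h i| <= (2^-1) ^+ n.
  elim: n => [//|n IH] {}i; have [->|[j hj]] := hh i; first by rewrite normr0 exprn_ge0.
  by rewrite exprSr (le_trans hj)// ler_wpM2r.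
have c : (fun n => (2^-1 : R) ^+ n) @ \oo --> (0 : R).
  by apply: cvg_expr; rewrite ger0_norm ?invf_lt1 ?ltr1n// invr_ge0.
apply/eqP; rewrite -normr_le0; apply: (ler_cvg_to (cvg_cst `|h i|) c).
by near=> n; exact: H.
Unshelve. all: by end_near. Qed.

Section digits_law.
Context {R : realType}.
Notation U := (@unif01 R).

Let F (a b : R) := U [set x | digits x < a /\ digits (dbl x) < b].

Let mD (a : R) : measurable [set x : R | digits x < a].
Proof.
rewrite -[X in measurable X]setTI (_ : [set x | _] = @digits R @^-1` `]-oo, a[%classic).
  exact: measurable_digits.
by apply/seteqP; split => x /=; rewrite in_itv.
Qed.

Let mDD (b : R) : measurable [set x : R | digits (dbl x) < b].
Proof.
rewrite -[X in measurable X]setTI (_ : [set x | _] = (fun x => digits (dbl x)) @^-1` `]-oo, b[%classic).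
  exact: measurable_digits_dbl.
by apply/seteqP; split => x /=; rewrite in_itv.
Qed.

Let mF (a b : R) : measurable [set x | digits x < a /\ digits (dbl x) < b].
Proof. exact: (measurableI _ _ (mD a) (mDD b)). Qed.

(** The endpoint 1 is a null set, discarded because the digit rule for the lower half holds only
    below 1. *)
Let U_ae (A B : set R) : measurable A -> measurable B ->
  (forall x, 0 <= x < 1 -> A x <-> B x) -> U A = U B.
Proof.
move=> mA mB AB; rewrite /unif01 /mrestr.
have H (C : set R) : measurable C ->
    leb (C `&` `[0, 1]%classic) = leb (C `&` `[0, 1[%classic).
  move=> mC; apply/eqP; rewrite eq_le; apply/andP; split; last first.
    apply: le_measure; rewrite ?inE; [exact: measurableI|exact: measurableI|].
    by apply: setIS => x /=; rewrite !in_itv/= => /andP[-> /ltW].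
  apply: (@le_trans _ _ (leb ((C `&` `[0, 1[%classic) `|` [set 1]))).
    apply: le_measure; rewrite ?inE.
    - exact: measurableI.
    - by apply: measurableU => //; exact: measurableI.
    - move=> x /= [Cx]; rewrite in_itv/= => /andP[x0]; rewrite le_eqVlt => /orP[/eqP ->|x1].
        by right.
      by left; split => //; rewrite in_itv/= x0.
  apply: (le_trans (measureU2 _ _ _)) => //; first exact: measurableI.
  by rewrite [X in (_ + X)%E](lebesgue_measure_set1 1) adde0.
rewrite !H//; congr (leb _); apply/seteqP; split => x /= [Cx x01]; split => //;
  by move: (x01); rewrite in_itv/= => /AB; tauto.
Qed.

(** Conditioning on the first binary digit; the exchange of the two families of digits swaps the
    arguments. *)
Let Frec (a b : R) : F a b = (2^-1%:E * (F b (2 * a) + F b (2 * a - 1)))%E.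
Proof.
rewrite /F unif01_split//; congr (_ * (_ + _))%E.
  apply: U_ae => //.
    rewrite -[X in measurable X]setTI; exact: measurable_half_add.
  move=> x /andP[x0 x1]; have /= [-> ->] := digits_half x1.
  by split => -[? ?]; split; lra.
apply: U_ae => //.
  rewrite -[X in measurable X]setTI; exact: measurable_half_add.
move=> x /andP[x0 x1]; have /= [-> ->] := digits_halfS x0.
by split => -[? ?]; split; lra.
Qed.

Let Fle1 a b : (0 <= F a b <= 1)%E.
Proof. by rewrite measure_ge0/= probability_le1. Qed.

Let Ffin a b : F a b \is a fin_num.
Proof.
have /andP[h0 h1] := Fle1 a b.
by rewrite ge0_fin_numE// (le_lt_trans h1)// ltry.
Qed.

Let G a b : R := fine (F a b) - clamp a * clamp b.

Let Grec a b : G a b = (G b (2 * a) + G b (2 * a - 1)) / 2.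
Proof.
rewrite /G Frec fineM ?fin_numD ?Ffin// fineD// /= (clamp_split a); ring.
Qed.

Let G1 a b : `|G a b| <= 1.
Proof.
have /andP[] := Fle1 a b; rewrite -(fineK (Ffin a b)) !lee_fin => f0 f1.
have /andP[a0 a1] := clamp01 a; have /andP[b0 b1] := clamp01 b.
rewrite ler_norml; apply/andP; split; rewrite /G; nra.
Qed.

Let Gr a b : b <= 0 -> G a b = 0.
Proof.
move=> b0; rewrite /G (clamp_le0 b0) mulr0 subr0 /F (_ : [set x | _] = set0) ?measure0//.
apply/seteqP; split => // x [_ xb]; have /andP[x0 _] := digits01 (dbl x); lra.
Qed.

Let Gl1 a b : 1 < a -> G a b = G 2 b.
Proof.
move=> a1; rewrite /G !(clamp_ge1 (a := a)) ?(clamp_ge1 (a := 2)) ?ler1n ?(ltW a1)//.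
congr (fine (U _) - _); apply/seteqP; split => x [_ xb]; split => //;
  have /andP[_ x1] := digits01 x; lra.
Qed.

Let Gr1 a b : 1 < b -> G a b = G a 2.
Proof.
move=> b1; rewrite /G !(clamp_ge1 (a := b)) ?(clamp_ge1 (a := 2)) ?ler1n ?(ltW b1)//.
congr (fine (U _) - _); apply/seteqP; split => x [xb _]; split => //;
  have /andP[_ x1] := digits01 (dbl x); lra.
Qed.

Let G22 : G 2 2 = 0.
Proof.
rewrite /G !clamp_ge1 ?ler1n// mulr1 /F (_ : [set x | _] = setT) ?unif01_setT ?subrr//.
apply/seteqP; split => // x _; have /andP[_ x1] := digits01 x.
by have /andP[_ x1'] := digits01 (dbl x); split; lra.
Qed.

Let Gswap a : G 2 a = G a 2.
Proof.
have h1 : 1 < 2 * 2 :> R by lra.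
have h2 : 1 < 2 * 2 - 1 :> R by lra.
by rewrite Grec (Gr1 a h1) (Gr1 a h2); lra.
Qed.

(** The marginal law has to come first. Where the value is not already 0, one term of [Grec]
    vanishes and [Gswap] brings the other back to second argument 2, at half the size. *)
Let Gm a : G a 2 = 0.
Proof.
apply: (@halving_eq0 R R (G ^~ 2)) => // i.
have [i0|i0] := leP (2 * i - 1) 0.
  right; exists (2 * i); rewrite Grec (Gr _ i0) addr0 Gswap normrM.
  by rewrite (ger0_norm (x := 2^-1))// invr_ge0.
have [i1|i1] := leP i 1; last by left; rewrite Gl1// G22.
have h : 1 < 2 * i by lra.
right; exists (2 * i - 1); rewrite Grec (Gr1 _ h).
by rewrite G22 add0r Gswap normrM (ger0_norm (x := 2^-1))// invr_ge0.
Qed.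

(** If [2 * a - 1] is at most 0, the second term of [Grec] vanishes; otherwise [2 * a] exceeds 1 and
    the first term is a marginal value, known to be 0. A single halved term remains. *)
Let G0 a b : G a b = 0.
Proof.
apply: (@halving_eq0 R (R * R) (fun i => G i.1 i.2) _ _ (a, b)) => // -[{}a {}b] /=.
have [i0|i0] := leP (2 * a - 1) 0.
  right; exists (b, 2 * a); rewrite Grec (Gr _ i0) addr0 normrM.
  by rewrite (ger0_norm (x := 2^-1))// invr_ge0.
have h : 1 < 2 * a by lra.
right; exists (b, 2 * a - 1); rewrite Grec (Gr1 _ h).
by rewrite Gm add0r normrM (ger0_norm (x := 2^-1))// invr_ge0.
Qed.

Lemma digits_cdf a b :
  U [set x | digits x < a /\ digits (dbl x) < b] = (clamp a * clamp b)%:E.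
Proof.
have /eqP := G0 a b; rewrite subr_eq0 => /eqP <-.
by rewrite fineK//; exact: Ffin.
Qed.

End digits_law.

(** * Image laws and densities *)

Section density.
Import HBNNSimple.

Lemma integral_with_density {R : realType} d (T : measurableType d)
    (mu m : {measure set T -> \bar R}) (phi : T -> R) (g : T -> \bar R) :
  measurable_fun setT phi -> (forall x, 0 <= phi x) ->
  (forall A, measurable A -> m A = \int[mu]_(x in A) (phi x)%:E)%E ->
  measurable_fun setT g -> (forall x, 0 <= g x)%E ->
  (\int[m]_x g x = \int[mu]_x (g x * (phi x)%:E))%E.
Proof.
move=> mphi phi0 mE mg g0.
pose f_ := nnsfun_approx measurableT mg.
have cf x : (fun n => (f_ n x)%:E) @ \oo --> g x by exact: cvg_nnsfun_approx.
have simple (h : {nnsfun T >-> R}) :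
    (\int[m]_x (h x)%:E = \int[mu]_x ((h x)%:E * (phi x)%:E))%E.
  transitivity (\sum_(r \in range h) (r%:E * m (h @^-1` [set r])))%E.
    under eq_integral do rewrite fimfunE -fsumEFin//.
    rewrite ge0_integral_fsum//; last 2 first.
    - by move=> r; exact/measurable_EFinP/measurable_funM.
    - by move=> r x _; rewrite nnfun_muleindic_ge0.
    apply: eq_fsbigr => r _; rewrite integralZl_indic_nnsfun// integral_indic//=.
    by rewrite setIT.
  transitivity (\sum_(r \in range h) \int[mu]_x ((r * \1_(h @^-1` [set r]) x)%:E * (phi x)%:E))%E.
    apply: eq_fsbigr => r; rewrite inE => -[x _ <-].
    rewrite mE// [in LHS]integral_mkcond -ge0_integralZl_EFin//; last 2 first.
    - by move=> y _; rewrite patchE; case: ifP => // _; rewrite lee_fin.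
    - apply/(measurable_restrictT (EFin \o phi)) => //.
      by apply: measurable_funTS; exact/measurable_EFinP.
    apply: eq_integral => y _; rewrite patchE indicE.
    by case: ifP => yh; rewrite ?mulr1 ?mulr0 ?mul0e ?mule0.
  rewrite -ge0_integral_fsum//.
  - apply: eq_integral => x _; rewrite [in RHS]fimfunE -fsumEFin// ge0_mule_fsuml//.
    by move=> r; exact: nnfun_muleindic_ge0.
  - move=> r; apply: emeasurable_funM; last exact/measurable_EFinP.
    by exact/measurable_EFinP/measurable_funM.
  - by move=> r x _; rewrite mule_ge0 ?lee_fin// -lee_fin nnfun_muleindic_ge0.
transitivity (limn (fun n => \int[m]_x (f_ n x)%:E)%E).
  rewrite -monotone_convergence//.
  - by apply: eq_integral => x _; apply/esym/cvg_lim => //; exact: cf.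
  - by move=> n; exact/measurable_EFinP.
  - by move=> n x _; rewrite lee_fin.
  - by move=> x _ a b ab; rewrite lee_fin; exact/lefP/nd_nnsfun_approx.
under eq_fun do rewrite simple.
rewrite -monotone_convergence//.
- apply: eq_integral => x _; apply/cvg_lim => //.
  by apply: cvgeZr => //; exact: cf.
- move=> n; apply: emeasurable_funM; exact/measurable_EFinP.
- by move=> n x _; rewrite mule_ge0// lee_fin.
- move=> x _ a b ab; rewrite lee_wpmul2r ?lee_fin//.
  exact/lefP/nd_nnsfun_approx.
Qed.

End density.

Lemma integral_leb {R : realType} (D : set R) (f : R -> \bar R) :
  measurable D -> measurable_fun D f -> (forall x, D x -> 0 <= f x)%E ->
  (\int[@leb R]_(x in D) f x = \int[@lebesgue_measure R]_(x in D) f x)%E.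
Proof.
move=> mD mf f0.
have mid : measurable_fun setT (idfun : measurableTypeR R -> R).
  by move=> _ Y mY; rewrite setTI.
rewrite (eq_measure_integral (pushforward (@lebesgue_measure R) (idfun : measurableTypeR R -> R)))//.
by rewrite ge0_integral_pushforward// => x /[!inE]; exact: f0.
Qed.

(** Rectangles determine the product measure, so the pair has the product law and Tonelli
    applies. *)
Lemma product_law {R : realType} d d1 d2 (X : measurableType d)
    (T1 : measurableType d1) (T2 : measurableType d2) (P : probability X R)
    (P1 : probability T1 R) (P2 : probability T2 R) (u : X -> T1) (s : X -> T2)
    (f : T1 * T2 -> \bar R) :
  measurable_fun setT u -> measurable_fun setT s ->
  (forall A B, measurable A -> measurable B ->
    P (u @^-1` A `&` s @^-1` B) = P1 A * P2 B)%E ->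
  measurable_fun setT f -> (forall z, 0 <= f z)%E ->
  (\int[P]_x f (u x, s x) = \int[P1]_y \int[P2]_z f (y, z))%E.
Proof.
move=> mu ms PE mf f0.
have mus : measurable_fun setT (fun x => (u x, s x)) by exact: measurable_fun_pair.
rewrite -[RHS](fubini_tonelli1 f mf f0).
transitivity (\int[pushforward P (fun x => (u x, s x))]_z f z)%E.
  by rewrite ge0_integral_pushforward.
apply: eq_measure_integral => A mA _; apply/esym.
apply: (@product_measure_unique _ _ _ _ _ P1 P2 (pushforward P (fun x => (u x, s x)))) => //.
Qed.

Lemma unif01_lty {R : realType} (A : set R) : measurable A -> (@unif01 R A < +oo)%E.
Proof. by move=> mA; rewrite (le_lt_trans (probability_le1 _ mA))// ltry. Qed.

(** From half-lines to Borel sets, one variable at a time: with one set frozen, both sides are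
    finite measures in the other set that agree on half-lines, first by [digits_cdf], then by the
    case already extended. *)
Lemma digits_joint {R : realType} (A B : set R) : measurable A -> measurable B ->
  (@unif01 R (digits @^-1` A `&` (fun x => digits (dbl x)) @^-1` B) =
   @unif01 R A * @unif01 R B)%E.
Proof.
move=> mA mB.
have mdA C : measurable C -> measurable (@digits R @^-1` C).
  by move=> mC; rewrite -[X in measurable X]setTI; exact: measurable_digits.
have mdB C : measurable C -> measurable ((fun x : R => digits (dbl x)) @^-1` C).
  by move=> mC; rewrite -[X in measurable X]setTI; exact: measurable_digits_dbl.
have restr (E : set R) : measurable E -> exists m : {measure set R -> \bar R},
    forall C, m C = @unif01 R (C `&` E).
  by move=> mE; exists (mrestr (@unif01 R) mE).
have scaled (c : R) : 0 <= c -> exists m : {measure set R -> \bar R},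
    forall C, m C = (c%:E * @unif01 R C)%E.
  by move=> c0; exists (mscale (NngNum c0) (@unif01 R)).
have step1 b : @unif01 R (digits @^-1` A `&` (fun x => digits (dbl x)) @^-1` `]-oo, b[%classic) =
    ((clamp b)%:E * @unif01 R A)%E.
  have [r rE] := restr _ (mdB _ (measurable_itv `]-oo, b[)).
  have [p pE] := pushforward_measure r (@measurable_digits R).
  have /andP[b0 _] := clamp01 b.
  have [q qE] := scaled _ b0.
  rewrite -qE -rE -pE; apply: finite_measure_rays => //.
    by rewrite pE rE preimage_setT setTI unif01_lty//; exact: mdB.
  move=> a; rewrite pE rE qE unif01_ray -EFinM mulrC -digits_cdf.
  by congr (unif01 _); apply/seteqP; split => x /=; rewrite !in_itv.
have [r rE] := restr _ (mdA _ mA).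
have [p pE] := pushforward_measure r (@measurable_digits_dbl R).
have fA : @unif01 R A \is a fin_num by rewrite ge0_fin_numE// unif01_lty.
have A0 : 0 <= fine (@unif01 R A) by rewrite fine_ge0.
have [q qE] := scaled _ A0.
rewrite setIC -rE -pE -(fineK fA) -qE; apply: finite_measure_rays => //.
  by rewrite pE rE preimage_setT setTI unif01_lty//; exact: mdA.
move=> b; rewrite pE rE qE fineK// setIC step1 unif01_ray muleC.
by [].
Qed.

(** * The exponential law by inversion *)

Definition expo {R : realType} (rate : R) (A : set R) : \bar R :=
  (\int[@leb R]_(x in A) (exponential_pdf rate x)%:E)%E.

Lemma expoE {R : realType} (rate : R) A : 0 < rate -> measurable A ->
  expo rate A = exponential_prob rate A.
Proof.
move=> r0 mA; rewrite /expo integral_leb//.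
  by apply: measurable_funTS; apply/measurable_EFinP; exact: measurable_exponential_pdf.
by move=> x _; rewrite lee_fin exponential_pdf_ge0// ltW.
Qed.

Lemma expo_ray {R : realType} (rate a : R) : 0 < rate ->
  expo rate `]-oo, a[%classic = (1 - expR (- rate * Num.max 0 a))%:E.
Proof.
move=> r0; rewrite expoE//.
have r0' := ltW r0.
have mpdf (D : set R) : measurable_fun (D : set (measurableTypeR R)) (fun x => (exponential_pdf rate x)%:E).
  by apply: measurable_funTS; apply/measurable_EFinP; exact: measurable_exponential_pdf.
have neg (D : set R) : D `<=` `]-oo, 0[%classic -> exponential_prob rate D = 0%E.
  move=> D0; rewrite /exponential_prob integral0_eq// => x /D0 /=.
  by rewrite in_itv/= => x0; rewrite lt0_exponential_pdf.
have [a0|a0] := leP a 0.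
  rewrite neg; last by move=> x /=; rewrite !in_itv/= => /lt_le_trans; apply.
  by rewrite mulr0 expR0 subrr.
rewrite -[RHS]exponential_prob_itv0c// /exponential_prob.
have -> : `]-oo, a[%classic = `]-oo, 0[%classic `|` `[0, a[%classic :> set R.
  apply/seteqP; split => x /=; rewrite !in_itv/=.
    by move=> xa; have [x0|x0] := ltP x 0; [left|right; rewrite xa].
  by move=> [/lt_trans|/andP[]//]; apply.
rewrite ge0_integral_setU//=.
- rewrite [X in (X + _)%E](neg `]-oo, 0[%classic)// add0e.
  by apply: integral_itv_bndo_bndc; exact: mpdf.
- by move=> x _; rewrite lee_fin exponential_pdf_ge0.
- by apply/disj_setPS => x [/=]; rewrite !in_itv/= => x0 /andP[]; lra.
Qed.

Lemma expo_measure {R : realType} (rate : R) : 0 < rate ->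
  exists m : {measure set R -> \bar R}, forall A, measurable A -> m A = expo rate A.
Proof.
move=> r0; pose e_ : {measure set (measurableTypeR R) -> \bar R} := exponential_prob rate.
have mid : measurable_fun setT (idfun : measurableTypeR R -> R).
  by move=> _ Y mY; rewrite setTI.
have [m mE] := pushforward_measure (e_ r0) mid.
by exists m => A mA; rewrite mE expoE.
Qed.

Lemma unif01_ae {R : realType} (A B : set R) : measurable A -> measurable B ->
  (forall x, 0 < x < 1 -> A x <-> B x) -> @unif01 R A = @unif01 R B.
Proof.
move=> mA mB AB; rewrite /unif01 /mrestr.
have H (C : set R) : measurable C ->
    leb (C `&` `[0, 1]%classic) = leb (C `&` `]0, 1[%classic).
  move=> mC; apply/eqP; rewrite eq_le; apply/andP; split; last first.
    apply: le_measure; rewrite ?inE; [exact: measurableI|exact: measurableI|].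
    by apply: setIS => x /=; rewrite !in_itv/= => /andP[/ltW -> /ltW].
  apply: (@le_trans _ _ (leb ((C `&` `]0, 1[%classic) `|` ([set 0] `|` [set 1])))).
    apply: le_measure; rewrite ?inE.
    - exact: measurableI.
    - by apply: measurableU; [exact: measurableI|exact: measurableU].
    - move=> x /= [Cx]; rewrite in_itv/= => /andP[].
      rewrite le_eqVlt => /orP[/eqP <-|x0]; first by right; left.
      rewrite le_eqVlt => /orP[/eqP ->|x1]; first by right; right.
      by left; split => //; rewrite in_itv/= x0.
  apply: (le_trans (measureU2 _ _ _)) => //; [exact: measurableI|exact: measurableU|].
  rewrite [X in (_ + X)%E](_ : _ = 0%E) ?adde0//.
  apply/eqP; rewrite eq_le measure_ge0 andbT.
  apply: (le_trans (measureU2 _ _ _)) => //.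
  by rewrite [X in (X + _)%E](lebesgue_measure_set1 0) [X in (_ + X)%E](lebesgue_measure_set1 1) adde0.
rewrite !H//; congr (leb _); apply/seteqP; split => x /= [Cx x01]; split => //;
  by move: (x01); rewrite in_itv/= => /AB; tauto.
Qed.

Lemma measurable_neg_ln {R : realType} (rate : R) :
  measurable_fun setT (fun x : R => - ln x / rate).
Proof.
by apply: measurable_funM => //; apply: measurableT_comp => //; exact: measurable_ln.
Qed.

(** Inversion of the distribution function: for [x] in ]0, 1[ and positive [a], [- ln x / rate < a]
    means [x > expR (- rate * a)]. *)
Lemma neg_ln_law {R : realType} (rate : R) (A : set R) : 0 < rate -> measurable A ->
  @unif01 R ((fun x => - ln x / rate) @^-1` A) = expo rate A.
Proof.
move=> r0 mA.
have [p pE] := pushforward_measure (@unif01 R) (measurable_neg_ln rate).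
have [m mE] := expo_measure r0.
rewrite -pE -mE//; apply: finite_measure_rays => //; first by rewrite pE preimage_setT unif01_lty.
move=> a; rewrite mE// expo_ray// pE.
have [a0|a0] := leP a 0.
  rewrite mulr0 expR0 subrr -[RHS](measure0 (@unif01 R)); apply: unif01_ae => //.
    by rewrite -[X in measurable X]setTI; exact: measurable_neg_ln.
  move=> x /andP[x0 x1]; split => //=; rewrite in_itv/= ltr_pdivrMr//.
  have := ln_le0 (ltW x1); nra.
have e1 : expR (- rate * a) <= 1.
  by rewrite -expR0 ler_expR mulNr oppr_le0 mulr_ge0// ltW.
apply: (etrans (@unif01_ae R _ `]expR (- rate * a), 1]%classic _ _ _)) => //.
- by rewrite -[X in measurable X]setTI; exact: measurable_neg_ln.
- move=> x /andP[x0 x1] /=; rewrite !in_itv/= (ltW x1) andbT ltr_pdivrMr//.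
  by rewrite -{2}(lnK x0) ltr_expR; split; lra.
- rewrite /unif01 /mrestr (_ : _ `&` _ = `]expR (- rate * a), 1]%classic).
    rewrite /leb lebesgue_measure_itv/= lte_fin.
    rewrite ifT ?EFinB//; rewrite -expR0 ltr_expR mulNr oppr_lt0 mulr_gt0//.
  apply/setIidl => x /=; rewrite !in_itv/= => /andP[ex ->].
  by rewrite andbT ltW// (lt_trans (expR_gt0 _) ex).
Qed.

Lemma integral_neg_ln {R : realType} (rate : R) (g : R -> \bar R) : 0 < rate ->
  measurable_fun setT g -> (forall x, 0 <= g x)%E ->
  (\int[@unif01 R]_x g (- ln x / rate)%R =
   \int[@lebesgue_measure R]_(x in `[0%R, +oo[) (g x * (rate * expR (- rate * x))%:E))%E.
Proof.
move=> r0 mg g0.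
have [p pE] := pushforward_measure (@unif01 R) (measurable_neg_ln rate).
have mpdf := @measurable_exponential_pdf R rate.
have pdf0 x : 0 <= exponential_pdf rate x by rewrite exponential_pdf_ge0// ltW.
transitivity (\int[p]_x g x)%E.
  by rewrite (integral_image_measure (measurable_neg_ln rate) pE mg g0).
rewrite (@integral_with_density R _ R (@leb R) p (exponential_pdf rate) g)//.
- rewrite integral_leb//; last 2 first.
  + by apply: emeasurable_funM => //; exact/measurable_EFinP.
  + by move=> x _; rewrite mule_ge0// lee_fin.
  rewrite [RHS]integral_mkcond; apply: eq_integral => x _.
  rewrite patchE; case: ifPn => [|].
    by rewrite inE/= in_itv/= andbT => x0; rewrite exponential_pdfE.
  rewrite notin_setE/= in_itv/= andbT => /negP; rewrite -ltNge => x0.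
  by rewrite lt0_exponential_pdf// mule0.
- by move=> A mA; rewrite pE; exact: neg_ln_law.
Qed.

(** * Exponential variables *)

(** The absolute value, in place of a minus sign, makes [gexp] nonnegative on the whole line; the
    two agree for [v] in ]0, 1[, hence almost surely. *)
Definition gexp {R : realType} (rate v : R) : R := `|ln v| / rate.

Lemma gexp_ge0 {R : realType} (rate v : R) : 0 < rate -> 0 <= gexp rate v.
Proof. by move=> r0; rewrite divr_ge0// ltW. Qed.

Lemma measurable_gexp {R : realType} (rate : R) : measurable_fun setT (gexp rate).
Proof.
apply: measurable_funM => //; apply: measurableT_comp => //; exact: measurable_ln.
Qed.

Lemma gexp_law {R : realType} (rate : R) (A : set R) : 0 < rate -> measurable A ->
  @unif01 R (gexp rate @^-1` A) = expo rate A.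
Proof.
move=> r0 mA; rewrite -neg_ln_law//; apply: unif01_ae.
- by rewrite -[X in measurable X]setTI; exact: measurable_gexp.
- by rewrite -[X in measurable X]setTI; exact: measurable_neg_ln.
- by move=> x /andP[x0 x1]; rewrite /preimage/= /gexp ler0_norm// ln_le0// ltW.
Qed.

Lemma integral_gexp {R : realType} (rate : R) (g : R -> \bar R) : 0 < rate ->
  measurable_fun setT g -> (forall x, 0 <= g x)%E ->
  (\int[@unif01 R]_x g (gexp rate x) =
   \int[@lebesgue_measure R]_(x in `[0%R, +oo[) (g x * (rate * expR (- rate * x))%:E))%E.
Proof.
move=> r0 mg g0.
have mgn : measurable_fun setT (fun x : R => g `|x|) by apply: measurableT_comp.
rewrite -[LHS](_ : \int[@unif01 R]_x g `|- ln x / rate|%R = _)%E; last first.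
  by apply: eq_integral => x _; rewrite normrM normrN (gtr0_norm (x := rate^-1)) ?invr_gt0.
rewrite (integral_neg_ln (g := fun x => g `|x|) r0 mgn)//.
by apply: eq_integral => x; rewrite inE/= in_itv/= andbT => x0; rewrite ger0_norm.
Qed.

(** [g] is nonnegative on the whole line, as the image integral asks, while [psi] is the expression
    on the half-line for which an antiderivative is at hand: for the mean, the absolute value and
    the identity. *)
Lemma integral_gexp_FTC {R : realType} (rate : R) (g psi F : R -> R) (l : R) :
  0 < rate -> measurable_fun setT g -> (forall x, 0 <= g x) ->
  (forall x, 0 <= x -> g x = psi x) -> continuous psi ->
  (forall x : R, is_derive x (1 : R) F (psi x * (rate * expR (- rate * x)))) ->
  F x @[x --> +oo%R] --> l ->
  (\int[@unif01 R]_x (g (gexp rate x))%:E = (l - F 0)%:E)%E.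
Proof.
move=> r0 mg g0 gpsi cpsi dF Fl.
rewrite (integral_gexp (g := EFin \o g) r0)//; last exact/measurable_EFinP.
transitivity (\int[@lebesgue_measure R]_(x in `[0%R, +oo[)
    ((psi x * (rate * expR (- rate * x)))%:E))%E.
  by apply: eq_integral => x; rewrite inE/= in_itv/= andbT => x0; rewrite gpsi.
have cexp : continuous (fun x : R => psi x * (rate * expR (- rate * x))).
  move=> x; apply: cvgM; first exact: cpsi.
  apply: cvgM; first exact: cvg_cst.
  apply: continuous_comp; last exact: continuous_expR.
  by apply: cvgM; [exact: cvg_cst|exact: cvg_id].
rewrite EFinB; apply: (@ge0_continuous_FTC2y R _ F) => //.
- by move=> x x0; rewrite -gpsi// mulr_ge0// mulr_ge0 ?expR_ge0// ltW.
- by apply: continuous_subspaceT => x; exact: cexp.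
- apply: cvg_at_right_filter; apply: differentiable_continuous.
  by apply/derivable1_diffP; have := dF 0; case.
- by move=> x _; rewrite derive1E; have := dF x; case.
Qed.

Lemma cvg_expR_scale {R : realType} (rate : R) : 0 < rate ->
  expR (- rate * x) @[x --> +oo%R] --> (0 : R).
Proof.
move=> r0; rewrite (_ : (fun x => _) = (fun z => expR (- z)) \o (fun z => rate * z)).
  apply: (@cvg_comp _ _ _ _ _ _ (pinfty_nbhs R)); last exact: cvgr_expR.
  exact: gt0_cvgMry.
by apply/funext => x; rewrite /= mulNr.
Qed.

Lemma gexp_mean {R : realType} (rate : R) : 0 < rate ->
  (\int[@unif01 R]_x (gexp rate x)%:E = (rate^-1)%:E)%E.
Proof.
move=> r0; have rn0 : rate != 0 by rewrite gt_eqF.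
transitivity (\int[@unif01 R]_x (`|gexp rate x|%R)%:E)%E.
  by apply: eq_integral => x _; rewrite ger0_norm// gexp_ge0.
have dF (x : R) : is_derive x (1 : R) (fun x => - ((x + rate^-1) * expR (- rate * x)))
    (x * (rate * expR (- rate * x))).
  apply: is_derive_eq; rewrite /GRing.scale/=.
  by field.
have Fl : (fun x => - ((x + rate^-1) * expR (- rate * x))) x @[x --> +oo%R] --> (0 : R).
  rewrite -oppr0; apply: cvgN.
  have r2 : 0 < rate / 2 by rewrite divr_gt0.
  (* Half of the exponential absorbs the linear factor: 1 + rate x <= 3 (1 + rate x / 2) <= 3
     exp(rate x / 2). *)
  apply: (@squeeze_cvgr _ _ _ _ (fun=> 0) (fun x => 3 / rate * expR (- (rate / 2) * x))).
  - near=> x; have x0 : 0 <= x by near: x; exact: nbhs_pinfty_ge.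
    have xr : 0 <= x + rate^-1 by rewrite addr_ge0// invr_ge0 ltW.
    rewrite mulr_ge0 ?expR_ge0//=.
    have -> : - rate * x = - (rate / 2) * x + - (rate / 2) * x by field.
    rewrite expRD mulrA ler_wpM2r ?expR_ge0//.
    rewrite mulNr expRN ler_pdivrMr ?expR_gt0//.
    apply: (@le_trans _ _ (3 / rate * (1 + rate / 2 * x))).
      rewrite -(ler_pM2l r0) mulrDr mulfV// [leRHS]mulrA [rate * (3 / rate)]mulrC mulfVK//.
      by have : 0 <= rate * x; [rewrite mulr_ge0// ltW|nra].
    by rewrite ler_wpM2l ?expR_ge1Dx// divr_ge0// ltW.
  - exact: cvg_cst.
  - rewrite -(mulr0 (3 / rate)); apply: cvgM; first exact: cvg_cst.
    exact: cvg_expR_scale.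
apply: (etrans (@integral_gexp_FTC R rate (fun x => `|x|) id
  (fun x => - ((x + rate^-1) * expR (- rate * x))) 0 r0 _ _ _ _ dF Fl)) => //.
- by move=> x x0; rewrite ger0_norm.
- by move=> x; exact: cvg_id.
- by rewrite mulr0 expR0 mulr1 !add0r opprK.
Unshelve. all: by end_near. Qed.

(* The second moment is 2 / rate^2; a crude bound suffices. *)
Lemma gexp_sqr {R : realType} (rate : R) : 0 < rate ->
  (\int[@unif01 R]_x (gexp rate x ^+ 2)%:E <= (32 * rate ^- 2)%:E)%E.
Proof.
move=> r0; have rn0 : rate != 0 by rewrite gt_eqF.
have r2 : 0 < rate / 2 by rewrite divr_gt0.
(* Squaring rate y / 4 <= exp(rate y / 4) gives the factor 16; the exponential moment at half the
   rate is 2, whence 32. *)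
apply: (@le_trans _ _ (\int[@unif01 R]_x (16 * rate ^- 2 * expR (rate / 2 * gexp rate x))%:E)%E).
  apply: ge0_le_integral => //.
  - by move=> x _; rewrite lee_fin sqr_ge0.
  - by apply/measurable_EFinP; apply: measurable_funX; exact: measurable_gexp.
  - apply/measurable_EFinP; apply: measurable_funM => //.
    apply: measurableT_comp => //; apply: measurable_funM => //; exact: measurable_gexp.
  - move=> x _; rewrite lee_fin; have := gexp_ge0 x r0; move: (gexp rate x) => y y0.
    have h : 1 + rate / 4 * y <= expR (rate / 4 * y) by exact: expR_ge1Dx.
    have -> : rate / 2 * y = rate / 4 * y + rate / 4 * y by field.
    rewrite expRD -expr2.
    have h2 : (rate / 4 * y) ^+ 2 <= expR (rate / 4 * y) ^+ 2.
      rewrite ler_pXn2r ?nnegrE ?expR_ge0//; first by apply: le_trans h; lra.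
      by rewrite mulr_ge0// divr_ge0// ltW.
    apply: (@le_trans _ _ (16 * rate ^- 2 * (rate / 4 * y) ^+ 2)).
      by rewrite le_eqVlt; apply/orP; left; apply/eqP; field.
    by rewrite ler_wpM2l// mulr_ge0// invr_ge0 exprn_ge0// ltW.
rewrite (integral_gexp (g := fun y => (16 * rate ^- 2 * expR (rate / 2 * y))%:E) r0); last 2 first.
- apply/measurable_EFinP; apply: measurable_funM => //.
  by apply: measurableT_comp => //; exact: mulrl_measurable.
- by move=> x; rewrite lee_fin mulr_ge0 ?expR_ge0// mulr_ge0// invr_ge0 exprn_ge0// ltW.
have E := integral_exponential_pdf r2.
have -> : (32 * rate ^- 2)%:E = ((32 * rate ^- 2)%:E * \int[@lebesgue_measure R]_x (exponential_pdf (rate / 2) x)%:E)%E.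
  by rewrite E mule1.
rewrite -ge0_integralZl_EFin//; last 3 first.
- by move=> x _; rewrite lee_fin exponential_pdf_ge0// ltW.
- by apply/measurable_EFinP; exact: measurable_exponential_pdf.
- by rewrite mulr_ge0// invr_ge0 exprn_ge0// ltW.
rewrite le_eqVlt; apply/orP; left; apply/eqP.
rewrite [LHS]integral_mkcond; apply: eq_integral => x _; rewrite patchE.
case: ifPn => [|].
  rewrite inE/= in_itv/= andbT => x0; rewrite exponential_pdfE// -!EFinM; congr (_%:E).
  have -> : - rate * x = - (rate / 2) * x + - (rate / 2) * x by field.
  have -> : rate / 2 * x = - (- (rate / 2) * x) by rewrite mulNr opprK.
  move: (- (rate / 2) * x) => z; rewrite expRD expRN.
  have e0 : expR z != 0 by rewrite gt_eqF ?expR_gt0.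
  by field; rewrite ?e0 ?rn0.
rewrite notin_setE/= in_itv/= andbT => /negP; rewrite -ltNge => x0.
by rewrite lt0_exponential_pdf// mule0.
Qed.

(** The fraction is the real part of rate / (rate - i t), the characteristic function of the
    exponential law; [gexp_sin] gives the imaginary part. The added 1 makes the integrand
    nonnegative and produces the first term of [F]. *)
Lemma gexp_cos {R : realType} (rate t : R) : 0 < rate ->
  (\int[@unif01 R]_x (1 + cos (t * gexp rate x))%:E =
   (1 + rate ^+ 2 / (rate ^+ 2 + t ^+ 2))%:E)%E.
Proof.
move=> r0; have rn0 : rate != 0 by rewrite gt_eqF.
have d0 : rate ^+ 2 + t ^+ 2 != 0 by rewrite gt_eqF// ltr_wpDr ?sqr_ge0// exprn_gt0.
pose c := rate / (rate ^+ 2 + t ^+ 2).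
pose F (x : R) := - expR (- rate * x) +
  c * (expR (- rate * x) * (t * sin (t * x) - rate * cos (t * x))).
have dF (x : R) : is_derive x (1 : R) F ((1 + cos (t * x)) * (rate * expR (- rate * x))).
  apply: is_derive_eq; rewrite /GRing.scale/= /c.
  by field.
have Fl : F x @[x --> +oo%R] --> (0 : R).
  have e := cvg_expR_scale r0.
  rewrite (_ : 0 = - 0 + c * 0); last by rewrite mulr0 oppr0 addr0.
  apply: cvgD; first exact: cvgN.
  apply: cvgM; first exact: cvg_cst.
  apply: norm_cvg0.
  apply: (@squeeze_cvgr _ _ _ _ (fun=> 0) (fun x => (`|t| + rate) * expR (- rate * x))).
  - near=> x; rewrite normr_ge0/= normrM (ger0_norm (expR_ge0 _)) mulrC ler_wpM2r ?expR_ge0//.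
    apply: le_trans (ler_normB _ _) _; rewrite !normrM (gtr0_norm r0) lerD//.
      by rewrite ler_piMr// ler_norml sin_geN1 sin_le1.
    by rewrite ler_piMr ?(ltW r0)// ler_norml cos_geN1 cos_le1.
  - exact: cvg_cst.
  - rewrite -(mulr0 (`|t| + rate)); apply: cvgM; first exact: cvg_cst.
    exact: e.
have ctx : continuous (fun x : R => 1 + cos (t * x)).
  move=> x; apply: cvgD; first exact: cvg_cst.
  apply: continuous_comp; last exact: continuous_cos.
  by apply: cvgM; [exact: cvg_cst|exact: cvg_id].
apply: (etrans (@integral_gexp_FTC R rate (fun x => 1 + cos (t * x))
  (fun x => 1 + cos (t * x)) F 0 r0 _ _ _ ctx dF Fl)) => //.
- exact: continuous_measurable_fun.
- by rewrite /F !mulr0 expR0 sin0 cos0 /c; congr (_%:E); field.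
Unshelve. all: by end_near. Qed.

Lemma gexp_sin {R : realType} (rate t : R) : 0 < rate ->
  (\int[@unif01 R]_x (1 + sin (t * gexp rate x))%:E =
   (1 + rate * t / (rate ^+ 2 + t ^+ 2))%:E)%E.
Proof.
move=> r0; have rn0 : rate != 0 by rewrite gt_eqF.
have d0 : rate ^+ 2 + t ^+ 2 != 0 by rewrite gt_eqF// ltr_wpDr ?sqr_ge0// exprn_gt0.
pose c := rate / (rate ^+ 2 + t ^+ 2).
pose F (x : R) := - expR (- rate * x) -
  c * (expR (- rate * x) * (rate * sin (t * x) + t * cos (t * x))).
have dF (x : R) : is_derive x (1 : R) F ((1 + sin (t * x)) * (rate * expR (- rate * x))).
  apply: is_derive_eq; rewrite /GRing.scale/= /c.
  by field.
have Fl : F x @[x --> +oo%R] --> (0 : R).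
  have e := cvg_expR_scale r0.
  rewrite (_ : 0 = - 0 - c * 0); last by rewrite mulr0 oppr0 addr0.
  apply: cvgB; first exact: cvgN.
  apply: cvgM; first exact: cvg_cst.
  apply: norm_cvg0.
  apply: (@squeeze_cvgr _ _ _ _ (fun=> 0) (fun x => (rate + `|t|) * expR (- rate * x))).
  - near=> x; rewrite normr_ge0/= normrM (ger0_norm (expR_ge0 _)) mulrC ler_wpM2r ?expR_ge0//.
    apply: le_trans (ler_normD _ _) _; rewrite !normrM (gtr0_norm r0) lerD//.
      by rewrite ler_piMr ?(ltW r0)// ler_norml sin_geN1 sin_le1.
    by rewrite ler_piMr// ler_norml cos_geN1 cos_le1.
  - exact: cvg_cst.
  - rewrite -(mulr0 (rate + `|t|)); apply: cvgM; first exact: cvg_cst.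
    exact: e.
have ctx : continuous (fun x : R => 1 + sin (t * x)).
  move=> x; apply: cvgD; first exact: cvg_cst.
  apply: continuous_comp; last exact: continuous_sin.
  by apply: cvgM; [exact: cvg_cst|exact: cvg_id].
apply: (etrans (@integral_gexp_FTC R rate (fun x => 1 + sin (t * x))
  (fun x => 1 + sin (t * x)) F 0 r0 _ _ _ ctx dF Fl)) => //.
- exact: continuous_measurable_fun.
- by rewrite /F !mulr0 expR0 sin0 cos0 /c; congr (_%:E); field.
Unshelve. all: by end_near. Qed.

Lemma gexp_tail {R : realType} (rate a : R) : 0 < rate -> 0 <= a ->
  @unif01 R [set v | a <= gexp rate v] = (expR (- rate * a))%:E.
Proof.
move=> r0 a0.
have mA : measurable (gexp rate @^-1` `]-oo, a[%classic).
  by rewrite -[X in measurable X]setTI; exact: measurable_gexp.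
have -> : [set v | a <= gexp rate v] = ~` (gexp rate @^-1` `]-oo, a[%classic).
  apply/seteqP; split => x /=; rewrite in_itv/=; last by move=> /negP; rewrite -leNgt.
  by rewrite leNgt => /negP.
rewrite probability_setC//; rewrite [X in (1 - X)%E](gexp_law r0 (measurable_itv _)).
by rewrite expo_ray// max_r// -EFinB opprB addrC subrK.
Qed.

(** * Series of independent variables *)

Definition tail_digits {R : realType} (w : R) : R := digits (dbl w).

(** Independent uniform variables on one copy of the unit interval: the first is made of the digits
    of even rank, and the others are read in the same way from the digits that remain. *)
Definition xi {R : realType} (k : nat) (w : R) : R := digits (iter k tail_digits w).

Lemma xiSr {R : realType} k (w : R) : xi k.+1 w = xi k (tail_digits w).
Proof. by rewrite /xi iterSr. Qed.

Lemma measurable_xi {R : realType} k : measurable_fun setT (@xi R k).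
Proof.
apply: measurableT_comp; first exact: measurable_digits.
elim: k => [|k IH] /=; first exact: measurable_id.
by apply: measurableT_comp IH; exact: measurable_digits_dbl.
Qed.

(** Integrates out the first variable, the tail being a fresh uniform point. Second moments, the
    maximal inequality and the characteristic functions of sums all follow from it by induction. *)
Lemma integral_digits {R : realType} (f : R * R -> \bar R) :
  measurable_fun setT f -> (forall z, 0 <= f z)%E ->
  (\int[@unif01 R]_w f (digits w, tail_digits w) =
   \int[@unif01 R]_v \int[@unif01 R]_w f (v, w))%E.
Proof.
move=> mf f0; apply: (product_law (P := @unif01 R)) => //.
- exact: measurable_digits.
- exact: measurable_digits_dbl.
- exact: digits_joint.
Qed.

Definition xsum {R : realType} (y : nat -> R -> R) (m : nat) (w : R) : R :=
  \sum_(k < m) y k (xi k w).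

Lemma xsumS {R : realType} (y : nat -> R -> R) m w :
  xsum y m.+1 w = y 0%N (digits w) + xsum (fun k => y k.+1) m (tail_digits w).
Proof.
rewrite /xsum big_ord_recl; congr (_ + _).
by apply: eq_bigr => k _; rewrite -xiSr.
Qed.

Lemma measurable_xsum {R : realType} (y : nat -> R -> R) m :
  (forall k, measurable_fun setT (y k)) -> measurable_fun setT (xsum y m).
Proof.
move=> my; rewrite /xsum; apply: measurable_sum => k.
by apply: measurableT_comp => //; exact: measurable_xi.
Qed.

Lemma measurable_xsum_pair {R : realType} (y : nat -> R -> R) m (c : R) :
  (forall k, measurable_fun setT (y k)) ->
  measurable_fun setT (fun z : R * R => c + y 0%N z.1 + xsum (fun k => y k.+1) m z.2).
Proof.
move=> my; apply: measurable_funD.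
  by apply: measurable_funD => //; apply: measurableT_comp.
by apply: measurableT_comp => //; exact: measurable_xsum.
Qed.

(** Asking the bound for every starting point [c] packs a vanishing mean and a second moment at most
    [v k] into one inequality between nonnegative integrals, which the induction propagates. *)
Lemma xsum_second_moment {R : realType} (y : nat -> R -> R) (v : nat -> R) :
  (forall k, measurable_fun setT (y k)) ->
  (forall k c, \int[@unif01 R]_x ((c + y k x) ^+ 2)%:E <= (c ^+ 2 + v k)%:E)%E ->
  forall m c, (\int[@unif01 R]_w ((c + xsum y m w) ^+ 2)%:E <=
    (c ^+ 2 + \sum_(k < m) v k)%:E)%E.
Proof.
move=> my yv m; elim: m y v my yv => [|m IH] y v my yv c.
  rewrite big_ord0 addr0 /xsum; under eq_integral do rewrite big_ord0 addr0.
  by rewrite integral_cst//= [X in (_ * X)%E]probability_setT mule1.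
pose f (z : R * R) := ((c + y 0%N z.1 + xsum (fun k => y k.+1) m z.2) ^+ 2)%:E.
rewrite [leLHS](_ : _ = \int[@unif01 R]_w f (digits w, tail_digits w))%E; last first.
  by apply: eq_integral => w _; rewrite /f xsumS addrA.
have mf : measurable_fun setT f.
  by apply/measurable_EFinP; apply: measurable_funX; exact: measurable_xsum_pair.
rewrite integral_digits//; last by move=> z; rewrite lee_fin sqr_ge0.
have V0 : (0 <= (\sum_(k < m) v k.+1)%:E)%E.
  rewrite lee_fin; apply: sumr_ge0 => k _.
  have := yv k.+1 0; rewrite expr0n add0r -lee_fin; apply: le_trans.
  by apply: integral_ge0 => x _; rewrite lee_fin sqr_ge0.
apply: (@le_trans _ _ (\int[@unif01 R]_x (((c + y 0%N x) ^+ 2)%:E + (\sum_(k < m) v k.+1)%:E))%E).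
  apply: ge0_le_integral => //.
  - by move=> x _; apply: integral_ge0 => w _; rewrite lee_fin sqr_ge0.
  - apply: (measurable_fun_fubini_tonelli_F f) => // z.
    by rewrite lee_fin sqr_ge0.
  - by apply: emeasurable_funD => //; apply/measurable_EFinP; apply: measurable_funX; apply: measurable_funD.
  - by move=> x _; rewrite /f/= -EFinD; exact: (IH (fun k => y k.+1) (fun k => v k.+1)).
rewrite ge0_integralD//; last 2 first.
- by move=> x _; rewrite lee_fin sqr_ge0.
- by apply/measurable_EFinP; apply: measurable_funX; apply: measurable_funD.
rewrite integral_cst//= [X in (_ + _ * X)%E]probability_setT mule1.
by rewrite big_ord_recl addrA EFinD leeD2r//; exact: yv.
Qed.

(* Kolmogorov's inequality; the starting point [c] makes the induction on the
   number of summands go through by conditioning on the first one. *)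
Lemma xsum_maximal {R : realType} (y : nat -> R -> R) (v : nat -> R) (eps : R) :
  0 < eps ->
  (forall k, measurable_fun setT (y k)) ->
  (forall k c, \int[@unif01 R]_x ((c + y k x) ^+ 2)%:E <= (c ^+ 2 + v k)%:E)%E ->
  forall m c, (@unif01 R [set w | exists2 i, (i <= m)%N & (eps <= `|c + xsum y i w|)%R]
    <= ((c ^+ 2 + \sum_(k < m) v k) / eps ^+ 2)%:E)%E.
Proof.
move=> e0 my yv m; elim: m y v my yv => [|m IH] y v my yv c.
  rewrite big_ord0 addr0; have [ec|ec] := leP eps `|c|.
    apply: (@le_trans _ _ 1%E).
      rewrite probability_le1// (_ : [set _ | _] = setT)//.
      apply/seteqP; split => // w _; exists 0%N => //.
      by rewrite /xsum big_ord0 addr0.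
    rewrite lee_fin ler_pdivlMr ?exprn_gt0// mul1r -(real_normK (num_real c)).
    by rewrite ler_pXn2r ?nnegrE// ltW.
  rewrite (_ : [set _ | _] = set0) ?measure0 ?lee_fin ?divr_ge0 ?sqr_ge0//.
  apply/seteqP; split => // w [[|//] _]; rewrite /xsum big_ord0 addr0.
  by move=> /(lt_le_trans ec); rewrite ltxx.
have v0 k : 0 <= v k.
  have := yv k 0; rewrite expr0n add0r -lee_fin; apply: le_trans.
  by apply: integral_ge0 => x _; rewrite lee_fin sqr_ge0.
(* If the walk starts beyond [eps], the claimed bound is at least 1. Otherwise index 0 never
   contributes, and the first summand can be integrated out. *)
have [ec|ec] := leP eps `|c|.
  apply: (@le_trans _ _ 1%E).
    rewrite probability_le1// (_ : [set _ | _] = setT)//.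
    apply/seteqP; split => // w _; exists 0%N => //.
    by rewrite /xsum big_ord0 addr0.
  rewrite lee_fin ler_pdivlMr ?exprn_gt0// mul1r -(real_normK (num_real c)).
  apply: (@le_trans _ _ (`|c| ^+ 2)); first by rewrite ler_pXn2r ?nnegrE// ltW.
  by rewrite lerDl sumr_ge0.
pose E : set (R * R) := \bigcup_(i in [set i | (i <= m)%N])
  [set z | eps <= `|c + y 0%N z.1 + xsum (fun k => y k.+1) i z.2|].
have mE : measurable E.
  apply: bigcup_measurable => i _.
  rewrite -[X in measurable X]setTI.
  rewrite (_ : [set z | _] = (fun z : R * R => `|c + y 0%N z.1 + xsum (fun k => y k.+1) i z.2|)
     @^-1` `[eps, +oo[%classic).
    apply: measurableT_comp => //; exact: measurable_xsum_pair.
  by apply/seteqP; split => z /=; rewrite in_itv/= andbT.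
have mds : measurable_fun setT (fun w : R => (digits w, tail_digits w)).
  by apply: measurable_fun_pair; [exact: measurable_digits|exact: measurable_digits_dbl].
rewrite (_ : [set _ | _] = (fun w => (digits w, tail_digits w)) @^-1` E); last first.
  apply/seteqP; split => w.
    move=> [[|i] im]; rewrite ?xsumS ?addrA.
      by rewrite /xsum big_ord0 addr0 => /(lt_le_trans ec); rewrite ltxx.
    by move=> h; exists i.
  by move=> [i /= im h]; exists i.+1 => //; rewrite xsumS addrA.
pose f (z : R * R) := ((\1_E z : R)%:E).
have mf : measurable_fun setT f by apply/measurable_EFinP; exact: measurable_indic.
have f0 z : (0 <= f z)%E by rewrite lee_fin indicE ler0n.
have mpre : measurable ((fun w : R => (digits w, tail_digits w)) @^-1` E).
  by rewrite -[X in measurable X]setTI; exact: mds.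
rewrite -[X in @unif01 R X]setIT -(@integral_indic _ _ R (@unif01 R) setT)//.
rewrite (_ : (\int[@unif01 R]_x _ = \int[@unif01 R]_w f (digits w, tail_digits w))%E)//.
rewrite (integral_digits mf f0).
apply: (@le_trans _ _ (\int[@unif01 R]_x ((eps ^- 2)%:E *
    (((c + y 0%N x) ^+ 2)%:E + (\sum_(k < m) v k.+1)%:E)))%E).
  have e2 : 0 <= eps ^- 2 by rewrite invr_ge0 exprn_ge0// ltW.
  apply: ge0_le_integral => //.
  - by move=> x _; apply: integral_ge0 => w _; exact: f0.
  - exact: (measurable_fun_fubini_tonelli_F f).
  - apply: measurable_funeM; apply: emeasurable_funD => //.
    by apply/measurable_EFinP; apply: measurable_funX; apply: measurable_funD.
  - move=> x _; rewrite -EFinD -EFinM mulrC.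
    have mEx : measurable [set w | E (x, w)].
      by rewrite -[X in measurable X]setTI; exact: (pair1_measurable x).
    rewrite (_ : (\int[@unif01 R]_w f (x, w) = \int[@unif01 R]_w (\1_[set w | E (x, w)] w)%:E)%E).
      rewrite integral_indic// setIT.
      (* Given the first variable, the walk restarts from [c + y 0 x] with one summand less. *)
      apply: le_trans (IH (fun k => y k.+1) (fun k => v k.+1) _ _ (c + y 0%N x)) => //.
    by apply: eq_integral => w _; rewrite /f !indicE; congr (_%:R%:E); apply/idP/idP; rewrite !inE.
rewrite ge0_integralZl_EFin ?invr_ge0 ?exprn_ge0// ?(ltW e0)//; last 2 first.
- by move=> x _; rewrite adde_ge0// lee_fin ?sqr_ge0// sumr_ge0.
- apply: emeasurable_funD => //.
  by apply/measurable_EFinP; apply: measurable_funX; apply: measurable_funD.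
rewrite mulrC EFinM lee_wpmul2l// ?lee_fin ?invr_ge0 ?exprn_ge0// ?(ltW e0)//.
rewrite ge0_integralD//; last 3 first.
- by move=> x _; rewrite lee_fin sqr_ge0.
- by apply/measurable_EFinP; apply: measurable_funX; apply: measurable_funD.
- by move=> x _; rewrite lee_fin sumr_ge0.
rewrite integral_cst//= [X in (_ + _ * X)%E]probability_setT mule1.
by rewrite big_ord_recl addrA EFinD leeD2r//; exact: yv.
Qed.

Lemma xi_independent {R : realType} n (A : nat -> set R) :
  (forall k, measurable (A k)) ->
  @unif01 R [set w | forall k, (k < n)%N -> A k (xi k w)] =
  (\prod_(k < n) @unif01 R (A k))%E.
Proof.
elim: n A => [|n IH] A mA.
  rewrite big_ord0 (_ : [set _ | _] = setT) ?unif01_setT//.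
  by apply/seteqP; split.
rewrite big_ord_recl -(IH (fun k => A k.+1))//.
have mB : measurable [set w : R | forall k, (k < n)%N -> A k.+1 (xi k w)].
  rewrite (_ : [set _ | _] = \bigcap_k (if (k < n)%N then xi k @^-1` A k.+1 else setT)).
    apply: bigcapT_measurable => k; case: ifP => // _.
    by rewrite -[X in measurable X]setTI; exact: measurable_xi.
  apply/seteqP; split => w h k.
    by move=> _; case: ifP => // kn; exact: h.
  by move=> kn; have := h k I; rewrite kn.
rewrite -digits_joint//; congr (unif01 _); apply/seteqP; split => w.
  by move=> h; split; [exact: (h 0%N)|move=> k kn; rewrite -xiSr; exact: h].
by move=> [h0 h] [|k]//; rewrite ltnS => kn; rewrite xiSr; exact: h.
Qed.

Lemma geometric_sum_law {R : realType} (K : nat) (q : nat -> R) (phi : nat -> R -> nat) :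
  (forall k m, measurable [set v | phi k v = m]) ->
  (forall k m, @unif01 R [set v | phi k v = m] = (geo (q k) m)%:E) ->
  forall m, measurable [set w | (\sum_(k < K) phi k (xi k w))%N = m] /\
  @unif01 R [set w | (\sum_(k < K) phi k (xi k w))%N = m] = (gconv q K m)%:E.
Proof.
elim: K q phi => [|K IH] q phi mphi Pphi m.
  under eq_set do rewrite big_ord0; rewrite /= /unit_mass.
  case: m => [|m].
    rewrite (_ : [set _ | _] = setT) ?unif01_setT; last by apply/seteqP; split.
    by split => //; exact: measurableT.
  by rewrite (_ : [set _ | _] = set0) ?measure0//; apply/seteqP; split.
pose S w := (\sum_(k < K) phi k.+1 (xi k w))%N.
have {}IH := IH (fun k => q k.+1) (fun k => phi k.+1) (fun k => mphi k.+1) (fun k => Pphi k.+1).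
have mS j : measurable [set w : R | S w = j] by have [] := IH j.
have PS j : @unif01 R [set w | S w = j] = (gconv (fun k => q k.+1) K j)%:E by have [] := IH j.
pose F (a : nat) : set R := digits @^-1` [set v | phi 0%N v = a] `&`
  (fun w => digits (dbl w)) @^-1` [set w | S w = (m - a)%N].
have mF a : measurable (F a).
  apply: measurableI; rewrite -[X in measurable X]setTI.
    exact: measurable_digits.
  exact: measurable_digits_dbl.
have -> : [set w | (\sum_(k < K.+1) phi k (xi k w))%N = m] = \big[setU/set0]_(a < m.+1) F a.
  have E w : (\sum_(k < K.+1) phi k (xi k w) = phi 0 (digits w) + S (tail_digits w))%N.
    rewrite big_ord_recl; congr (_ + _)%N; apply: eq_bigr => k _.
    by rewrite -xiSr.
  rewrite -(bigcup_mkord m.+1 F); apply/seteqP; split => w /=.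
    rewrite E => Sw; exists (phi 0%N (digits w)); first by rewrite /= ltnS -Sw leq_addr.
    split => //; change (S (tail_digits w) = (m - phi 0 (digits w))%N).
    by rewrite -Sw addKn.
  move=> [a /= am [ha Sw]]; rewrite E.
  rewrite (ha : phi 0%N (digits w) = a) (Sw : S (tail_digits w) = (m - a)%N).
  exact: subnKC.
split; first by apply: bigsetU_measurable.
rewrite (@measure_bigsetU_ord _ _ _ _ _ xpredT (fun a : 'I_m.+1 => F a))//; last first.
  by move=> a b _ _ [w [[/= ha _] [/= hb _]]]; apply/val_inj => /=; rewrite -ha -hb.
rewrite /= /conv -sumEFin; apply: eq_bigr => a _.
by rewrite EFinM -PS -Pphi -digits_joint.
Qed.

Lemma integrable_bounded {R : realType} d (T : measurableType d)
    (P : probability T R) (X : T -> R) (M : R) :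
  measurable_fun setT X -> (forall w, `|X w| <= M) ->
  P.-integrable setT (EFin \o X).
Proof.
move=> mX XM; apply: measurable_bounded_integrable => //.
  by rewrite [ltLHS]probability_setT ltry.
exists M; split; first exact: num_real.
by move=> N MN w _ /=; apply: le_trans (XM w) _; exact: ltW.
Qed.

Lemma integral_lin {R : realType} d (T : measurableType d)
    (P : probability T R) (X Y : T -> R) (x y c1 c2 : R) :
  measurable_fun setT X -> measurable_fun setT Y ->
  (forall w, `|X w| <= 1) -> (forall w, `|Y w| <= 1) ->
  (\int[P]_w (1 + X w)%:E = (1 + x)%:E)%E ->
  (\int[P]_w (1 + Y w)%:E = (1 + y)%:E)%E ->
  (\int[P]_w (1 + (c1 * X w + c2 * Y w))%:E = (1 + (c1 * x + c2 * y))%:E)%E.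
Proof.
move=> mX mY X1 Y1 HX HY.
have iX := integrable_bounded P mX X1; have iY := integrable_bounded P mY Y1.
have i1 : P.-integrable setT (EFin \o (fun=> 1 : R)).
  by apply: (@integrable_bounded _ _ _ _ _ 1) => // w; rewrite normr1.
have E1 : (\int[P]_w (1 : R)%:E = 1%:E)%E.
  by rewrite integral_cst//= [X in (_ * X)%E]probability_setT mule1.
have ext (Z : T -> R) z : P.-integrable setT (EFin \o Z) ->
    (\int[P]_w (1 + Z w)%:E = (1 + z)%:E)%E -> (\int[P]_w (Z w)%:E = z%:E)%E.
  move=> iZ; rewrite (integralD_EFin measurableT i1 iZ) E1 => /eqP.
  have : (\int[P]_w (Z w)%:E)%E \is a fin_num by exact: integrable_fin_num.
  move=> /fineK <-; rewrite -EFinD => /eqP[/addrI ->]; by [].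
have {}HX := ext _ _ iX HX; have {}HY := ext _ _ iY HY.
have iX' : P.-integrable setT (EFin \o (fun w => c1 * X w)).
  by rewrite (_ : _ \o _ = (fun w => c1%:E * (EFin \o X) w)%E)//; exact: integrableZl.
have iY' : P.-integrable setT (EFin \o (fun w => c2 * Y w)).
  by rewrite (_ : _ \o _ = (fun w => c2%:E * (EFin \o Y) w)%E)//; exact: integrableZl.
have iXY : P.-integrable setT (EFin \o (fun w => c1 * X w + c2 * Y w)).
  rewrite (_ : _ \o _ = ((EFin \o (fun w => c1 * X w)%R) \+ (EFin \o (fun w => c2 * Y w)%R))%E)//.
  exact: integrableD.
rewrite (integralD_EFin measurableT i1 iXY) (integralD_EFin measurableT iX' iY') E1.
rewrite (_ : (\int[P]_w (c1 * X w)%:E = c1%:E * x%:E)%E); last first.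
  by rewrite -HX -integralZl//.
rewrite (_ : (\int[P]_w (c2 * Y w)%:E = c2%:E * y%:E)%E); last first.
  by rewrite -HY -integralZl//.
by rewrite -!EFinM -!EFinD.
Qed.

Lemma normr_cos_le1 {R : realType} (x : R) : `|cos x| <= 1.
Proof. by rewrite ler_norml cos_geN1 cos_le1. Qed.

Lemma normr_sin_le1 {R : realType} (x : R) : `|sin x| <= 1.
Proof. by rewrite ler_norml sin_geN1 sin_le1. Qed.

Lemma measurable_cos_comp {R : realType} d (T : measurableType d) (X : T -> R) :
  measurable_fun setT X -> measurable_fun setT (fun w => cos (X w)).
Proof.
move=> mX; apply: measurableT_comp mX; apply: continuous_measurable_fun.
exact: continuous_cos.
Qed.

Lemma measurable_sin_comp {R : realType} d (T : measurableType d) (X : T -> R) :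
  measurable_fun setT X -> measurable_fun setT (fun w => sin (X w)).
Proof.
move=> mX; apply: measurableT_comp mX; apply: continuous_measurable_fun.
exact: continuous_sin.
Qed.

(* Adding 1 makes the integrands nonnegative, so that Tonelli applies without
   integrability conditions. *)
Lemma xsum_char {R : realType} (y : nat -> R -> R) (a b : nat -> R) :
  (forall k, measurable_fun setT (y k)) ->
  (forall k, \int[@unif01 R]_v (1 + cos (y k v))%:E = (1 + a k)%:E)%E ->
  (forall k, \int[@unif01 R]_v (1 + sin (y k v))%:E = (1 + b k)%:E)%E ->
  forall m, let z := \prod_(k < m) ((a k +i* b k)%C : R[i]) in
  (\int[@unif01 R]_w (1 + cos (xsum y m w))%:E = (1 + complex.Re z)%:E)%E /\
  (\int[@unif01 R]_w (1 + sin (xsum y m w))%:E = (1 + complex.Im z)%:E)%E.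
Proof.
move=> my ya yb m; elim: m y a b my ya yb => [|m IH] y a b my ya yb.
  rewrite /= big_ord0 /xsum; split.
    under eq_integral do rewrite big_ord0 cos0.
    by rewrite integral_cst//= [X in (_ * X)%E]probability_setT mule1.
  under eq_integral do rewrite big_ord0 sin0.
  by rewrite integral_cst//= [X in (_ * X)%E]probability_setT mule1.
have [] := IH (fun k => y k.+1) (fun k => a k.+1) (fun k => b k.+1) (fun k => my k.+1)
  (fun k => ya k.+1) (fun k => yb k.+1).
rewrite /= big_ord_recl /=; case: (\prod_(k < m) _) => p q /= Hp Hq.
set S := xsum (fun k => y k.+1) m in Hp Hq.
have mS : measurable_fun setT S by exact: measurable_xsum.
have mcS := measurable_cos_comp mS; have msS := measurable_sin_comp mS.
have cS w := normr_cos_le1 (S w); have sS w := normr_sin_le1 (S w).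
have mcy := measurable_cos_comp (my 0%N); have msy := measurable_sin_comp (my 0%N).
have cy v := normr_cos_le1 (y 0%N v); have sy v := normr_sin_le1 (y 0%N v).
have mp : measurable_fun setT (fun z : R * R => y 0%N z.1 + S z.2).
  by apply: measurable_funD; apply: measurableT_comp.
split.
  pose f (z : R * R) := (1 + cos (y 0%N z.1 + S z.2))%:E.
  transitivity (\int[@unif01 R]_w f (digits w, tail_digits w))%E.
    by apply: eq_integral => w _; rewrite xsumS.
  rewrite integral_digits; last 2 first.
  - apply/measurable_EFinP; apply: measurable_funD => //; exact: measurable_cos_comp.
  - by move=> z; rewrite lee_fin; have := cos_geN1 (y 0%N z.1 + S z.2); lra.
  (* With the tail integrated out, the addition formula yields the real part of the product of
     [p +i* q] with the factor of the first summand. *)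
  transitivity (\int[@unif01 R]_v (1 + (p * cos (y 0%N v) + (- q) * sin (y 0%N v)))%:E)%E.
    apply: eq_integral => v _; rewrite /f/=.
    under eq_integral do rewrite cosD -mulNr.
    by rewrite (integral_lin _ _ mcS msS cS sS Hp Hq); congr (_%:E); ring.
  rewrite (integral_lin _ _ mcy msy cy sy (ya 0%N) (yb 0%N)); congr (_%:E); ring.
pose f (z : R * R) := (1 + sin (y 0%N z.1 + S z.2))%:E.
transitivity (\int[@unif01 R]_w f (digits w, tail_digits w))%E.
  by apply: eq_integral => w _; rewrite xsumS.
rewrite integral_digits; last 2 first.
- apply/measurable_EFinP; apply: measurable_funD => //; exact: measurable_sin_comp.
- by move=> z; rewrite lee_fin; have := sin_geN1 (y 0%N z.1 + S z.2); lra.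
transitivity (\int[@unif01 R]_v (1 + (q * cos (y 0%N v) + p * sin (y 0%N v)))%:E)%E.
  apply: eq_integral => v _; rewrite /f/=.
  under eq_integral do rewrite sinD.
  by rewrite (integral_lin _ _ mcS msS cS sS Hp Hq); congr (_%:E); ring.
rewrite (integral_lin _ _ mcy msy cy sy (ya 0%N) (yb 0%N)); congr (_%:E); ring.
Qed.

(** * Almost sure and mean-square convergence of centred series *)

Section random_series.
Context {R : realType}.
Variables (y : nat -> R -> R) (v : nat -> R) (s : R).
Hypothesis my : forall k, measurable_fun setT (y k).
Hypothesis yv : forall k c,
  (\int[@unif01 R]_x ((c + y k x) ^+ 2)%:E <= (c ^+ 2 + v k)%:E)%E.
Hypothesis vs : series v @ \oo --> s.
Notation U := (@unif01 R).

Let v0 k : 0 <= v k.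
Proof.
have := yv k 0; rewrite expr0n add0r -lee_fin; apply: le_trans.
by apply: integral_ge0 => x _; rewrite lee_fin sqr_ge0.
Qed.

Let V N := s - series v N.

Let V0 : V @ \oo --> (0 : R).
Proof. by rewrite -(subrr s); apply: cvgB; [exact: cvg_cst|exact: vs]. Qed.

(** Cancelling the summands before [N] keeps the indexing of [xi], so that the moment and maximal
    inequalities apply to tails as they stand. *)
Let y' N k : R -> R := if (k < N)%N then (fun=> 0) else y k.

Let my' N k : measurable_fun setT (y' N k).
Proof. by rewrite /y'; case: ifP. Qed.

Let v' N k : R := if (k < N)%N then 0 else v k.

Let yv' N k c : (\int[U]_x ((c + y' N k x) ^+ 2)%:E <= (c ^+ 2 + v' N k)%:E)%E.
Proof.
rewrite /y' /v'; case: ifP => _; last exact: yv.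
by rewrite !addr0 integral_cst//= [X in (_ * X)%E]probability_setT mule1.
Qed.

Let sum_v' N m : \sum_(k < m) v' N k <= V N.
Proof.
rewrite /V lerBrDr; have [mN|Nm] := leqP m N.
  rewrite big1 ?add0r; first exact: series_le_lim.
  by move=> k _; rewrite /v' (leq_trans (ltn_ord k) mN).
apply: (le_trans _ (series_le_lim m v0 vs)).
rewrite /series/= [leRHS](@big_cat_nat _ _ _ N)//= ?(ltnW Nm)// [leLHS]addrC lerD2l.
rewrite -(big_mkord xpredT (v' N)) (@big_cat_nat _ _ _ N)//= ?(ltnW Nm)//.
rewrite big_nat_cond big1 ?add0r; last by move=> k /andP[/andP[_ kN] _]; rewrite /v' kN.
apply: ler_sum_nat => k /andP[Nk _]; by rewrite /v' ltnNge Nk.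
Qed.

Let xsumE (z : nat -> R -> R) m w : xsum z m w = \sum_(0 <= k < m) z k (xi k w).
Proof. by rewrite big_mkord. Qed.

Let xsum_y' N m w : (N <= m)%N -> xsum (y' N) m w = xsum y m w - xsum y N w.
Proof.
move=> Nm; rewrite !xsumE.
rewrite (@big_cat_nat _ _ _ N)//= [in RHS](@big_cat_nat _ _ _ N)//= addrAC subrr add0r.
rewrite big_nat_cond big1 ?add0r; last by move=> k /andP[/andP[_ kN] _]; rewrite /y' kN.
by apply: eq_big_nat => k /andP[Nk _]; rewrite /y' ltnNge Nk.
Qed.

Lemma xsum_tail_second_moment N m : (N <= m)%N ->
  (\int[U]_w ((xsum y m w - xsum y N w) ^+ 2)%:E <= (V N)%:E)%E.
Proof.
move=> Nm; under eq_integral do rewrite -(xsum_y' _ Nm) -[xsum _ _ _]add0r.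
apply: le_trans (xsum_second_moment (my' N) (yv' N) m 0) _.
by rewrite expr0n add0r lee_fin sum_v'.
Qed.

Let B N (j : nat) : set R := \bigcup_m
  [set w | exists2 i, (i <= m)%N & j.+1%:R^-1 <= `|xsum (y' N) i w|].

Let mB1 N (j : nat) m : measurable
  [set w | exists2 i, (i <= m)%N & j.+1%:R^-1 <= `|xsum (y' N) i w|].
Proof.
rewrite (_ : [set _ | _] = \bigcup_(i in [set i | (i <= m)%N])
  ((fun w => `|xsum (y' N) i w|) @^-1` `[j.+1%:R^-1, +oo[%classic)); last first.
  by apply/seteqP; split => w [i im h]; exists i => //; move: h; rewrite /= in_itv/= andbT.
apply: bigcup_measurable => i _; rewrite -[X in measurable X]setTI.
by apply: measurableT_comp => //; exact: measurable_xsum.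
Qed.

(** Kolmogorov's inequality on each finite horizon, then continuity from below in the horizon. *)
Let PB N j : (U (B N j) <= (V N * j.+1%:R ^+ 2)%:E)%E.
Proof.
have mBU : measurable (B N j) by exact: bigcupT_measurable.
have := @nondecreasing_cvg_mu _ _ _ U (fun m => [set w | exists2 i, (i <= m)%N &
  j.+1%:R^-1 <= `|xsum (y' N) i w|]) (mB1 N j) mBU.
move=> /(_ _)/cvg_lim <-//; last first.
  move=> a b ab; apply/subsetPset => w [i ia h]; exists i => //.
  exact: leq_trans ia ab.
apply: lime_le.
  apply: ereal_nondecreasing_is_cvgn => a b ab; apply: le_measure; rewrite ?inE//.
  by move=> w [i ia h]; exists i => //; exact: leq_trans ia ab.
near=> m; have j0 : 0 < j.+1%:R^-1 :> R by rewrite invr_gt0.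
have := xsum_maximal j0 (my' N) (yv' N) m 0.
rewrite [X in (U X <= _)%E -> _](_ : _ =
    [set w | exists2 i, (i <= m)%N & j.+1%:R^-1 <= `|xsum (y' N) i w|]); last first.
  by apply/seteqP; split => w [i im]; rewrite ?add0r => h; exists i => //; rewrite add0r.
move=> /le_trans; apply; rewrite expr0n add0r lee_fin exprVn invrK ler_wpM2r// sum_v'//.
Unshelve. all: by end_near. Qed.

(** Failure of the Cauchy criterion: for some [j], the tails from every [N] reach size 1 / (j +
    1). *)
Let bad : set R := \bigcup_j \bigcap_N B N j.

Let bad0 : U.-negligible bad.
Proof.
apply: negligible_bigcup => j; exists (\bigcap_N B N j); split => //.
  by apply: bigcapT_measurable => N; exact: bigcupT_measurable.
have mI : measurable (\bigcap_N B N j).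
  by apply: bigcapT_measurable => N; exact: bigcupT_measurable.
apply/eqP; rewrite eq_le measure_ge0 andbT.
have c : (fun N => (V N * j.+1%:R ^+ 2)%:E) @ \oo --> (0 : R)%:E.
  apply: cvg_EFinT; rewrite -[X in _ --> X](mul0r (j.+1%:R ^+ 2)).
  by apply: cvgM; [exact: V0|exact: cvg_cst].
apply: (@le_trans _ _ (limn (fun N => (V N * j.+1%:R ^+ 2)%:E))); last by rewrite (cvg_lim _ c).
apply: lime_ge; first by apply/cvg_ex; exists 0%:E.
near=> N; apply: le_trans (PB N j); apply: le_measure; rewrite ?inE//.
  exact: bigcupT_measurable.
by move=> w; apply.
Unshelve. all: by end_near. Qed.

Let good_cvg w : ~ bad w -> cvgn (xsum y ^~ w).
Proof.
move=> nb; apply/cauchy_cvgP; apply: cauchy_exP => e /= e0.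
have [j je] : exists j : nat, j.+1%:R^-1 < e.
  exists (Num.truncn e^-1); rewrite invf_plt ?posrE//.
  by rewrite truncnS_gt// invr_ge0 ltW.
have [N nN] : exists N, ~ B N j w.
  apply: contrapT => h; apply: nb; exists j => // N _; apply: contrapT => h'.
  by apply: h; exists N.
exists (xsum y N w); exists N => // m /= Nm; rewrite /ball/= distrC -(xsum_y' _ Nm).
apply: lt_trans je; rewrite ltNge; apply/negP => h; apply: nN.
by exists m => //; exists m.
Qed.

Lemma random_series_cvg : {ae U, forall w, cvgn (xsum y ^~ w)}.
Proof. by apply: negligibleS bad0 => w h; apply: contrapT => /good_cvg. Qed.

(* The upper limit makes the definition total and measurable; it is the sum of
   the series almost surely. *)
Definition random_series w : R := fine (limn_esup (fun m => (xsum y m w)%:E)).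

Lemma measurable_random_series : measurable_fun setT random_series.
Proof.
apply: measurableT_comp => //; apply: measurable_fun_limn_esup => m.
by apply/measurable_EFinP; exact: measurable_xsum.
Qed.

Let random_seriesE w l : xsum y ^~ w @ \oo --> l -> random_series w = l.
Proof.
by move=> /cvg_EFinT h; rewrite /random_series (cvg_limn_einf_sup h).2.
Qed.

Lemma random_series_ae :
  {ae U, forall w, xsum y ^~ w @ \oo --> random_series w}.
Proof.
apply: filterS random_series_cvg => w /cvg_ex[l wl].
by rewrite (random_seriesE wl).
Qed.

(** Fatou along the partial sums, which converge almost surely, transfers the bound on finite
    tails. *)
Lemma random_series_tail N :
  (\int[U]_w ((random_series w - xsum y N w) ^+ 2)%:E <= (V N)%:E)%E.
Proof.
pose f m w := ((xsum y (m + N) w - xsum y N w) ^+ 2)%:E.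
have mf m : measurable_fun setT (f m).
  apply/measurable_EFinP; apply: measurable_funX; apply: measurable_funB;
  exact: measurable_xsum.
have f0 m w : (0 <= f m w)%E by rewrite lee_fin sqr_ge0.
rewrite [leLHS](_ : _ = \int[U]_w limn_einf (f ^~ w))%E.
  apply: le_trans (fatou _ _ _ _) _ => //.
  rewrite limn_einf_lim; apply: lime_le; first exact: is_cvg_einfs.
  near=> n; apply: (@le_trans _ _ (\int[U]_w f n w)%E).
    by apply: ereal_inf_lbound; exists n => /=.
  by apply: xsum_tail_second_moment; rewrite leq_addl.
apply: ae_eq_integral => //.
- apply/measurable_EFinP; apply: measurable_funX; apply: measurable_funB.
    exact: measurable_random_series.
  exact: measurable_xsum.
- rewrite (_ : (fun w => _) = fun w => (- limn_esup (fun m => - f m w))%E); last first.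
    by apply/funext => w; rewrite (limn_esupN (f ^~ w)) oppeK.
  apply: measurableT_comp => //; apply: measurable_fun_limn_esup => m.
  exact: measurableT_comp.
apply: filterS random_series_ae => w cw _; apply/esym.
have h : (fun m => (xsum y (m + N) w - xsum y N w) ^+ 2) @ \oo -->
    (random_series w - xsum y N w) ^+ 2.
  rewrite expr2; have h1 : (fun m => xsum y (m + N) w - xsum y N w) @ \oo -->
      random_series w - xsum y N w.
    by apply: cvgB; [exact: cvg_comp (cvg_addnr N) cw|exact: cvg_cst].
  under eq_cvg do rewrite expr2.
  exact: cvgM.
exact: (cvg_limn_einf_sup (cvg_EFinT h)).1.
Unshelve. all: by end_near. Qed.

End random_series.

(** * Spectral estimates *)

Section centering.
Context {R : realType} d (T : measurableType d) (P : probability T R).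
Variables (W : T -> R) (m v : R).
Hypotheses (mW : measurable_fun setT W) (W0 : forall w, 0 <= W w).
Hypothesis W1 : (\int[P]_w (W w)%:E = m%:E)%E.
Hypothesis W2 : (\int[P]_w ((W w) ^+ 2)%:E <= v%:E)%E.

(** The exact value is c^2 + E[W^2] - m^2; the square of the mean is dropped. *)
Lemma centered_second_moment c :
  (\int[P]_w ((c + (W w - m)) ^+ 2)%:E <= (c ^+ 2 + v)%:E)%E.
Proof.
have iW : P.-integrable setT (EFin \o W).
  apply/integrableP; split; first exact/measurable_EFinP.
  under eq_integral do rewrite /= ger0_norm//.
  by rewrite W1 ltry.
have iW2 : P.-integrable setT (fun w => (W w ^+ 2)%:E).
  apply/integrableP; split; first exact/measurable_EFinP/measurable_funX.
  under eq_integral do rewrite /= ger0_norm ?sqr_ge0//.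
  exact: le_lt_trans W2 (ltry _).
have E w : ((c + (W w - m)) ^+ 2)%:E =
    (((2 * (c - m))%:E * (W w)%:E + (W w ^+ 2)%:E) + ((c - m) ^+ 2)%:E)%E.
  by rewrite -EFinM -!EFinD; congr EFin; ring.
under eq_integral do rewrite E.
have iZ : P.-integrable setT (fun w => ((2 * (c - m))%:E * (W w)%:E)%E).
  exact: integrableZl.
have iC : P.-integrable setT (cst ((c - m) ^+ 2)%:E).
  exact: finite_measure_integrable_cst.
rewrite integralD//=; last exact: integrableD.
rewrite integralD//= integralZl//= W1.
rewrite integral_cst//= [X in (_ + _ * X)%E]probability_setT mule1.
rewrite -EFinM -addeA addeC -addeA -EFinD.
apply: (@le_trans _ _ (v%:E + ((c - m) ^+ 2 + 2 * (c - m) * m)%:E)%E).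
  by rewrite leeD2r.
rewrite -EFinD lee_fin.
have : 0 <= m ^+ 2 by exact: sqr_ge0.
nra.
Qed.

Lemma centered_second_momentN c :
  (\int[P]_w ((c + (m - W w)) ^+ 2)%:E <= (c ^+ 2 + v)%:E)%E.
Proof.
rewrite -sqrrN; under eq_integral do rewrite -sqrrN opprD opprB.
exact: centered_second_moment.
Qed.

End centering.

Section spectral_series.
Context {R : realType}.

(* Telescoping: p (x + 1)^-(1 + p) <= x^-p - (x + 1)^-p. *)
Lemma pseries_partial (p : R) n : 0 < p ->
  series (fun k => k.+1%:R `^ (- (1 + p))) n.+1 <= 1 + p^-1 * (1 - n.+1%:R `^ (- p)).
Proof.
move=> p0; elim: n => [|n IH].
  by rewrite /series/= big_nat1 !powR1 subrr mulr0 addr0.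
rewrite seriesSr; apply: le_trans (lerD IH (lexx _)) _.
have x0 : 0 < n.+1%:R :> R by [].
rewrite -[n.+2]addn1 natrD; move: (n.+1%:R) x0 => x x0.
have y0 : 0 < x + 1 by rewrite addr_gt0.
have y1 : 0 < (x + 1)^-1 by rewrite invr_gt0.
rewrite opprD powRD ?(gt_eqF y0) ?implybT// powR_inv1 ?(ltW y0)//.
have -> : x `^ (- p) = expR (- p * ln x) by rewrite /powR gt_eqF.
have -> : (x + 1) `^ (- p) = expR (- p * ln (x + 1)) by rewrite /powR gt_eqF.
have lnx : ln x <= ln (x + 1) - (x + 1)^-1.
  have := @le_ln1Dx _ (- (x + 1)^-1); rewrite ltrN2 invf_lt1// ltrDr x0 => /(_ isT).
  have -> : 1 - (x + 1)^-1 = x / (x + 1) by field; rewrite gt_eqF.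
  by rewrite lnM ?posrE// lnV ?posrE// => h; lra.
have : expR (- p * ln (x + 1)) * (1 + p * (x + 1)^-1) <= expR (- p * ln x).
  apply: (@le_trans _ _ (expR (- p * ln (x + 1)) * expR (p * (x + 1)^-1))).
    by rewrite ler_wpM2l ?expR_ge0// expR_ge1Dx.
  by rewrite -expRD ler_expR; nra.
have pp : p * p^-1 = 1 by rewrite divff// gt_eqF.
have p1 : 0 < p^-1 by rewrite invr_gt0.
move: (expR _) (expR (- p * ln x)) (p^-1) ((x + 1)^-1) pp p1 => E F q z pp q0 h.
have := ler_wpM2l (ltW q0) h; rewrite mulrDr mulr1 mulrDr [q * (E * _)](_ : _ = E * z * (p * q)); last ring.
rewrite pp mulr1; lra.
Qed.

Lemma cvg_pseries (p : R) : 0 < p -> cvgn (series (fun k => k.+1%:R `^ (- (1 + p)))).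
Proof.
move=> p0; apply: nondecreasing_is_cvgn.
  by apply: nondecreasing_series => k _ _; exact: powR_ge0.
exists (1 + p^-1) => _ [[|n] _ <-].
  by rewrite /series/= big_geq// addr_ge0// invr_ge0 ltW.
apply: le_trans (pseries_partial n p0) _; rewrite lerD2l ger_pMr ?invr_gt0//.
Qed.

Variable lam : nat -> R.
Hypotheses (lam0 : 0 < lam 0%N) (lamS : forall k, lam k <= lam k.+1).
Hypothesis expansion : heat_trace_expansion lam.

Lemma lam_ge0th k : lam 0%N <= lam k.
Proof. by elim: k => // k IH; apply: le_trans IH (lamS k). Qed.

Lemma lam_gt0 k : 0 < lam k.
Proof. exact: lt_le_trans lam0 (lam_ge0th k). Qed.

Lemma lam_homo : {homo lam : j k / (j <= k)%N >-> j <= k}.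
Proof. by apply: homo_leq => // x y z; apply: le_trans. Qed.

Lemma heat_trace_ge0 t : (0 <= heat_trace lam t)%E.
Proof. by apply: nneseries_ge0 => k _ _; rewrite lee_fin expR_ge0. Qed.

Lemma heat_trace_anti s t : s <= t -> (heat_trace lam t <= heat_trace lam s)%E.
Proof.
move=> st; apply: lee_nneseries => k _; first by rewrite lee_fin expR_ge0.
by rewrite lee_fin ler_expR !mulNr lerN2 ler_wpM2l// ltW// lam_gt0.
Qed.

(** Below time 1 the other powers in the expansion and the constant are at most t^(-3/2). Halving
    the threshold keeps the closed range of times inside the neighbourhood where the expansion
    holds. *)
Lemma heat_trace_small_time : exists C s : R, [/\ 0 <= C, 0 < s &
  forall t, 0 < t <= s -> (heat_trace lam t <= (C * t `^ (- (3 / 2)))%:E)%E].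
Proof.
have [a1 [a2 [M]]] := expansion; rewrite near_withinE => -[/= d d0 H].
exists (`|(4 * pi) `^ (- (3 / 2))| + `|a1| + `|a2| + `|M|), (Num.min 1 d / 2).
have m0 : 0 < Num.min 1 d by rewrite lt_min ltr01.
split; [by rewrite !addr_ge0|by rewrite divr_gt0|move=> t /andP[t0 ts]].
have td : t < Num.min 1 d by apply: le_lt_trans ts _; rewrite ltr_pdivrMr// ltr_pMr// ltr1n.
have /andP[t1 td'] : (t < 1) && (t < d) by rewrite -lt_min.
have {H} := H t; rewrite /ball/= sub0r normrN gtr0_norm// => /(_ td' t0).
have := heat_trace_ge0 t; case: (heat_trace lam t) => [z||]// _.
rewrite -EFinB abse_EFin !lee_fin => h.
have tp : 0 < t `^ (- (3 / 2)) by exact: powR_gt0.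
have e1 : t^-1 <= t `^ (- (3 / 2)).
  rewrite -[in t^-1](powRr1 (ltW t0)) powRN lef_pV2 ?posrE ?powR_gt0//.
  by apply: ger_powR; [rewrite t0 ltW|lra].
have e2 : t `^ (- (1 / 2)) <= t `^ (- (3 / 2)).
  rewrite !powRN lef_pV2 ?posrE ?powR_gt0//.
  by apply: ger_powR; [rewrite t0 ltW|lra].
have e3 : 1 <= t `^ (- (3 / 2)).
  by rewrite powRN invf_ge1 ?powR_gt0// -[leRHS](powRr0 t); apply: ger_powR; [rewrite t0 ltW|lra].
have i0 : 0 <= t^-1 by rewrite invr_ge0 ltW.
have p0 : 0 <= t `^ (- (1 / 2)) by exact: powR_ge0.
move: h; rewrite ler_norml => /andP[_ h].
move: (t `^ _) (t^-1) (t `^ (- (1 / 2))) tp e1 e2 e3 i0 p0 h => x y w x0 yx wx x1 y0 w0 h.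
have b1 : a1 * y <= `|a1| * x.
  by apply: (@le_trans _ _ (`|a1| * y)); [rewrite ler_wpM2r// ler_norm|rewrite ler_wpM2l].
have b2 : a2 * w <= `|a2| * x.
  by apply: (@le_trans _ _ (`|a2| * w)); [rewrite ler_wpM2r// ler_norm|rewrite ler_wpM2l].
have b3 : M <= `|M| * x.
  by apply: (@le_trans _ _ `|M|); [rewrite ler_norm|rewrite ler_peMr].
have b4 : (4 * pi) `^ (- (3 / 2)) * x <= `|(4 * pi) `^ (- (3 / 2))| * x.
  by rewrite ler_wpM2r ?ler_norm// ltW.
move: b4 b1 b2 b3 h; rewrite !mulrDl; move: (_ `^ _ * x) (`|_ `^ _| * x) (a1 * y) (a2 * w).
by move: (`|a1| * x) (`|a2| * x) (`|M| * x) => *; lra.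
Qed.

Lemma heat_trace_lty t : 0 < t -> (heat_trace lam t < +oo)%E.
Proof.
have [C [s [C0 s0 H]]] := heat_trace_small_time => t0.
have [ts|/ltW st] := leP t s.
  by apply: le_lt_trans (H t _) (ltry _); rewrite t0.
apply: le_lt_trans (heat_trace_anti st) _.
by apply: le_lt_trans (H s _) (ltry _); rewrite s0/=.
Qed.

Lemma cvg_heat_trace t : 0 < t ->
  series (fun k => expR (- lam k * t)) @ \oo --> fine (heat_trace lam t).
Proof.
by move=> t0; apply: nneseries_cvg => [k|]; [exact: expR_ge0|exact: heat_trace_lty].
Qed.

(* (k + 1) exp(- lam_k t) <= Z(t) = O(t^(-3/2)), at t proportional to 1 / lam_k. *)
Lemma eigenvalue_growth : exists2 c : R, 0 < c &
  forall k, c * k.+1%:R `^ (4 / 3) <= lam k ^+ 2.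
Proof.
have [C [s [C0 s0 H]]] := heat_trace_small_time.
pose b := C * (s * lam 0%N) `^ (- (3 / 2)) * expR (s * lam 0%N).
have bk k : k.+1%:R <= b * lam k `^ (3 / 2).
  have lk := lam_gt0 k.
  (* At this time, at most [s], each of the first k + 1 eigenvalues contributes at least exp(- s
     lam_0) to the trace, being at most lam_k. *)
  have t0 : 0 < s * lam 0%N / lam k by rewrite divr_gt0// mulr_gt0.
  have ts : s * lam 0%N / lam k <= s.
    by rewrite ler_pdivrMr// ler_pM2l// lam_ge0th.
  have := H (s * lam 0%N / lam k); rewrite t0 ts => /(_ isT) h.
  have : ((k.+1%:R * expR (- (s * lam 0%N)))%:E <=
         (C * (s * lam 0%N / lam k) `^ (- (3 / 2)))%:E)%E.
    apply: le_trans h.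
    apply: le_trans (nneseries_lim_ge k.+1 _); last by move=> i _ _; rewrite lee_fin expR_ge0.
    rewrite sumEFin lee_fin big_mkord.
    apply: (@le_trans _ _ (\sum_(i < k.+1) expR (- (s * lam 0%N)))).
      by rewrite sumr_const card_ord -[leRHS]mulr_natl.
    apply: ler_sum => i _; rewrite ler_expR mulNr lerN2.
    rewrite mulrA ler_pdivrMr// mulrC ler_wpM2l ?mulr_ge0 ?(ltW s0) ?(ltW lam0)//.
    by apply: lam_homo; rewrite -ltnS.
  rewrite lee_fin powRM ?invr_ge0 ?(ltW lk)// ?mulr_ge0 ?(ltW s0) ?(ltW lam0)//.
  rewrite -[(lam k)^-1]powR_inv1 ?(ltW lk)// -powRrM mulN1r opprK expRN.
  by rewrite ler_pdivrMr ?expR_gt0// /b mulrA => h'; rewrite [leRHS]mulrAC.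
have b0 : 0 < b.
  have := bk 0%N; rewrite -(pmulr_lgt0 _ (powR_gt0 (3 / 2) lam0)).
  exact: lt_le_trans.
exists ((b `^ (4 / 3))^-1) => [|k]; first by rewrite invr_gt0 powR_gt0.
rewrite ler_pdivrMl ?powR_gt0// -powR_mulrn ?(ltW (lam_gt0 k))//.
(* Raising k + 1 <= b lam_k^(3/2) to the power 4/3 makes lam_k^2 appear; 4/3 exceeds 1, as
   summability of lam_k^-2 requires. *)
have -> : 2%:R = (3 / 2) * (4 / 3) :> R by field.
rewrite [lam k `^ _]powRrM -powRM ?powR_ge0 ?(ltW b0)//.
by apply: ge0_ler_powR; rewrite ?nnegrE ?mulr_ge0 ?powR_ge0 ?(ltW b0).
Qed.

Lemma cvg_sum_lam_sqr : cvgn (series (fun k => (lam k ^+ 2)^-1)).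
Proof.
have [c c0 H] := eigenvalue_growth.
apply: (@series_le_cvg _ _ (fun k => c^-1 * k.+1%:R `^ (- (1 + 1 / 3)))).
- by move=> k; rewrite invr_ge0 sqr_ge0.
- by move=> k; rewrite mulr_ge0 ?powR_ge0// invr_ge0 ltW.
- move=> k; have -> : (1 + 1 / 3 : R) = 4 / 3 by field.
  by rewrite powRN -invfM lef_pV2 ?posrE ?exprn_gt0 ?lam_gt0// mulr_gt0// powR_gt0.
by apply: is_cvg_seriesZ; apply: cvg_pseries; lra.
Qed.

(** For u >= 1, Z(u) <= exp(- lam_0 (u - 1)) Z(1), since every eigenvalue is at least lam_0 > 0. *)
Lemma heat_trace_decay (u : nat -> R) : u @ \oo --> +oo ->
  (fun n => fine (heat_trace lam (u n))) @ \oo --> (0 : R).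
Proof.
move=> uoo; have /cvgryPgt ugt := uoo; have /cvgryPge uge := uoo.
pose g n := expR (- lam 0%N * (u n - 1)) * fine (heat_trace lam 1).
have gz : g @ \oo --> (0 : R).
  rewrite -(mul0r (fine (heat_trace lam 1))); apply: cvgMl.
  apply/(cvgrPdist_lt) => e e0; near=> n.
  rewrite sub0r normrN ger0_norm ?expR_ge0//.
  rewrite -[ltRHS](lnK e0) ltr_expR mulNr ltrNl.
  rewrite -ltr_pdivrMl// ltrBrDr; near: n; exact: ugt.
apply: (squeeze_cvgr _ (cvg_cst 0) gz); near=> n.
have u1 : 1 <= u n by near: n; exact: uge.
have fz t : 0 <= fine (heat_trace lam t) by rewrite fine_ge0// heat_trace_ge0.
rewrite fz/=; have un : 0 < u n by exact: lt_le_trans u1.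
have h := @cvg_seriesZ R (expR (- lam 0%N * (u n - 1))) _ _ (cvg_heat_trace ltr01).
apply: (cvg_series_le _ (cvg_heat_trace un) h) => k.
rewrite -expRD ler_expR mulr1; have := lam_ge0th k; nra.
Unshelve. all: by end_near. Qed.

End spectral_series.

(** * Coupling of geometric and exponential variables *)

Lemma series_lt_nat {R : realType} (x n : nat) :
  series (fun m => (m < x)%N%:R : R) n = (minn n x)%:R.
Proof.
elim: n => [|n IH]; first by rewrite /series/= big_geq// min0n.
rewrite seriesSr IH -natrD; congr _%:R; rewrite addnC; case: (ltnP n x) => [nx|xn].
  by rewrite (minn_idPl nx).
by rewrite (minn_idPr (leqW xn)).
Qed.

Lemma integral_nat_tail {R : realType} d (T : measurableType d) (P : probability T R)
    (X : T -> nat) : (forall m, measurable [set w | (m < X w)%N]) ->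
  (\int[P]_w ((X w)%:R)%:E = \sum_(0 <= m <oo) P [set w | (m < X w)%N])%E.
Proof.
move=> mX.
have E w : (((X w)%:R)%:E = \sum_(0 <= m <oo) (\1_[set w | (m < X w)%N] w)%:E :> \bar R)%E.
  apply/esym/cvg_nneseries; rewrite (_ : (fun m => _) = (fun m => (m < X w)%N%:R)); last first.
    by apply/funext => m; rewrite indicE; congr (nat_of_bool _)%:R; apply/idP/idP; rewrite inE.
  apply: cvg_near_cst; near=> n; rewrite series_lt_nat; congr _%:R; apply/minn_idPr.
  by near: n; exists (X w).
under eq_integral do rewrite E.
rewrite integral_nneseries//.
- by apply: eq_eseriesr => m _; rewrite integral_indic// setIT.
- by move=> m; apply/measurable_EFinP; exact: measurable_indic.
Unshelve. all: by end_near. Qed.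

Section floor_of_exponential.
Context {R : realType}.
Variables (r h : R).
Hypotheses (r0 : 0 < r) (h0 : 0 < h).
Notation U := (@unif01 R).
Let q : R := expR (- r * h).

Definition gfloor v : nat := Num.truncn (gexp r v / h).

Definition grem v : R := gexp r v - h * (gfloor v)%:R.

Lemma leq_gfloor m v : (m <= gfloor v)%N = (h * m%:R <= gexp r v).
Proof.
rewrite truncn_ge_nat; last by rewrite divr_ge0 ?(ltW h0)// gexp_ge0.
by rewrite (ler_pdivlMr _ _ h0) mulrC.
Qed.

Lemma measurable_gfloor_ge m : measurable [set v | (m <= gfloor v)%N].
Proof.
rewrite (_ : [set v | _] = gexp r @^-1` `[h * m%:R, +oo[%classic); last first.
  by apply/seteqP; split => v /=; rewrite in_itv/= andbT leq_gfloor.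
by rewrite -[X in measurable X]setTI; exact: measurable_gexp.
Qed.

(** The floor is at least [m] exactly when the exponential variable is at least [h * m], and
    exponential tails at multiples of [h] are geometric. *)
Lemma gfloor_tail m : U [set v | (m <= gfloor v)%N] = (q ^+ m)%:E.
Proof.
under eq_set do rewrite leq_gfloor.
rewrite gexp_tail ?mulr_ge0 ?(ltW h0)//.
by rewrite mulrA -expRM_natr.
Qed.

Let gfloor_eq m : [set v | gfloor v = m] =
  [set v | (m <= gfloor v)%N] `\` [set v | (m.+1 <= gfloor v)%N].
Proof.
apply/seteqP; split => v /= => [->|[mv /negP]]; first by rewrite ltnn.
by rewrite -leqNgt => vm; apply/eqP; rewrite eqn_leq mv vm.
Qed.

Lemma measurable_gfloor m : measurable [set v | gfloor v = m].
Proof. by rewrite gfloor_eq; apply: measurableD; exact: measurable_gfloor_ge. Qed.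

Lemma gfloor_law m : U [set v | gfloor v = m] = (geo q m)%:E.
Proof.
rewrite gfloor_eq measureD//=; try exact: measurable_gfloor_ge; last first.
  by rewrite gfloor_tail ltry.
rewrite setIidr; last by move=> v /=; exact: ltnW.
rewrite [X in (X - _)%E]gfloor_tail [X in (_ - X)%E]gfloor_tail -EFinB.
by congr EFin; rewrite /geo exprS mulrBl mul1r.
Qed.

Lemma expR_step_lt1 : 0 <= q < 1.
Proof. by rewrite expR_ge0 -expR0 ltr_expR mulNr oppr_lt0 mulr_gt0. Qed.

Lemma gfloor_mean : (\int[U]_v ((gfloor v)%:R)%:E = (q / (1 - q))%:E)%E.
Proof.
rewrite (integral_nat_tail U) => [|m]; last exact: (measurable_gfloor_ge m.+1).
transitivity (\sum_(0 <= m <oo) (q ^+ m.+1)%:E)%E.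
  by apply: eq_eseriesr => m _; exact: (gfloor_tail m.+1).
apply: cvg_nneseries; have /andP[q0 q1] := expR_step_lt1.
rewrite (_ : (fun m => _) = geometric q q); last by apply/funext => m; rewrite /= exprS.
by apply: cvg_geometric_series; rewrite ger0_norm.
Qed.

Lemma grem_ge0 v : 0 <= grem v.
Proof. by rewrite subr_ge0 -leq_gfloor. Qed.

Lemma grem_le_h v : grem v <= h.
Proof.
rewrite lerBlDr; have := leq_gfloor (gfloor v).+1 v; rewrite ltnn => /esym/negbT.
by rewrite -ltNge -natr1 mulrDr mulr1 addrC => /ltW.
Qed.

Lemma grem_le_gexp v : grem v <= gexp r v.
Proof. by rewrite gerBl mulr_ge0// ltW. Qed.

Lemma measurable_gfloorR : measurable_fun setT (fun v => (gfloor v)%:R : R).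
Proof.
exact: (@measurable_nat_comp _ R _ R gfloor (fun m => m%:R) measurable_gfloor).
Qed.

Lemma measurable_grem : measurable_fun setT grem.
Proof.
apply: measurable_funB; first exact: measurable_gexp.
by apply: measurable_funM => //; exact: measurable_gfloorR.
Qed.

Lemma grem_mean : (\int[U]_v (grem v)%:E = (r^-1 - h * (q / (1 - q)))%:E)%E.
Proof.
have m1 : measurable_fun setT (fun v => (h * (gfloor v)%:R)%:E).
  by apply/measurable_EFinP; apply: measurable_funM => //; exact: measurable_gfloorR.
have m2 : measurable_fun setT (fun v => (grem v)%:E).
  by apply/measurable_EFinP; exact: measurable_grem.
have := gexp_mean r0.
under eq_integral => v _ do rewrite -[gexp r v](subrK (h * (gfloor v)%:R)) EFinD.
rewrite ge0_integralD//; last 2 first.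
- by move=> v _; rewrite lee_fin grem_ge0.
- by move=> v _; rewrite lee_fin mulr_ge0// ltW.
under [X in (_ + X)%E]eq_integral do rewrite EFinM.
rewrite ge0_integralZl_EFin ?(ltW h0)//; last by apply/measurable_EFinP; exact: measurable_gfloorR.
rewrite gfloor_mean -EFinM.
case: (\int[_]_v _)%E => [z||]//; rewrite -EFinD => -[<-].
by rewrite addrK.
Qed.

(** Two bounds for two purposes: [h ^+ 2] makes each rounding error vanish with [h], while
    [32 / r ^+ 2] is summable over the eigenvalues uniformly in [h]. *)
Lemma grem_sqr : (\int[U]_v ((grem v) ^+ 2)%:E <= (Num.min (h ^+ 2) (32 / r ^+ 2))%:E)%E.
Proof.
have m2 : measurable_fun setT (fun v => (grem v ^+ 2)%:E).
  by apply/measurable_EFinP; apply: measurable_funX; exact: measurable_grem.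
rewrite EFin_min le_min; apply/andP; split.
  apply: (@le_trans _ _ (\int[U]_v (h ^+ 2)%:E)%E); last first.
    by rewrite integral_cst//= [X in (_ * X)%E]probability_setT mule1.
  apply: ge0_le_integral => //; try by move=> v _; rewrite lee_fin sqr_ge0.
  by move=> v _; rewrite lee_fin lerXn2r ?nnegrE ?grem_ge0 ?(ltW h0) ?grem_le_h.
apply: le_trans (gexp_sqr r0); apply: ge0_le_integral => //.
- by move=> v _; rewrite lee_fin sqr_ge0.
- by apply/measurable_EFinP; apply: measurable_funX; exact: measurable_gexp.
by move=> v _; rewrite lee_fin lerXn2r ?nnegrE ?grem_ge0 ?gexp_ge0 ?grem_le_gexp.
Qed.

End floor_of_exponential.

(** * From second moments to weak convergence *)

Section weak_convergence_from_L2.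
Context {R : realType} d (T : measurableType d) (P : probability T R).

Lemma integral_sqr_comb_le (X Y : T -> R) (a b c x y : R) :
  measurable_fun setT X -> measurable_fun setT Y ->
  0 <= a -> 0 <= b -> 0 <= c ->
  (\int[P]_w (X w ^+ 2)%:E <= x%:E)%E -> (\int[P]_w (Y w ^+ 2)%:E <= y%:E)%E ->
  (\int[P]_w (a + b * X w ^+ 2 + c * Y w ^+ 2)%:E <= (a + b * x + c * y)%:E)%E.
Proof.
move=> mX mY a0 b0 c0 Xx Yy.
have mX2 : measurable_fun setT (fun w => (X w ^+ 2)%:E).
  by apply/measurable_EFinP; apply: measurable_funX.
have mY2 : measurable_fun setT (fun w => (Y w ^+ 2)%:E).
  by apply/measurable_EFinP; apply: measurable_funX.
have p0 (z : R) : (0 <= (z ^+ 2)%:E)%E by rewrite lee_fin sqr_ge0.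
have E u v : ((a + b * u + c * v)%:E = a%:E + b%:E * u%:E + c%:E * v%:E)%E.
  by rewrite -!EFinM -!EFinD.
under eq_integral do rewrite E.
have bX w : (0 <= b%:E * (X w ^+ 2)%:E)%E by rewrite mule_ge0.
have cY w : (0 <= c%:E * (Y w ^+ 2)%:E)%E by rewrite mule_ge0.
have mbX : measurable_fun setT (fun w => b%:E * (X w ^+ 2)%:E)%E by exact: measurable_funeM.
have mcY : measurable_fun setT (fun w => c%:E * (Y w ^+ 2)%:E)%E by exact: measurable_funeM.
rewrite ge0_integralD//; last 2 first.
- by move=> w _; rewrite adde_ge0.
- exact: emeasurable_funD.
rewrite ge0_integralD// integral_cst//= [X in (_ * X)%E]probability_setT mule1.
rewrite !ge0_integralZl_EFin// E.
by rewrite !leeD// lee_wpmul2l.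
Qed.

Lemma integral_sqrB_le (X Y : T -> R) (x y : R) :
  measurable_fun setT X -> measurable_fun setT Y ->
  (\int[P]_w (X w ^+ 2)%:E <= x%:E)%E -> (\int[P]_w (Y w ^+ 2)%:E <= y%:E)%E ->
  (\int[P]_w ((X w - Y w) ^+ 2)%:E <= (2 * x + 2 * y)%:E)%E.
Proof.
move=> mX mY Xx Yy.
have := integral_sqr_comb_le mX mY (lexx 0) (ler0n R 2) (ler0n R 2) Xx Yy.
rewrite add0r; apply: le_trans; apply: ge0_le_integral => //.
- by move=> w _; rewrite lee_fin sqr_ge0.
- by apply/measurable_EFinP; apply: measurable_funX; exact: measurable_funB.
- apply/measurable_EFinP; apply: measurable_funD; last exact/measurable_funM/measurable_funX.
  by apply: measurable_funD => //; exact/measurable_funM/measurable_funX.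
- by move=> w _; rewrite lee_fin; have := sqr_ge0 (X w + Y w); nra.
Qed.

Lemma expectation_diff_le (X Y g : T -> R) (M r : R) :
  measurable_fun setT X -> measurable_fun setT Y -> measurable_fun setT g ->
  (forall w, `|X w| <= M) -> (forall w, `|Y w| <= M) ->
  (forall w, `|X w - Y w| <= g w) -> (\int[P]_w (g w)%:E <= r%:E)%E ->
  `|fine (\int[P]_w (X w)%:E) - fine (\int[P]_w (Y w)%:E)| <= r.
Proof.
move=> mX mY mg XM YM XYg gr.
have iX := integrable_bounded P mX XM; have iY := integrable_bounded P mY YM.
rewrite -fineB; [|exact: integrable_fin_num|exact: integrable_fin_num].
rewrite -integralB//; have iXY := integrableB measurableT iX iY.
rewrite -lee_fin -abse_EFin fineK; last exact: integrable_fin_num.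
apply: le_trans gr; apply: le_trans (le_abse_integral _ _ _) _ => //.
  exact: measurable_int iXY.
apply: ge0_le_integral => //.
- by apply: measurableT_comp => //; exact: measurable_int iXY.
- exact/measurable_EFinP.
- by move=> w _; rewrite -EFinB abse_EFin lee_fin.
Qed.

(** Only [x] is confined to a compact interval; [y] may leave it. The local radii are made uniform
    by the covering form of compactness. *)
Lemma modulus_of_continuity (f : R -> R) (A e : R) : continuous f -> 0 < e ->
  exists2 r : R, 0 < r &
    forall x y, `|x| <= A -> `|y - x| < r -> `|f y - f x| <= e.
Proof.
move=> fc e0.
have K : compact (`[- A, A]%classic : set R) by exact: segment_compact.
have := (compact_near_coveringP (`[- A, A]%classic : set R)).1 K R (0^'+)
  (fun r x => forall y, `|y - x| < r -> `|f y - f x| <= e) ltac:(typeclasses eauto).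
move=> [x _|d' /= d0 H].
  have e2 : 0 < e / 2 by rewrite divr_gt0.
  have /cvgrPdist_lt/(_ _ e2) := fc x.
  rewrite near_simpl => -[/= s s0 H].
  exists (ball x (s / 2), [set r | r < s / 2]).
    split => /=; first by apply: nbhsx_ballx; rewrite divr_gt0.
    by apply: nbhs_right_lt; rewrite divr_gt0.
  move=> [x' r] [/= xx' rs] y yx'.
  have h1 := H x'; have h2 := H y.
  have {h1}h1 : `|f x - f x'| < e / 2.
    by apply: h1; apply: lt_trans xx' _; rewrite ltr_pdivrMr// ltr_pMr// ltr1n.
  have {h2}h2 : `|f x - f y| < e / 2.
    apply: h2; rewrite /= (splitr s) -(subrKA x') (le_lt_trans (ler_normD _ _))// ltrD//.
    by rewrite distrC (lt_trans yx').
  rewrite -(subrKA (f x)) (le_trans (ler_normD _ _))// [leRHS]splitr lerD ?ltW//.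
  by rewrite distrC.
exists (d' / 2); first by rewrite divr_gt0.
move=> x y xA; apply: (H (d' / 2)) => /=.
- by rewrite sub0r normrN gtr0_norm ?divr_gt0// ltr_pdivrMr// ltr_pMr// ltr1n.
- by rewrite divr_gt0.
- by rewrite in_itv/= -ler_norml.
Qed.

(** A bound by squares, so that second moments suffice. For x of modulus at most 1 + 2M/c, either y
    is close and [e] is enough, or [b * (y - x) ^+ 2] exceeds 2M; for larger x, [c * x ^+ 2] exceeds
    2M. *)
Lemma bounded_continuous_sqr_bound (f : R -> R) (M e c : R) : continuous f ->
  (forall x, `|f x| <= M) -> 0 < e -> 0 < c ->
  exists2 b : R, 0 <= b &
    forall x y, `|f y - f x| <= e + c * x ^+ 2 + b * (y - x) ^+ 2.
Proof.
move=> fc fM e0 c0; have M0 : 0 <= M by exact: le_trans (fM 0).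
have [r r0 H] := modulus_of_continuity (1 + 2 * M / c) fc e0.
exists (2 * M / r ^+ 2) => [|x y]; first by rewrite divr_ge0 ?sqr_ge0// mulr_ge0.
have b0 : 0 <= 2 * M / r ^+ 2 by rewrite divr_ge0 ?sqr_ge0// mulr_ge0.
have ff : `|f y - f x| <= 2 * M.
  by rewrite mulr_natl mulr2n (le_trans (ler_normB _ _))// lerD.
have p1 := mulr_ge0 (ltW c0) (sqr_ge0 x).
have p2 := mulr_ge0 b0 (sqr_ge0 (y - x)).
have [xA|Ax] := leP `|x| (1 + 2 * M / c).
  have [yx|yx] := ltP `|y - x| r.
    by have := H x y xA yx; lra.
  apply: le_trans ff _; rewrite -[leLHS]add0r lerD//; first by lra.
  rewrite -mulrA ler_peMr ?mulr_ge0// mulrC ler_pdivlMr ?exprn_gt0// mul1r.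
  by rewrite -[leRHS]real_normK ?num_real// lerXn2r ?nnegrE// ltW.
apply: le_trans ff _; suff h : 2 * M <= c * x ^+ 2 by lra.
have q0 : 0 <= 2 * M / c by rewrite divr_ge0 ?mulr_ge0// ltW.
rewrite -ler_pdivrMl// mulrC -[x ^+ 2]real_normK ?num_real//.
move: (2 * M / c) q0 (`|x|) Ax => p p0 z; nra.
Qed.

Lemma cvg_expectation_L2 (X : T -> R) (Y : nat -> T -> R) (s : R) (b : nat -> R)
    (f : R -> R) (M : R) :
  measurable_fun setT X -> (forall n, measurable_fun setT (Y n)) ->
  (\int[P]_w (X w ^+ 2)%:E <= s%:E)%E ->
  (forall n, \int[P]_w ((Y n w - X w) ^+ 2)%:E <= (b n)%:E)%E ->
  b @ \oo --> (0 : R) -> continuous f -> (forall x, `|f x| <= M) ->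
  (fun n => fine (\int[P]_w (f (Y n w))%:E)) @ \oo --> fine (\int[P]_w (f (X w))%:E).
Proof.
move=> mX mY Xs Yb b0 fc fM.
have s0 : 0 <= s.
  by rewrite -lee_fin; apply: le_trans Xs; apply: integral_ge0 => w _; rewrite lee_fin sqr_ge0.
have mf : measurable_fun setT f by exact: continuous_measurable_fun.
apply/cvgrPdist_le => e e0.
have e3 : 0 < e / 3 by rewrite divr_gt0.
(* One third of [e] per term: this constant times [s] is at most [e / 3], the added 1 avoiding a
   division by zero. *)
have c0 : 0 < e / 3 / (s + 1) by rewrite divr_gt0// ltr_wpDl.
have [B B0 H] := bounded_continuous_sqr_bound fc fM e3 c0.
have B1 : 0 < B + 1 by rewrite ltr_wpDl.
have /cvgrPdist_le/(_ (e / 3 / (B + 1)) (divr_gt0 e3 B1)) := b0.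
apply: filterS => n; rewrite sub0r normrN => bn.
have bn0 : 0 <= b n.
  by rewrite -lee_fin; apply: le_trans (Yb n); apply: integral_ge0 => w _; rewrite lee_fin sqr_ge0.
rewrite ger0_norm// in bn; rewrite distrC.
have mYn := mY n.
apply: (@expectation_diff_le _ _ (fun w => e / 3 + e / 3 / (s + 1) * X w ^+ 2 +
    B * (Y n w - X w) ^+ 2) M) => //.
- exact: measurableT_comp.
- exact: measurableT_comp.
- apply: measurable_funD; last exact/measurable_funM/measurable_funX/measurable_funB.
  by apply: measurable_funD => //; exact/measurable_funM/measurable_funX.
apply: le_trans (integral_sqr_comb_le mX (measurable_funB mYn mX) _ _ _ Xs (Yb n)) _;
  rewrite ?(ltW e3) ?(ltW c0)//.
rewrite lee_fin.
have h1 : e / 3 / (s + 1) * s <= e / 3.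
  by rewrite -mulrA ger_pMr// ler_pdivrMl ?ltr_wpDl// mulr1 lerDl.
have h2 : B * b n <= e / 3.
  apply: (@le_trans _ _ ((B + 1) * b n)); first by rewrite ler_wpM2r// lerDl.
  by rewrite mulrC -ler_pdivlMr.
lra.
Qed.

End weak_convergence_from_L2.

(** * Coupled approximations of the limit *)

Section coupling.
Context {R : realType}.
Variable lam : nat -> R.
Hypotheses (lam0 : 0 < lam 0%N) (lamS : forall k, lam k <= lam k.+1).
Hypothesis expansion : heat_trace_expansion lam.
Notation U := (@unif01 R).

Let lam_pos k : 0 < lam k. Proof. exact: lam_gt0. Qed.

Definition centered_exp (k : nat) (v : R) : R := gexp (lam k) v - (lam k)^-1.

Lemma measurable_centered_exp k : measurable_fun setT (centered_exp k).
Proof. by apply: measurable_funB => //; exact: measurable_gexp. Qed.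

Lemma centered_exp_sqr k c :
  (\int[U]_v ((c + centered_exp k v) ^+ 2)%:E <= (c ^+ 2 + 32 / lam k ^+ 2)%:E)%E.
Proof.
apply: (centered_second_moment (measurable_gexp _) _ (gexp_mean (lam_pos k)) (gexp_sqr (lam_pos k))).
by move=> v; rewrite gexp_ge0// ltW.
Qed.

Definition var_bound : R := limn (series (fun k => 32 / lam k ^+ 2)).

Lemma cvg_var_bound : series (fun k => 32 / lam k ^+ 2) @ \oo --> var_bound.
Proof. by apply: is_cvg_seriesZ; exact: cvg_sum_lam_sqr. Qed.

Definition chi : R -> R := random_series centered_exp.

Lemma measurable_chi : measurable_fun setT chi.
Proof. exact: (measurable_random_series measurable_centered_exp). Qed.

Lemma chi_second_moment : (\int[U]_w (chi w ^+ 2)%:E <= var_bound%:E)%E.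
Proof.
have E w : chi w = random_series centered_exp w - xsum centered_exp 0 w by rewrite /xsum big_ord0 subr0.
under eq_integral => w _ do rewrite E.
apply: le_trans (random_series_tail measurable_centered_exp centered_exp_sqr cvg_var_bound 0) _.
by rewrite /series/= big_geq// subr0.
Qed.

Variable h : R.
Hypothesis h0 : 0 < h.

Definition bose (k : nat) : R := expR (- lam k * h).

Lemma bose_lt1 k : 0 <= bose k < 1.
Proof. exact: expR_step_lt1. Qed.

Definition gsum K w : nat := (\sum_(k < K) gfloor (lam k) h (xi k w))%N.

(** Deterministic centring error: [bose k / (1 - bose k)] is the mean of the geometric variable of
    index [k], and [m] will be the mean particle number. *)
Definition bias K (m : R) : R := h * (\sum_(k < K) bose k / (1 - bose k) - m).

(** Minus the rounding error, recentred by the mean found in [grem_mean]. *)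
Let u k v : R := (lam k)^-1 - h * (bose k / (1 - bose k)) - grem (lam k) h v.

Let mu k : measurable_fun setT (u k).
Proof. by apply: measurable_funB => //; exact: measurable_grem. Qed.

Let uv k c : (\int[U]_v ((c + u k v) ^+ 2)%:E <=
  (c ^+ 2 + Num.min (h ^+ 2) (32 / lam k ^+ 2))%:E)%E.
Proof.
apply: (centered_second_momentN (measurable_grem (lam_pos k) h0) _
  (grem_mean (lam_pos k) h0) (grem_sqr (lam_pos k) h0)).
by move=> v; exact: grem_ge0.
Qed.

Lemma gsum_law K m : measurable [set w | gsum K w = m] /\
  U [set w | gsum K w = m] = (gconv bose K m)%:E.
Proof.
apply: (@geometric_sum_law R K bose (fun k => gfloor (lam k) h)) => k j.
  exact: measurable_gfloor.
exact: gfloor_law.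
Qed.

Lemma gsum_decomposition K m w : h * ((gsum K w)%:R - m) =
  (bias K m + xsum u K w) + xsum centered_exp K w.
Proof.
rewrite /bias /gsum /xsum -addrA -big_split/= natr_sum !mulrBr addrAC; congr (_ - _).
rewrite !mulr_sumr -big_split/=; apply: eq_bigr => k _.
rewrite /u /centered_exp /grem; ring.
Qed.

(** Bias and rounding errors are set against the tail of the series beyond [K], hence the two
    factors 2. *)
Lemma coupling_L2 K m :
  (\int[U]_w ((h * ((gsum K w)%:R - m) - chi w) ^+ 2)%:E <=
   (2 * (bias K m ^+ 2 + \sum_(k < K) Num.min (h ^+ 2) (32 / lam k ^+ 2)) +
    2 * (var_bound - series (fun k => 32 / lam k ^+ 2) K))%:E)%E.
Proof.
under eq_integral => w _ do rewrite gsum_decomposition -addrA -[xsum centered_exp K w - _]opprB.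
apply: integral_sqrB_le.
- by apply: measurable_funD => //; exact: measurable_xsum.
- by apply: measurable_funB; [exact: measurable_chi|apply: measurable_xsum; exact: measurable_centered_exp].
- exact: (xsum_second_moment mu uv).
- exact: (random_series_tail measurable_centered_exp centered_exp_sqr cvg_var_bound).
Qed.

Lemma cvg_series_bose j : (0 < j)%N ->
  series (fun k => bose k ^+ j) @ \oo --> fine (heat_trace lam (h * j%:R)).
Proof.
move=> j0; rewrite (_ : (fun k => _) = (fun k => expR (- lam k * (h * j%:R)))); last first.
  by apply/funext => k; rewrite /bose -expRM_natr mulrA.
by apply: cvg_heat_trace => //; rewrite mulr_gt0// ltr0n.
Qed.

Lemma sum_bose_le K j : (0 < j)%N ->
  \sum_(k < K) bose k ^+ j <= fine (heat_trace lam (h * j%:R)).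
Proof.
move=> j0; rewrite -(big_mkord xpredT (fun k => bose k ^+ j)).
apply: (series_le_lim K _ (cvg_series_bose j0)) => k.
by rewrite exprn_ge0//; have /andP[] := bose_lt1 k.
Qed.

Lemma geometric_tail (q : R) N : q < 1 ->
  q / (1 - q) = \sum_(1 <= j < N.+1) q ^+ j + q ^+ N.+1 / (1 - q).
Proof.
move=> q1; have d0 : 1 - q != 0 by rewrite subr_eq0 gt_eqF.
elim: N => [|N IH]; first by rewrite big_geq// add0r.
rewrite IH [in RHS]big_nat_recr//= -addrA; congr (_ + _).
by rewrite [q ^+ N.+2]exprS; move: (q ^+ N.+1) => x; field.
Qed.

(** The part of the heat traces carried by the eigenvalues of index at least [K], added up over the
    loop lengths up to the cut-off. *)
Definition defect N K : R := \sum_(1 <= j < N.+1)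
  (fine (heat_trace lam (h * j%:R)) - \sum_(k < K) bose k ^+ j).

Lemma defect_ge0 N K : 0 <= defect N K.
Proof.
rewrite /defect big_nat_cond sumr_ge0// => j /andP[/andP[j0 _] _].
by rewrite subr_ge0 sum_bose_le.
Qed.

Lemma cvg_defect N : defect N @ \oo --> (0 : R).
Proof.
elim: N => [|N IH].
  rewrite (_ : defect 0 = fun=> 0); first exact: cvg_cst.
  by apply/funext => K; rewrite /defect big_geq.
rewrite (_ : defect N.+1 = fun K => defect N K + (fine (heat_trace lam (h * N.+1%:R)) -
    \sum_(k < K) bose k ^+ N.+1)); last first.
  by apply/funext => K; rewrite /defect big_nat_recr.
rewrite -[X in _ --> X](addr0 0); apply: cvgD; first exact: IH.
rewrite -[X in _ --> X](subrr (fine (heat_trace lam (h * N.+1%:R)))); apply: cvgB; first exact: cvg_cst.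
rewrite (_ : (fun K => _) = series (fun k => bose k ^+ N.+1)); first exact: cvg_series_bose.
by apply/funext => K; rewrite /series/= big_mkord.
Qed.

(** The mean q / (1 - q) splits into the powers 1 to [N], compared with the heat traces, and the
    remainder q^(N+1) / (1 - q). The former give exactly minus [h] times the defect; in the latter,
    h / (1 - q) is bounded uniformly over the eigenvalues. *)
Lemma normr_bias_le N K :
  `|bias K (\sum_(1 <= j < N.+1) fine (heat_trace lam (h * j%:R)))| <=
  h * defect N K +
  (lam 0%N)^-1 * (1 + lam 0%N * h) * fine (heat_trace lam (h * N.+1%:R)).
Proof.
have E : bias K (\sum_(1 <= j < N.+1) fine (heat_trace lam (h * j%:R))) =
    h * \sum_(k < K) bose k ^+ N.+1 / (1 - bose k) - h * defect N K.
  rewrite /bias /defect -mulrBr; congr (_ * _).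
  rewrite (eq_bigr (fun k : 'I_K => \sum_(1 <= j < N.+1) bose k ^+ j +
      bose k ^+ N.+1 / (1 - bose k))); last first.
    by move=> k _; apply: geometric_tail; have /andP[] := bose_lt1 k.
  by rewrite big_split/= exchange_big/= sumrB; ring.
rewrite E; apply: le_trans (ler_normB _ _) _.
rewrite (ger0_norm (mulr_ge0 (ltW h0) (defect_ge0 N K))) addrC lerD2l.
have d1 k : 0 < 1 - bose k by rewrite subr_gt0; have /andP[] := bose_lt1 k.
have b0 k : 0 <= bose k ^+ N.+1 by rewrite exprn_ge0//; have /andP[] := bose_lt1 k.
rewrite ger0_norm; last first.
  by rewrite mulr_ge0 ?(ltW h0)// sumr_ge0// => k _; rewrite divr_ge0// ltW.
(* With x = lam_0 h, [bose k] is at most exp(-x) and (1 + x) exp(-x) <= 1, so that [1 - bose k] is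
   at least x / (1 + x). *)
have hb k : h / (1 - bose k) <= (lam 0%N)^-1 * (1 + lam 0%N * h).
  rewrite ler_pdivrMr// -mulrA ler_pdivlMl//.
  have x0 : 0 < lam 0%N * h by rewrite mulr_gt0.
  have : bose k * (1 + lam 0%N * h) <= 1.
    apply: (@le_trans _ _ (expR (- (lam 0%N * h)) * expR (lam 0%N * h))).
      apply: ler_pM; rewrite ?expR_ge0 ?expR_ge1Dx//; first by rewrite addr_ge0// ltW.
      by rewrite ler_expR mulNr lerN2 ler_wpM2r ?(ltW h0)// lam_ge0th.
    by rewrite -expRD addNr expR0.
  lra.
rewrite mulr_sumr.
apply: (@le_trans _ _ (\sum_(k < K) (lam 0%N)^-1 * (1 + lam 0%N * h) * bose k ^+ N.+1)).
  by apply: ler_sum => k _; rewrite mulrCA [leLHS]mulrC ler_wpM2r.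
rewrite -mulr_sumr ler_wpM2l ?sum_bose_le// mulr_ge0 ?invr_ge0 ?(ltW lam0)//.
by rewrite addr_ge0// mulr_ge0// ltW.
Qed.

End coupling.

(** * Passage to the limit *)

Section convergence.
Context {R : realType}.
Variable lam : nat -> R.
Hypotheses (lam0 : 0 < lam 0%N) (lamS : forall k, lam k <= lam k.+1).
Hypothesis expansion : heat_trace_expansion lam.
Notation U := (@unif01 R).
Let Z t := fine (heat_trace lam t).
Let v k : R := 32 / lam k ^+ 2.

Definition bose_gas_pmf (h : R) (N m : nat) : R :=
  expR (- \sum_(1 <= j < N.+1) fine (heat_trace lam (h * j%:R)) / j%:R) *
  cpois (fun j => fine (heat_trace lam (h * j%:R)) / j%:R) N m.

Lemma law_comparison d (T : measurableType d) (P : probability T R) (X : T -> nat)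
    (h M : R) (N K : nat) (F : nat -> R) : 0 < h ->
  (forall m, measurable [set w | X w = m]) ->
  (forall m, P [set w | X w = m] = (bose_gas_pmf h N m)%:E) ->
  (forall m, `|F m| <= M) ->
  `|fine (\int[P]_w (F (X w))%:E) - fine (\int[U]_w (F (gsum lam h K w))%:E)| <=
  2 * M * (defect lam h N K + Z (h * N.+1%:R)).
Proof.
move=> h0 mX lX FM.
(* The comparison takes test functions between 0 and a bound; the added [M] costs a factor 2 and
   cancels in the difference. *)
pose G m := F m + M.
have GM m : 0 <= G m <= 2 * M.
  by have := FM m; rewrite ler_norml /G => /andP[? ?]; apply/andP; split; lra.
have shift d' (T' : measurableType d') (P' : probability T' R) (Y : T' -> nat) :
    (forall m, measurable [set w | Y w = m]) ->
    (\int[P']_w (G (Y w))%:E < +oo)%E /\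
    fine (\int[P']_w (G (Y w))%:E) = fine (\int[P']_w (F (Y w))%:E) + M.
  move=> mY.
  have iF : P'.-integrable setT (EFin \o (F \o Y)).
    apply: (integrable_bounded P' (M := M)) => [|w]; last exact: FM.
    exact: (@measurable_nat_comp _ T' _ R Y F mY).
  have iM : P'.-integrable setT (EFin \o cst M).
    by apply: (integrable_bounded P' (M := `|M|)) => //.
  have -> : (\int[P']_w (G (Y w))%:E = \int[P']_w (F (Y w))%:E + M%:E)%E.
    under eq_integral do rewrite EFinD.
    rewrite integralD//= integral_cst//=.
    by rewrite [X in (_ + _ * X)%E]probability_setT mule1.
  have := integrable_fin_num measurableT iF; rewrite /comp.
  case: (\int[P']_w _)%E => [z||]// _; split; first by rewrite -EFinD ltry.
  by rewrite -EFinD.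
have gl := gsum_law lam0 lamS h0 K.
have mg m : measurable [set w | gsum lam h K w = m] by have [] := gl m.
have lg m : U [set w | gsum lam h K w = m] = (gconv (bose lam h) K m)%:E by have [] := gl m.
have [X1 X2] := shift _ _ P X mX; have [g1 g2] := shift _ _ U _ mg.
have G0 m : 0 <= G m by have /andP[] := GM m.
have cX := cvg_series_expectation mX G0 lX X1.
have cg := cvg_series_expectation mg G0 lg g1.
(* The weight of index 0 is divided by 0, hence irrelevant, but it has to
   dominate the K terms [bose lam h k ^+ 0]. *)
pose a j : R := if j == 0%N then K%:R else Z (h * j%:R).
have ax : (fun j => Z (h * j%:R) / j%:R) = (fun j => a j / j%:R).
  by apply/funext => -[|j]; rewrite /a//= invr0 !mulr0.
have aK j : \sum_(k < K) bose lam h k ^+ j <= a j.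
  rewrite /a; case: j => [|j] /=; last exact: sum_bose_le.
  by rewrite (eq_bigr (fun=> 1)) => [|k _]; rewrite ?expr0// sumr_const card_ord.
have sx : \sum_(1 <= j < N.+1) fine (heat_trace lam (h * j%:R)) / j%:R =
    \sum_(1 <= j < N.+1) a j / j%:R.
  by apply: eq_bigr => j _; exact: (congr1 (@^~ j) ax).
rewrite /bose_gas_pmf sx ax in cX.
have := @compound_poisson_vs_geometric R N K _ _ _ _ _ _ (bose_lt1 lam0 lamS h0) aK GM.
move=> /(_ _ _ cX cg); rewrite X2 g2 [_ + M - _](_ : _ =
  fine (\int[P]_w (F (X w))%:E) - fine (\int[U]_w (F (gsum lam h K w))%:E)); last by ring.
move=> /le_trans; apply.
have M0 : 0 <= 2 * M by have := GM 0%N; move=> /andP[]; exact: le_trans.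
apply: ler_wpM2l => //; apply: lerD; last exact: sum_bose_le.
rewrite /defect le_eqVlt; apply/orP; left; apply/eqP.
by apply: eq_big_nat => -[|j]//.
Qed.

Let v0 k : 0 <= v k.
Proof. by rewrite divr_ge0// sqr_ge0. Qed.

Let tail_ge0 J : 0 <= var_bound lam - series v J.
Proof. by rewrite subr_ge0; apply: series_le_lim v0 _; exact: cvg_var_bound. Qed.

(** Dominated convergence by hand: the split at an auxiliary [J], free of [K], leaves finitely many
    terms that vanish with [h] and a tail of a convergent series. *)
Let min_sum_le (h : R) K J : \sum_(k < K) Num.min (h ^+ 2) (v k) <=
  J%:R * h ^+ 2 + (var_bound lam - series v J).
Proof.
have tr (n : nat) : \sum_(0 <= k < n) Num.min (h ^+ 2) (v k) <= n%:R * h ^+ 2.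
  apply: (@le_trans _ _ (\sum_(0 <= k < n) h ^+ 2)).
    by apply: ler_sum => k _; rewrite ge_min lexx.
  by rewrite sumr_const_nat subn0 [leRHS]mulr_natl.
rewrite -(big_mkord xpredT (fun k => Num.min (h ^+ 2) (v k))).
have [KJ|JK] := leqP K J.
  apply: le_trans (tr K) _; rewrite -[leLHS]addr0 lerD// ler_wpM2r ?sqr_ge0//.
  by rewrite ler_nat.
rewrite (@big_cat_nat _ _ _ J)//= ?(ltnW JK)// lerD//.
rewrite lerBrDr addrC; apply: (@le_trans _ _ (series v K)); last first.
  by apply: series_le_lim v0 _; exact: cvg_var_bound.
rewrite /series/= [leRHS](@big_cat_nat _ _ _ J)//= ?(ltnW JK)// lerD2l.
by apply: ler_sum => k _; rewrite ge_min lexx orbT.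
Qed.

(** Two errors add up: [D n] for replacing the law by that of the geometric sum, and the effect on
    [f] of the squared L^2 distance [b n] between that sum, rescaled, and [chi]. *)
Theorem bose_gas_limit (d : nat -> measure_display)
    (T : forall n, measurableType (d n)) (P : forall n, probability (T n) R)
    (X : forall n, T n -> nat) (h : nat -> R) (N : nat -> nat) (f : R -> R) (M : R) :
  (forall n, 0 < h n) -> h @ \oo --> (0 : R) ->
  (fun n => h n * (N n).+1%:R) @ \oo --> +oo ->
  (forall n m, measurable [set w | X n w = m]) ->
  (forall n m, P n [set w | X n w = m] = (bose_gas_pmf (h n) (N n) m)%:E) ->
  continuous f -> (forall x, `|f x| <= M) ->
  (fun n => fine (\int[P n]_w (f (h n * ((X n w)%:R -
     \sum_(1 <= j < (N n).+1) fine (heat_trace lam (h n * j%:R)))))%:E)) @ \oo -->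
  fine (\int[U]_w (f (chi lam w))%:E).
Proof.
move=> h0 hz hN mX lX fc fM.
pose m n := \sum_(1 <= j < (N n).+1) Z (h n * j%:R).
have M0 : 0 <= M by exact: le_trans (fM 0).
(* [K n] makes the defect small for the cut-off [N n], and it tends to infinity, so that the tail of
   the series vanishes too. *)
have /choice[K HK] n : exists k, (n <= k)%N /\ defect lam (h n) (N n) k <= n.+1%:R^-1.
  have n0 : 0 < n.+1%:R^-1 :> R by rewrite invr_gt0.
  have /cvgrPdist_le/(_ _ n0)[k0 _ H] := cvg_defect lam0 lamS expansion (h0 n) (N n).
  exists (maxn n k0); rewrite leq_maxl; split => //.
  have := H (maxn n k0) (leq_maxr _ _).
  by rewrite sub0r normrN; apply: le_trans; rewrite ler_norm.
have hnoo : (fun n => Z (h n * (N n).+1%:R)) @ \oo --> (0 : R).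
  exact: (heat_trace_decay lam0 lamS expansion hN).
have invn : (fun n => n.+1%:R^-1 : R) @ \oo --> (0 : R) by exact: cvg_harmonic.
pose D n := 2 * M * (n.+1%:R^-1 + Z (h n * (N n).+1%:R)).
have D0 : D @ \oo --> (0 : R).
  rewrite -[X in _ --> X](mulr0 (2 * M)) -[X in _ --> 2 * M * X](addr0 0).
  by apply: cvgMr; apply: cvgD.
have bias0 : (fun n => bias lam (h n) (K n) (m n) ^+ 2) @ \oo --> (0 : R).
  have B0 : (fun n => h n * n.+1%:R^-1 + (lam 0%N)^-1 * (1 + lam 0%N * h n) *
      Z (h n * (N n).+1%:R)) @ \oo --> (0 : R).
    rewrite -[X in _ --> X](addr0 0); apply: cvgD.
      by rewrite -[X in _ --> X](mulr0 0); apply: cvgM.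
    rewrite -[X in _ --> X](mulr0 ((lam 0%N)^-1 * (1 + lam 0%N * 0))); apply: cvgM => //.
    by apply: cvgMr; apply: cvgD; [exact: cvg_cst|exact: cvgMr].
  have b0 : (fun n => bias lam (h n) (K n) (m n)) @ \oo --> (0 : R).
    apply/norm_cvg0P; apply: (squeeze_cvgr _ (cvg_cst 0) B0); near=> n.
    rewrite normr_ge0/=; apply: le_trans (normr_bias_le lam0 lamS expansion (h0 n) _ _) _.
    by rewrite lerD2r ler_wpM2l ?(ltW (h0 n))//; have [] := HK n.
  rewrite -[X in _ --> X](mulr0 0); under eq_cvg do rewrite expr2.
  exact: cvgM.
have vc : (fun J => var_bound lam - series v J) @ \oo --> (0 : R).
  rewrite -(subrr (var_bound lam)); apply: cvgB; first exact: cvg_cst.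
  exact: cvg_var_bound.
have vK : (fun n => var_bound lam - series v (K n)) @ \oo --> (0 : R).
  apply: (squeeze_cvgr _ (cvg_cst 0) vc); near=> n.
  rewrite tail_ge0/= lerD2l lerN2; have [nK _] := HK n.
  exact: (nondecreasing_series (fun k _ _ => v0 k)).
have mK : (fun n => \sum_(k < K n) Num.min (h n ^+ 2) (v k)) @ \oo --> (0 : R).
  apply/cvgrPdist_le => e e0; have e2 : 0 < e / 2 by rewrite divr_gt0.
  have /cvgrPdist_le/(_ _ e2)[J _ HJ] := vc.
  have hJ : (fun n => J%:R * (h n * h n)) @ \oo --> (0 : R).
    have hh : (fun n => h n * h n) @ \oo --> (0 : R).
      by rewrite -[X in _ --> X](mulr0 0); apply: cvgM.
    by rewrite -[X in _ --> X](mulr0 J%:R); exact: cvgMr.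
  have /cvgrPdist_le/(_ _ e2) := hJ; apply: filterS => n; rewrite !sub0r !normrN => hn.
  rewrite ger0_norm; last by rewrite sumr_ge0// => k _; rewrite le_min sqr_ge0 v0.
  apply: le_trans (min_sum_le (h n) (K n) J) _; rewrite [leRHS]splitr lerD//.
    by apply: le_trans hn; rewrite expr2 ler_norm.
  by have := HJ J (leqnn J); rewrite sub0r normrN; apply: le_trans; rewrite ler_norm.
pose b n := 2 * (bias lam (h n) (K n) (m n) ^+ 2 +
  \sum_(k < K n) Num.min (h n ^+ 2) (v k)) + 2 * (var_bound lam - series v (K n)).
have b0 : b @ \oo --> (0 : R).
  rewrite -[X in _ --> X](addr0 0); apply: cvgD.
    rewrite -[X in _ --> X](mulr0 2); apply: cvgMr.
    by rewrite -[X in _ --> X](addr0 0); apply: cvgD.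
  by rewrite -[X in _ --> X](mulr0 2); apply: cvgMr.
pose Y n w := h n * ((gsum lam (h n) (K n) w)%:R - m n).
have mY n : measurable_fun setT (Y n).
  apply: (@measurable_nat_comp _ R _ R (gsum lam (h n) (K n))
    (fun k => h n * (k%:R - m n))) => k.
  by have [] := gsum_law lam0 lamS (h0 n) (K n) k.
have c1 := cvg_expectation_L2 (measurable_chi lam) mY
  (chi_second_moment lam0 lamS expansion)
  (fun n => coupling_L2 lam0 lamS expansion (h0 n) (K n) (m n)) b0 fc fM.
pose A n := fine (\int[P n]_w (f (h n * ((X n w)%:R - m n)))%:E).
pose B n := fine (\int[U]_w (f (Y n w))%:E).
have AB : (fun n => A n - B n) @ \oo --> (0 : R).
  apply/norm_cvg0P; apply: (squeeze_cvgr _ (cvg_cst 0) D0); near=> n.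
  rewrite normr_ge0/=.
  apply: le_trans (law_comparison (K n) (h0 n) (mX n) (lX n)
    (fun k => fM (h n * (k%:R - m n)))) _.
  by rewrite ler_wpM2l ?mulr_ge0// lerD2r; have [] := HK n.
rewrite (_ : (fun n => _) = (fun n => (A n - B n) + B n)); last first.
  by apply/funext => n; rewrite subrK.
by rewrite -[X in _ --> X]add0r; apply: cvgD.
Unshelve. all: by end_near. Qed.

End convergence.

(** * Characteristic function and regularized determinant *)

Section complex_limits.
Context {R : realType}.

Lemma ltc_norm (x y e : R) : 0 < e -> x ^+ 2 + y ^+ 2 < e ^+ 2 ->
  `|((x +i* y)%C : R[i])| < (e%:C)%C.
Proof.
move=> e0 h; rewrite normc_def ltcR /= -[ltRHS](ger0_norm (ltW e0)) -sqrtr_sqr.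
by rewrite ltr_sqrt// exprn_gt0.
Qed.

Lemma cvg_complex (u v : nat -> R) (a b : R) :
  u @ \oo --> a -> v @ \oo --> b ->
  (fun n => (u n +i* v n)%C : R[i]^o) @ \oo --> ((a +i* b)%C : R[i]^o).
Proof.
move=> ua vb; apply/cvgrPdist_lt => -[e e'] /=; rewrite ltcE/= => /andP[/eqP -> e0].
have e2 : 0 < e / 2 by rewrite divr_gt0.
have /cvgrPdist_lt/(_ _ e2) := ua; have /cvgrPdist_lt/(_ _ e2) := vb.
apply: filterS2 => n vn un; apply: ltc_norm => //=.
move: un vn; rewrite !ltr_norml => /andP[u1 u2] /andP[v1 v2]; nra.
Qed.

Lemma complex_neq0 (a b : R) : 0 < a ^+ 2 + b ^+ 2 -> ((a +i* b)%C : R[i]) != 0.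
Proof.
move=> h; apply/eqP => -[a0 b0]; move: h.
by rewrite a0 b0 expr0n addr0 ltxx.
Qed.

Lemma prod_sqr_norm (a b p : nat -> R) m :
  (forall k, a k ^+ 2 + b k ^+ 2 = p k) ->
  let z := \prod_(k < m) ((a k +i* b k)%C : R[i]) in
  complex.Re z ^+ 2 + complex.Im z ^+ 2 = \prod_(k < m) p k.
Proof.
move=> abp; elim: m => [|m IH] /=; first by rewrite !big_ord0 /= expr1n expr0n addr0.
rewrite !big_ord_recr/= -IH -(abp m); case: (\prod_(k < m) _) => x y /=; ring.
Qed.

End complex_limits.

Section characteristic_function.
Context {R : realType}.
Variable lam : nat -> R.
Hypotheses (lam0 : 0 < lam 0%N) (lamS : forall k, lam k <= lam k.+1).
Hypothesis expansion : heat_trace_expansion lam.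
Variable t : R.
Notation U := (@unif01 R).

Let lam_pos k : 0 < lam k. Proof. exact: lam_gt0. Qed.

(** [p k +i* r k] is lam_k / (lam_k - i t), the characteristic function of the exponential variable;
    [a k +i* b k] is its product with exp(- i t / lam_k), which accounts for the recentring. *)
Let p k : R := lam k ^+ 2 / (lam k ^+ 2 + t ^+ 2).
Let r k : R := lam k * t / (lam k ^+ 2 + t ^+ 2).
Let a k : R := cos (t / lam k) * p k + sin (t / lam k) * r k.
Let b k : R := cos (t / lam k) * r k - sin (t / lam k) * p k.

Let d0 k : 0 < lam k ^+ 2 + t ^+ 2.
Proof. by rewrite ltr_pwDl ?sqr_ge0// exprn_gt0. Qed.

Let y k (v : R) : R := t * centered_exp lam k v.

Let my k : measurable_fun setT (y k).
Proof. by apply: measurable_funM => //; exact: measurable_centered_exp. Qed.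

Let mtg k : measurable_fun setT (fun v => t * gexp (lam k) v).
Proof. by apply: measurable_funM => //; exact: measurable_gexp. Qed.

Let yE k v : y k v = t * gexp (lam k) v - t / lam k.
Proof. by rewrite /y /centered_exp mulrBr. Qed.

Let ya k : (\int[U]_v (1 + cos (y k v))%:E = (1 + a k)%:E)%E.
Proof.
rewrite /a -(integral_lin (P := U) (cos (t / lam k)) (sin (t / lam k))
  (measurable_cos_comp (mtg k)) (measurable_sin_comp (mtg k))
  (fun=> normr_cos_le1 _) (fun=> normr_sin_le1 _) (gexp_cos t (lam_pos k)) (gexp_sin t (lam_pos k))).
by apply: eq_integral => v _; rewrite yE cosB; congr (1 + _)%:E; ring.
Qed.

Let yb k : (\int[U]_v (1 + sin (y k v))%:E = (1 + b k)%:E)%E.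
Proof.
rewrite /b [_ - _]addrC -mulNr -(integral_lin (P := U) (- sin (t / lam k)) (cos (t / lam k))
  (measurable_cos_comp (mtg k)) (measurable_sin_comp (mtg k))
  (fun=> normr_cos_le1 _) (fun=> normr_sin_le1 _) (gexp_cos t (lam_pos k)) (gexp_sin t (lam_pos k))).
by apply: eq_integral => v _; rewrite yE sinB; congr (1 + _)%:E; ring.
Qed.

Let z m : R[i] := \prod_(k < m) ((a k +i* b k)%C : R[i]).

Let integral_shift (X : R -> R) (x : R) : measurable_fun setT X ->
  (forall w, `|X w| <= 1) -> (\int[U]_w (1 + X w)%:E = (1 + x)%:E)%E ->
  fine (\int[U]_w (X w)%:E) = x.
Proof.
move=> mX X1; under eq_integral do rewrite EFinD.
have iX := integrable_bounded U mX X1.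
have i1 : U.-integrable setT (EFin \o cst 1).
  by apply: (integrable_bounded U (M := 1)) => // w; rewrite /= normr1.
rewrite integralD//= integral_cst//= [X in (_ * X + _)%E]probability_setT mule1.
have := integrable_fin_num measurableT iX; rewrite /comp.
by case: (\int[_]_w _)%E => [u||]// _; rewrite -EFinD => -[/addrI].
Qed.

Let xsumE m w : xsum y m w = t * xsum (centered_exp lam) m w.
Proof. by rewrite /xsum mulr_sumr. Qed.

Let mxs m : measurable_fun setT (fun w => xsum y m w).
Proof. by apply: measurable_xsum; exact: my. Qed.

Let zRe m : complex.Re (z m) = fine (\int[U]_w (cos (t * xsum (centered_exp lam) m w))%:E).
Proof.
under eq_integral do rewrite -xsumE.
apply/esym/integral_shift; last by have [] := xsum_char my ya yb m.
- exact: measurable_cos_comp.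
- by move=> w; exact: normr_cos_le1.
Qed.

Let zIm m : complex.Im (z m) = fine (\int[U]_w (sin (t * xsum (centered_exp lam) m w))%:E).
Proof.
under eq_integral do rewrite -xsumE.
apply/esym/integral_shift; last by have [] := xsum_char my ya yb m.
- exact: measurable_sin_comp.
- by move=> w; exact: normr_sin_le1.
Qed.

Let cvg_bounded (f : R -> R) : continuous f -> (forall x, `|f x| <= 1) ->
  (fun m => fine (\int[U]_w (f (xsum (centered_exp lam) m w))%:E)) @ \oo -->
  fine (\int[U]_w (f (chi lam w))%:E).
Proof.
move=> fc f1; apply: (cvg_expectation_L2 (measurable_chi lam) _
  (chi_second_moment lam0 lamS expansion)
  (b := fun m => var_bound lam - series (fun k => 32 / lam k ^+ 2) m) _ _ fc f1) => [m|m|].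
- by apply: measurable_xsum; exact: measurable_centered_exp.
- under eq_integral do rewrite -sqrrN opprB.
  exact: (random_series_tail (measurable_centered_exp lam) (centered_exp_sqr lam0 lamS)
    (cvg_var_bound lam0 lamS expansion)).
rewrite -[X in _ --> X](subrr (var_bound lam)); apply: cvgB; first exact: cvg_cst.
exact: cvg_var_bound.
Qed.

Let re_lim : (fun m => complex.Re (z m)) @ \oo --> complex.Re (char_fun U (chi lam) t).
Proof.
under eq_cvg do rewrite zRe; rewrite /char_fun /= unlock.
apply: (@cvg_bounded (fun x => cos (t * x))) => x; last exact: normr_cos_le1.
by apply: continuous_comp; [exact: mulrl_continuous|exact: continuous_cos].
Qed.

Let im_lim : (fun m => complex.Im (z m)) @ \oo --> complex.Im (char_fun U (chi lam) t).
Proof.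
under eq_cvg do rewrite zIm; rewrite /char_fun /= unlock.
apply: (@cvg_bounded (fun x => sin (t * x))) => x; last exact: normr_sin_le1.
by apply: continuous_comp; [exact: mulrl_continuous|exact: continuous_sin].
Qed.

Let z_lim : (fun m => z m : R[i]^o) @ \oo --> (char_fun U (chi lam) t : R[i]^o).
Proof.
have := cvg_complex re_lim im_lim; case: (char_fun _ _ _) => u v /=.
by rewrite (_ : (fun m => _) = (fun m => z m : R[i]^o))//; apply/funext => m; case: (z m).
Qed.

(** Each factor has squared modulus 1 / (1 + t^2 / lam_k^2) >= exp(- t^2 / lam_k^2). As [var_bound]
    is 32 times the sum of lam_k^-2, dividing by 32 restores that sum. The bound is free of [m], so
    the limit stays away from 0. *)
Let z_sqr_norm m : expR (- (t ^+ 2 / 32 * var_bound lam)) <= complex.Re (z m) ^+ 2 + complex.Im (z m) ^+ 2.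
Proof.
have ab k : a k ^+ 2 + b k ^+ 2 = (1 + t ^+ 2 / lam k ^+ 2)^-1.
  have -> : a k ^+ 2 + b k ^+ 2 = (cos (t / lam k) ^+ 2 + sin (t / lam k) ^+ 2) * (p k ^+ 2 + r k ^+ 2).
    by rewrite /a /b; ring.
  rewrite cos2Dsin2 mul1r /p /r.
  have := d0 k; have := lam_pos k; move: (lam k) => l l0 e0; field.
  by rewrite !gt_eqF.
rewrite (prod_sqr_norm _ ab).
apply: (@le_trans _ _ (\prod_(k < m) expR (- (t ^+ 2 / lam k ^+ 2)))).
  rewrite -expR_sum ler_expR sumrN lerN2.
  apply: (@le_trans _ _ (t ^+ 2 / 32 * series (fun k => 32 / lam k ^+ 2) m)).
    rewrite /series/= big_mkord mulr_sumr; apply: ler_sum => k _.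
    have := lam_pos k; move: (lam k) => l l0; rewrite le_eqVlt; apply/orP; left; apply/eqP.
    by field; rewrite gt_eqF.
  rewrite ler_wpM2l ?divr_ge0 ?sqr_ge0//; apply: series_le_lim; last exact: cvg_var_bound.
  by move=> k; rewrite divr_ge0 ?sqr_ge0.
apply: ler_prod => k _; rewrite expR_ge0/= expRN lef_pV2 ?posrE ?expR_gt0 ?expR_ge1Dx//.
by rewrite ltr_pwDl// divr_ge0 ?sqr_ge0.
Qed.

Lemma char_fun_chi_neq0 : char_fun U (chi lam) t != 0.
Proof.
have h : (fun m => complex.Re (z m) ^+ 2 + complex.Im (z m) ^+ 2) @ \oo -->
    complex.Re (char_fun U (chi lam) t) ^+ 2 + complex.Im (char_fun U (chi lam) t) ^+ 2.
  rewrite !expr2; under eq_cvg do rewrite !expr2.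
  by apply: cvgD; apply: cvgM.
have : 0 < complex.Re (char_fun U (chi lam) t) ^+ 2 + complex.Im (char_fun U (chi lam) t) ^+ 2.
  apply: lt_le_trans (expR_gt0 (- (t ^+ 2 / 32 * var_bound lam))) _.
  rewrite -(cvg_lim _ h)//; apply: limr_ge; first by apply/cvg_ex; eexists; exact: h.
  by near=> m; exact: z_sqr_norm.
by case: (char_fun _ _ _) => u v; exact: complex_neq0.
Unshelve. all: by end_near. Qed.

(** With s = t / lam_k, each factor is (1 - i s) exp(i s), the inverse of exp(- i s) / (1 - i s). *)
Lemma det2_partial_product m (kappa := fun k => (- (0 +i* t) * ((lam k)^-1)%:C)%C : R[i]) :
  \prod_(k < m) ((1 + kappa k) * cexp (- kappa k)) = (z m)^-1.
Proof.
rewrite /z -prodfV; apply: eq_bigr => k _; apply/esym/mulr1_eq.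
have -> : kappa k = (0 +i* (- (t / lam k)))%C.
  by apply/eqP; rewrite eq_complex /=; apply/andP; split; apply/eqP; ring.
have e0 := d0 k; have l0 := lam_pos k.
have cs := cos2Dsin2 (t / lam k).
(* This identity and the next are the real and imaginary parts of (p + i r) (1 - i s) = 1. *)
have pr : p k + t / lam k * r k = 1.
  by rewrite /p /r; field; rewrite !gt_eqF.
have rp : r k - t / lam k * p k = 0.
  by rewrite /p /r; field; rewrite !gt_eqF.
rewrite /cexp /= !oppr0 opprK expR0 !mul1r.
apply/eqP; rewrite eq_complex /= /a /b; move: cs pr rp.
set C := cos _; set S := sin _; move: C S (p k) (r k) (t / lam k) => C S pk rk s cs pr rp.
apply/andP; split; apply/eqP.
  rewrite [LHS](_ : _ = (C ^+ 2 + S ^+ 2) * (pk + s * rk)); last by ring.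
  by rewrite cs pr mulr1.
rewrite [LHS](_ : _ = (C ^+ 2 + S ^+ 2) * (rk - s * pk)); last by ring.
by rewrite rp mulr0.
Qed.

Lemma cvg_det2_product (kappa := fun k => (- (0 +i* t) * ((lam k)^-1)%:C)%C : R[i]) :
  (fun m => \prod_(k < m) ((1 + kappa k) * cexp (- kappa k)) : R[i]^o) @ \oo -->
  ((char_fun U (chi lam) t)^-1 : R[i]^o).
Proof.
under eq_cvg do rewrite det2_partial_product.
by apply: (@cvgV R[i] _ _ _ _ _ char_fun_chi_neq0 z_lim).
Qed.

End characteristic_function.

(** [Rintegral] is [fine] of an extended integral. A positive factor scales positive and negative
    parts alike and keeps infinite values infinite, so non-integrable functions are covered as well;
    the forms of test functions can thus be scaled directly. *)
Lemma RintegralZ_ge0 {R : realType} d (T : measurableType d)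
    (mu : {measure set T -> \bar R}) (A : set T) (c : R) (f : T -> R) :
  measurable A -> measurable_fun A f -> 0 <= c ->
  (\int[mu]_(x in A) (c * f x))%R = c * (\int[mu]_(x in A) f x)%R.
Proof.
move=> mA mf; rewrite le_eqVlt => /predU1P[<-|c0].
  under eq_Rintegral do rewrite mul0r.
  by rewrite mul0r /Rintegral integral0.
have mfE : measurable_fun A (EFin \o f) by exact/measurable_EFinP.
rewrite /Rintegral; under eq_integral do rewrite EFinM.
rewrite integralE [in RHS]integralE.
rewrite ge0_funeposM ?ge0_funenegM ?(ltW c0)//.
rewrite !ge0_integralZl_EFin ?(ltW c0)//; last 2 first.
- exact: measurable_funeneg.
- exact: measurable_funepos.
have : (0 <= \int[mu]_(x in A) (EFin \o f)^\- x)%E by exact: integral_ge0.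
have : (0 <= \int[mu]_(x in A) (EFin \o f)^\+ x)%E by exact: integral_ge0.
rewrite /comp; move: (\int[_]_(_ in _) _)%E (\int[_]_(_ in _) _)%E => [a| |] [b| |]//= _ _;
  rewrite ?gt0_mulye ?gt0_muley ?lte_fin//= ?mulr0 ?mulrBr//.
Qed.

(** * Eigenfunctions of the inverse Laplacian *)

Section laplacian.
Context {R : realType} (D : domain R).
Hypothesis aD : admissible D.
Let mC := measurable_carrier aD.

Lemma C1_continuous (f : E3 R -> R) : C1 f -> continuous f.
Proof. by move=> [df _] x; exact: differentiable_continuous. Qed.

Lemma C1_measurable (f : E3 R -> R) : C1 f -> measurable_fun setT f.
Proof. by move=> /C1_continuous; exact: E3_continuous_measurable. Qed.

Lemma C1_scale (c : R) (f : E3 R -> R) : C1 f -> C1 (fun x => c * f x).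
Proof.
move=> [df cf]; split => [x|v]; first exact: (differentiableZ c (df x)).
rewrite (_ : (fun x => _) = fun x => c * 'D_v f x).
  by move=> x; apply: cvgMr; exact: cf.
by apply/funext => x; rewrite (deriveZ c (diff_derivable (df x))).
Qed.

Lemma C1B (f g : E3 R -> R) : C1 f -> C1 g -> C1 (f \- g).
Proof.
move=> [df cf] [dg cg]; split => [x|v]; first exact: (differentiableB (df x) (dg x)).
rewrite (_ : (fun x => _) = fun x => 'D_v f x - 'D_v g x).
  by move=> x; apply: cvgB; [exact: cf|exact: cg].
by apply/funext => x; rewrite (deriveB (diff_derivable (df x)) (diff_derivable (dg x))).
Qed.

Lemma grad_scale (c : R) (f : E3 R -> R) x : C1 f ->
  grad (fun x => c * f x) x = ((c * (grad f x).1.1, c * (grad f x).1.2), c * (grad f x).2).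
Proof.
move=> [df _]; rewrite /grad/=.
by congr ((_, _), _); rewrite (deriveZ c (diff_derivable (df x))).
Qed.

Lemma measurable_dot_grad (f g : E3 R -> R) : C1 f -> C1 g ->
  measurable_fun setT (fun x => dot3 (grad f x) (grad g x)).
Proof.
move=> [_ cf] [_ cg]; rewrite /dot3/grad/=.
by apply: measurable_funD; [apply: measurable_funD|]; apply: measurable_funM;
  apply: E3_continuous_measurable.
Qed.

Lemma dot_grad_scalel (c : R) (f g : E3 R -> R) x : C1 f ->
  dot3 (grad (fun x => c * f x) x) (grad g x) = c * dot3 (grad f x) (grad g x).
Proof.
move=> Cf; rewrite (grad_scale c x Cf).
by move: (grad f x) (grad g x) => [[u1 u2] u3] [[v1 v2] v3]; rewrite /dot3/=; ring.
Qed.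

Lemma dform_scale (c : R) (f g : E3 R -> R) : 0 <= c -> C1 f -> C1 g ->
  dform D (fun x => c * f x) g = c * dform D f g.
Proof.
move=> c0 Cf Cg; rewrite /dform mulrDr; congr (_ + _).
  under eq_Rintegral do rewrite dot_grad_scalel//.
  by rewrite RintegralZ_ge0//; exact: measurable_funTS (measurable_dot_grad Cf Cg).
case: D aD => [|Lam GamD alpha sigma] /=; first by rewrite mulr0.
move=> [_ _ _ [cG _] [ma _]].
under eq_Rintegral => x _ do rewrite [alpha x * _]mulrCA -mulrA.
rewrite RintegralZ_ge0//; first by apply: measurableC; exact: E3_closed_measurable.
apply: measurable_funTS; apply: measurable_funM; last exact: C1_measurable.
by apply: measurable_funM => //; exact: C1_measurable.
Qed.

Lemma energy_scale (c : R) (f : E3 R -> R) : 0 <= c -> C1 f ->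
  energy D (fun x => c * f x) = c ^+ 2 * energy D f.
Proof.
move=> c0 Cf; rewrite /energy mulrDr; congr (_ + _).
  rewrite -RintegralZ_ge0 ?sqr_ge0//; last exact: measurable_funTS (measurable_dot_grad Cf Cf).
  apply: eq_Rintegral => x _; rewrite (grad_scale c x Cf).
  by move: (grad f x) => [[u1 u2] u3]; rewrite /dot3/=; ring.
case: D aD => [|Lam GamD alpha sigma] /=; first by rewrite mulr0.
move=> [_ _ _ [cG _] [ma _]].
rewrite -RintegralZ_ge0 ?sqr_ge0//; last 2 first.
- by apply: measurableC; exact: E3_closed_measurable.
- apply: measurable_funTS; apply: measurable_funM.
    exact: measurableT_comp.
  by apply: measurable_funX; exact: C1_measurable.
by apply: eq_Rintegral => x _; rewrite exprMn mulrCA.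
Qed.

Lemma test_fun_scale (c : R) (f : E3 R -> R) : test_fun D f -> test_fun D (fun x => c * f x).
Proof.
move=> [Cf df Hf]; split; first exact: C1_scale.
  case: (D) df => [|//] /= df x; have [h1 h2 h3] := df x.
  by split; rewrite ?h1 ?h2 ?h3.
case: (D) Hf => [//|Lam GamD alpha sigma] [U [oU GU U0]].
by exists U; split => // x /U0 ->; rewrite mulr0.
Qed.

Lemma L2fun_scale (c : R) (f : E3 R -> R) : L2fun (carrier D) f ->
  L2fun (carrier D) (fun x => c * f x).
Proof.
move=> [mf fi]; split; first exact: measurable_funM.
under eq_integral do rewrite exprMn EFinM.
rewrite ge0_integralZl_EFin ?sqr_ge0//.
- by rewrite lte_mul_pinfty// lee_fin sqr_ge0.
- by move=> x _; rewrite lee_fin sqr_ge0.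
- by apply/measurable_EFinP; apply: measurable_funX.
Qed.

Lemma L2dot_scalel (c : R) (f g : E3 R -> R) : 0 <= c ->
  measurable_fun (carrier D) f -> measurable_fun (carrier D) g ->
  L2dot (carrier D) (fun x => c * f x) g = c * L2dot (carrier D) f g.
Proof.
move=> c0 mf mg; rewrite /L2dot; under eq_Rintegral do rewrite -mulrA.
by rewrite RintegralZ_ge0//; exact: measurable_funM.
Qed.

(** The approximating test functions are scaled along. The factors in view are [lam^-1], for the
    eigenfunctions, and 0, for their imaginary parts. *)
Lemma neg_laplacian_scale (c : R) (u f : E3 R -> R) : 0 <= c -> neg_laplacian D u f ->
  neg_laplacian D (fun x => c * u x) (fun x => c * f x).
Proof.
move=> c0 [Lu Lf [w [tw wu we wv]]].
split; [exact: L2fun_scale|exact: L2fun_scale|].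
have [mu _] := Lu; have [mf _] := Lf.
have mw n : measurable_fun (carrier D) (w n).
  by apply: measurable_funTS; apply: C1_measurable; have [] := tw n.
exists (fun n x => c * w n x); split.
- by move=> n; exact: test_fun_scale.
- rewrite (_ : (fun n => _) = fun n =>
      c ^+ 2 * L2dot (carrier D) (w n \- u) (w n \- u)).
    by rewrite -[X in _ --> X](mulr0 (c ^+ 2)); exact: cvgMr.
  apply/funext => n; rewrite /L2dot -RintegralZ_ge0 ?sqr_ge0//; last first.
    by apply: measurable_funM; exact: measurable_funB.
  by apply: eq_Rintegral => x _ /=; ring.
- move=> e e0.
  (* The energy is multiplied by [c ^+ 2]; the added 1 covers [c = 0]. *)
  have c1 : 0 < c ^+ 2 + 1 by rewrite ltr_wpDl ?sqr_ge0.
  have [M HM] := we _ (divr_gt0 e0 c1); exists M => m n Mm Mn.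
  rewrite (_ : _ \- _ = fun x => c * (w m \- w n) x); last first.
    by apply/funext => x /=; rewrite mulrBr.
  rewrite energy_scale//; last by apply: C1B; [have [] := tw m|have [] := tw n].
  have := HM m n Mm Mn; rewrite ltr_pdivlMr//.
  have := sqr_ge0 c; move: (energy _ _) (c ^+ 2) => E d0 d00 h.
  have [E0|E0] := ltP E 0; first by apply: le_lt_trans e0; nra.
  nra.
- move=> g tg; rewrite L2dot_scalel//; last first.
    by apply: measurable_funTS; apply: C1_measurable; have [] := tg.
  rewrite (_ : (fun n => _) = fun n => c * dform D (w n) g).
    by apply: cvgMr; exact: wv.
  by apply/funext => n; rewrite dform_scale//; [have [] := tw n|have [] := tg].
Qed.

(** Scaling any pair of the graph by 0 puts the zero pair in it, as the imaginary part of a real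
    eigenfunction requires. *)
Lemma neg_laplacian0 (u f : E3 R -> R) : neg_laplacian D u f ->
  neg_laplacian D (fun=> 0) (fun=> 0).
Proof.
move=> /(neg_laplacian_scale (lexx 0)).
have z (v : E3 R -> R) : (fun x => 0 * v x) = (fun=> 0).
  by apply/funext => x; exact: mul0r.
by rewrite (z u) (z f).
Qed.

Definition complexify (e : nat -> E3 R -> R) (k : nat) : E3 R -> R[i] :=
  fun x => (e k x)%:C%C.

Lemma L2dot0l (u : E3 R -> R) : L2dot (carrier D) (fun=> 0) u = 0.
Proof.
rewrite /L2dot; under eq_Rintegral do rewrite mul0r.
by rewrite /Rintegral integral0.
Qed.

Lemma L2dot0r (u : E3 R -> R) : L2dot (carrier D) u (fun=> 0) = 0.
Proof.
rewrite /L2dot; under eq_Rintegral do rewrite mulr0.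
by rewrite /Rintegral integral0.
Qed.

(** Against real functions the complex inner product splits into those of the real and imaginary
    parts of [u], and completeness is applied to each. *)
Lemma complexify_basis (e : nat -> E3 R -> R) : orthonormal_basis (carrier D) e ->
  corthonormal_basis (carrier D) (complexify e).
Proof.
move=> [Le oe ce].
have reE k : reF (complexify e k) = e k by [].
have imE k : imF (complexify e k) = fun=> 0 by [].
split.
- move=> k; rewrite /cL2fun reE imE; split => //; split; first exact: measurable_cst.
  under eq_integral do rewrite expr0n.
  by rewrite integral0 ltry.
- move=> j k; rewrite /cL2dot !reE !imE !L2dot0l !L2dot0r oe addr0 subr0.
  by case: eqP.
move=> u [Lr Li] uk.
have rk k : L2dot (carrier D) (reF u) (e k) = 0.
  by have [h _] := uk k; move: h; rewrite reE imE L2dot0r addr0.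
have ik k : L2dot (carrier D) (imF u) (e k) = 0.
  by have [_ h] := uk k; move: h; rewrite reE imE L2dot0r subr0.
apply: filterS2 (ce _ Lr rk) (ce _ Li ik) => x h1 h2 Cx.
by move: (h1 Cx) (h2 Cx); rewrite /reF /imF; case: (u x) => a b /= -> ->.
Qed.

(** In the graph of the inverse, [e k] is paired with [lam^-1 * e k], since minus the Laplacian
    sends the latter to [e k]. *)
Lemma inverse_laplacian_eigen (lam t : R) (e : nat -> E3 R -> R) k : 0 < lam ->
  neg_laplacian D (e k) (fun x => lam * e k x) ->
  op_scale (- (0 +i* t)%C) (op_inv (cneg_laplacian D)) (complexify e k)
    (fun x => (- (0 +i* t) * (lam^-1)%:C)%C * complexify e k x).
Proof.
move=> l0 He; exists (fun x => ((lam^-1 * e k x)%:C)%C).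
  split; rewrite /reF /imF /=.
    have := neg_laplacian_scale (ltW (_ : 0 < lam^-1)) He; rewrite invr_gt0 => /(_ l0).
    rewrite (_ : (fun x => lam^-1 * (lam * e k x)) = e k)//.
    by apply/funext => x; rewrite mulKf// gt_eqF.
  exact: neg_laplacian0 He.
by apply/funext => x; rewrite -mulrA /complexify; congr (_ * _); rewrite rmorphM.
Qed.

End laplacian.

(** * The limit theorem *)

(** Reduction to an initial segment: indices outside [s] are constrained by the whole line only,
    which has probability 1. *)
Lemma xi_independent_seq {R : realType} (s : seq nat) (B : nat -> set R) : uniq s ->
  (forall k, measurable (B k)) ->
  @unif01 R [set w | forall k, k \in s -> B k (xi k w)] =
  (\prod_(k <- s) @unif01 R (B k))%E.
Proof.
move=> us mB; pose n := (\max_(k <- s) k).+1.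
have sn k : k \in s -> (k < n)%N by move=> ks; rewrite ltnS; exact: leq_bigmax_seq.
pose B' k := if k \in s then B k else setT.
have mB' k : measurable (B' k) by rewrite /B'; case: ifP.
have := xi_independent n mB'.
rewrite (_ : [set w | _] = [set w | forall k, k \in s -> B k (xi k w)]); last first.
  apply/seteqP; split => w /= H k.
    by move=> ks; have := H k (sn k ks); rewrite /B' ks.
  by move=> _; rewrite /B'; case: ifP => // ks; exact: H.
move=> ->; rewrite -(big_mkord xpredT (fun k => @unif01 R (B' k))).
rewrite [LHS](_ : _ = \prod_(0 <= k < n | k \in s) @unif01 R (B k))%E.
  rewrite -big_filter; apply: perm_big; apply: uniq_perm => //.
    by rewrite filter_uniq// iota_uniq.
  move=> k; rewrite mem_filter mem_iota add0n subn0 andb_idr//.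
  exact: sn.
rewrite [RHS]big_mkcond/=; apply: eq_bigr => k _; rewrite /B'; case: ifP => // _.
exact: probability_setT.
Qed.

Lemma xi_law {R : realType} k (B : set R) : measurable B ->
  @unif01 R (xi k @^-1` B) = @unif01 R B.
Proof.
move=> mB; have := @xi_independent_seq R [:: k] (fun=> B) isT (fun=> mB).
rewrite big_cons big_nil mule1 => <-; congr (@unif01 R _).
apply/seteqP; split => w /= H; last by apply: H; rewrite mem_seq1.
by move=> j; rewrite mem_seq1 => /eqP ->.
Qed.

Section exponential_summands.
Context {R : realType}.
Notation U := (@unif01 R).

Definition expo_summand (lam : nat -> R) (k : nat) (w : R) : R := gexp (lam k) (xi k w).

Lemma measurable_expo_summand (lam : nat -> R) k :
  measurable_fun setT (expo_summand lam k).
Proof. exact: measurableT_comp (measurable_gexp (lam k)) (measurable_xi k). Qed.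

Let mgexp r (A : set R) : measurable A -> measurable (gexp r @^-1` A).
Proof. by move=> mA; rewrite -[X in measurable X]setTI; exact: measurable_gexp. Qed.

Lemma expo_summand_independent (lam : nat -> R) :
  mutually_independent U (expo_summand lam).
Proof.
move=> s A us mA.
have := xi_independent_seq us (fun k => mgexp (lam k) (mA k)).
move=> /= ->; apply: eq_bigr => k _.
by rewrite -(xi_law k (mgexp (lam k) (mA k))).
Qed.

(** The defining integral is the total mass of the exponential law of rate 1, an image of the
    uniform law. *)
Lemma Gamma_fun1 : Gamma_fun (1 : R) = 1.
Proof.
have h : (\int[@leb R]_(x in `[0%R, +oo[) (x `^ (1 - 1) * expR (- x))%:E = 1%:E)%E.
  have U1 : U (gexp 1 @^-1` `[0, +oo[%classic) = 1%E.
    rewrite (_ : _ @^-1` _ = setT); first exact: probability_setT.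
    by apply/seteqP; split => // v _; rewrite /= in_itv/= gexp_ge0.
  apply: etrans U1; apply: etrans (esym (gexp_law ltr01 (measurable_itv _))).
  rewrite /expo; apply: eq_integral => x x0.
  by rewrite subrr powRr0 mul1r /exponential_pdf patchE x0 mul1r mulN1r.
by rewrite /Gamma_fun /Rintegral h.
Qed.

Lemma expo_summand_gamma (lam : nat -> R) k : 0 < lam k ->
  gamma_distributed U (expo_summand lam k) 1 (lam k).
Proof.
move=> l0 A mA; apply: (etrans (xi_law k (mgexp (lam k) mA))).
apply: (etrans (gexp_law l0 mA)); rewrite /expo; apply: eq_integral => x _.
congr EFin; rewrite /gamma_pdf /exponential_pdf patchE Gamma_fun1 divr1.
have -> : (x \in `[0, +oo[%classic) = (0 <= x).
  by apply/idP/idP; rewrite inE/= in_itv/= andbT.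
case: ifP => // _.
by rewrite subrr powRr0 mulr1 powRr1 ?mulNr// ltW.
Qed.

Variable lam : nat -> R.

HB.instance Definition _ k :=
  isMeasurableFun.Build _ _ R R (expo_summand lam k) (measurable_expo_summand lam k).

HB.instance Definition _ :=
  isMeasurableFun.Build _ _ R R (chi lam) (measurable_chi lam).

End exponential_summands.

Lemma critical_density_gt0 {R : realType} (beta : R) : 0 < beta ->
  0 < critical_density beta.
Proof.
move=> b0; rewrite /critical_density mulr_gt0 ?powR_gt0 ?mulr_gt0 ?pi_gt0// /zeta.
(* Convergence has to be known, as [limn] of a divergent sequence carries no information. *)
have c : cvgn (series (fun n => (n.+1%:R : R) `^ (- (3 / 2)))).
  rewrite (_ : 3 / 2 = 1 + 1 / 2 :> R); last by field.
  by apply: cvg_pseries; rewrite divr_gt0.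
apply: (@lt_le_trans _ _ 1) => //.
have := series_le_lim 1 (fun k => powR_ge0 (k.+1%:R : R) (- (3 / 2))) c.
by rewrite /series/= big_nat1 powR1.
Qed.

Section scaling.
Context {R : realType}.
Variables (L : nat -> R) (beta : R).
Hypotheses (L0 : forall n, 0 < L n) (Loo : L @ \oo --> +oo) (b0 : 0 < beta).

Lemma cvg_inverse_temperature : (fun n => beta / L n ^+ 2) @ \oo --> (0 : R).
Proof.
have Li : (fun n => (L n)^-1) @ \oo --> (0 : R).
  by apply/gtr0_cvgV0 => //; near=> n.
rewrite (_ : (fun n => _) = (fun n => beta * ((L n)^-1 * (L n)^-1))); last first.
  by apply/funext => n; rewrite expr2 invfM.
have -> : 0 = beta * (0 * 0) :> R by rewrite !mulr0.
by apply: cvgMr; apply: cvgM.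
Unshelve. all: by end_near. Qed.

(** [h * N] is beta times the critical density times [L]. *)
Lemma cvg_scaled_cutoff (N : nat -> nat) :
  (forall n, critical_density beta * L n ^+ 3 = (N n)%:R) ->
  (fun n => beta / L n ^+ 2 * (N n).+1%:R) @ \oo --> +oo.
Proof.
move=> NE; have bc := mulr_gt0 b0 (critical_density_gt0 b0).
apply/cvgryPge => A; have /cvgryPge/(_ (A / (beta * critical_density beta))) := Loo.
apply: filterS => n; rewrite (ler_pdivrMr _ _ bc) => /le_trans; apply.
rewrite -natr1 -NE mulrDr; apply: (@le_trans _ _ (beta / L n ^+ 2 * (critical_density beta * L n ^+ 3))).
  rewrite le_eqVlt; apply/orP; left; apply/eqP; field.
  by rewrite gt_eqF.
by rewrite lerDl mulr1 divr_ge0 ?sqr_ge0// ltW.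
Qed.

End scaling.

Theorem proposition1p1 (R : realType) (beta : R) (D : domain R)
    (lam : nat -> R) (e : nat -> E3 R -> R)
    (L : nat -> R) (N : nat -> nat)
    (Q : forall n : nat, nat -> R.-ker (E3 R) ~> loop_path D (L n))
    (d : nat -> measure_display) (Omega : forall n, measurableType (d n))
    (P : forall n, probability (Omega n) R)
    (eta : forall n, Omega n -> seq (loop D (L n))) :
  0 < beta ->
  admissible D ->
  laplace_spectrum D lam e ->
  heat_trace_expansion lam ->
  0 < lam 0%N ->
  (forall n, 0 < L n) ->
  (forall n, critical_density beta * L n ^+ 3 = (N n)%:R) ->
  L @ \oo --> +oo ->
  (forall n j, (1 <= j <= N n)%N ->
     brownian_loop_measure lam e (beta * j%:R) (Q n j)) ->
  (forall n, poisson_process (P n) (loop_intensity (N n) (Q n)) (eta n)) ->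
  exists (d' : measure_display) (Omega' : measurableType d')
    (P' : probability Omega' R) (chi : {RV P' >-> R})
    (G : nat -> {RV P' >-> R}),
    [/\ let X n w : R := (particle_number (N n) (eta n w))%:R in
        cvg_in_distribution P
          (fun n w => (X n w - fine 'E_(P n)[X n]) / (beta^-1 * L n ^+ 2))
          P' chi,
        forall t : R, exists2 D2 : R[i],
          is_det2 (carrier D)
            (op_scale (- (0 +i* t)%C) (op_inv (cneg_laplacian D))) D2 &
          char_fun P' chi t = D2^-1,
        mutually_independent P' (fun k => G k : Omega' -> R),
        forall k, gamma_distributed P' (G k) 1 (lam k) &
        {ae P', forall w,
          (fun m => \sum_(k < m) (G k w - (lam k)^-1)) @ \oo --> chi w}].
Proof.
move=> b0 aD spec expansion lam0 L0 NE Loo QB etaP.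
have [onb eig _ _ lamS] := spec.
pose h n := beta / L n ^+ 2.
have h0 n : 0 < h n by rewrite divr_gt0// exprn_gt0.
have zfin := heat_trace_lty lam0 lamS expansion.
pose x n j := fine (heat_trace lam (h n * j%:R)) / j%:R.
have x0 n j : 0 <= x n j by rewrite divr_ge0// fine_ge0// heat_trace_ge0.
have mux n j : (0 < j <= N n)%N ->
    loop_intensity (N n) (Q n) [set l | l.1 = j] = (x n j)%:E.
  move=> /andP[j0 jN].
  rewrite (loop_intensity_length (L0 n) b0 aD spec zfin (QB n)) ?j0//.
  have hj : 0 < h n * j%:R by rewrite mulr_gt0// ltr0n.
  rewrite mulrAC -[(heat_trace _ _)]fineK; last first.
    by rewrite ge0_fin_numE ?heat_trace_ge0// zfin.
  by rewrite -EFinM mulrC.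
have lX n m : P n [set w | particle_number (N n) (eta n w) = m] =
    (bose_gas_pmf lam (h n) (N n) m)%:E.
  exact: (particle_number_law (mux n) (etaP n)).
have mX n m := measurable_particle_number (N n) (etaP n) m.
have EX n : fine (\int[P n]_w ((particle_number (N n) (eta n w))%:R)%:E)%E =
    \sum_(1 <= j < (N n).+1) fine (heat_trace lam (h n * j%:R)).
  rewrite (particle_number_mean (x0 n) (mux n) (etaP n)) /=.
  rewrite big_nat_cond [RHS]big_nat_cond; apply: eq_bigr => j /andP[/andP[j0 _] _].
  by rewrite /x mulrC divfK// pnatr_eq0 -lt0n.
(* The limit and its Gamma variables share the unit interval, where they are functions of the
   independent uniform variables [xi k]. *)
exists _, R, (@unif01 R), (chi lam), (expo_summand lam); split.
- move=> X f fc [M fM].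
  have lim := bose_gas_limit lam0 lamS expansion h0 (cvg_inverse_temperature beta L0 Loo)
    (cvg_scaled_cutoff L0 Loo b0 NE) mX lX fc fM.
  have mf : measurable_fun setT f by exact: continuous_measurable_fun.
  have fin d' (T : measurableType d') (P' : probability T R) (Y : T -> R) :
      measurable_fun setT Y -> ((\int[P']_w (f (Y w))%:E) \is a fin_num)%E.
    move=> mY; apply: integrable_fin_num => //.
    by apply: (integrable_bounded P' (M := M)) => //; exact: measurableT_comp.
  rewrite unlock /comp -(fineK (fin _ _ _ _ (measurable_chi lam))).
  rewrite [X in X @ _ --> _](_ : _ = fun n => (fine (\int[P n]_w (f (h n *
      ((particle_number (N n) (eta n w))%:R - \sum_(1 <= j < (N n).+1)
        fine (heat_trace lam (h n * j%:R)))))%:E))%:E).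
    exact: cvg_EFinT.
  apply/funext => n; rewrite fineK; last first.
    apply: (fin _ _ (P n)).
    exact: (@measurable_nat_comp _ _ _ R _ (fun k => h n * (k%:R - _)) (mX n)).
  apply: eq_integral => w _; rewrite /= EX; congr (f _)%:E.
  (* Dividing by [beta^-1 * L n ^+ 2] is multiplying by [h n]. *)
  by rewrite mulrC invfM invrK.
(* The witness for the determinant is the inverse of the characteristic function, to which the
   partial products converge; the eigenvalues - i t / lam_k are square-summable by
   [cvg_sum_lam_sqr]. *)
- move=> t; exists (char_fun (@unif01 R) (chi lam) t)^-1; last by rewrite invrK.
  exists (fun k => (- (0 +i* t) * ((lam k)^-1)%:C)%C), (complexify e); split.
  + exact: complexify_basis.
  + by move=> k; apply: inverse_laplacian_eigen => //; exact: lam_gt0.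
  + rewrite (_ : (fun k => _) = (fun k => t ^+ 2 * (lam k ^+ 2)^-1)).
      by apply: is_cvg_seriesZ; exact: cvg_sum_lam_sqr.
    by apply/funext => k /=; rewrite -exprVn; ring.
  + exact: cvg_det2_product.
- exact: expo_summand_independent.
- by move=> k; apply: expo_summand_gamma; exact: lam_gt0.
exact: (random_series_ae (measurable_centered_exp lam) (centered_exp_sqr lam0 lamS)
  (cvg_var_bound lam0 lamS expansion)).
Qed.
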